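(* Let $m\ge 3$ and let $k$ be a non-zero real constant. There does not exist any Hopf hypersurface $M$ in the complex two-plane Grassmannian $G_2(\mathbb{C}^{m+2})$ satisfying $(\widehat\nabla^{(k)}_XS)Y=(\nabla_XS)Y$ for arbitrary tangent vector fields $X$ and $Y$ on $M$.
   Context: $G_2(\mathbb{C}^{m+2})$ is the set of complex two-dimensional linear subspaces of $\mathbb{C}^{m+2}$ with its $SU(m+2)$-invariant Riemannian metric $g$, normalized so that the maximal sectional curvature is $8$. It carries a Kähler structure $J$. Let $M$ be a real hypersurface (real codimension one) with induced metric $g$, local unit normal $N$, shape operator $A$, and Levi-Civita connection $\nabla$. The Reeb vector field is $\xi=-JN$, $\eta(X)=g(X,\xi)$, and the structure tensor $\phi$ is defined by letting $\phi X$ be the tangential part of $JX$. $M$ is a Hopf hypersurface if $\xi$ is principal: $A\xi=\alpha\xi$ with $\alpha=g(A\xi,\xi)$. The Ricci tensor is the $(1,1)$-tensor $SX=\sum_{i=1}^{4m-1}R(X,e_i)e_i$ for a local orthonormal frame $\{e_i\}$ of $M$. For a non-zero real constant $k$, the generalized Tanaka-Webster (GTW) connection on $M$ is $$\widehat\nabla^{(k)}_XY=\nabla_XY+g(\phi AX,Y)\xi-\eta(Y)\phi AX-k\eta(X)\phi Y,$$ and $(\widehat\nabla^{(k)}_XS)Y=\widehat\nabla^{(k)}_X(SY)-S(\widehat\nabla^{(k)}_XY)$. *)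

(* Defs.v *)
From HB Require Import structures.
From mathcomp Require Import all_boot all_order all_algebra.
From mathcomp Require Import spectral complex.
From mathcomp Require Import all_classical all_reals all_analysis.
Set Implicit Arguments.
Unset Strict Implicit.
Unset Printing Implicit Defensive.
Import Order.TTheory GRing.Theory Num.Theory numFieldNormedType.Exports.
Local Open Scope classical_set_scope.
Local Open Scope ring_scope.
Local Open Scope sesquilinear_scope.

Section SmoothMaps.
Variables (R : realType) (d : nat).
Implicit Types (V : normedModType R) (U : set 'rV[R]_d).

Definition iter_deriv V (s : seq 'rV[R]_d) (f : 'rV[R]_d -> V) :=
  foldr (fun v g => fun u => 'D_v g u) f s.

(* C^oo on the open set U: all iterated directional derivatives exist on U
   and are differentiable there.                                            *)
Definition smooth_on V U (f : 'rV[R]_d -> V) :=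
  forall (s : seq 'rV[R]_d) (u : 'rV[R]_d), U u ->
    differentiable (iter_deriv s f) u.

(* R[i] carries no normed-space structure over R in the library, so maps into
   complex matrices are differentiated through their real coordinates.       *)
Definition smooth_mx_on n U (F : 'rV[R]_d -> 'M[R[i]]_n) :=
  forall a b, smooth_on U (fun u => complex.Re (F u a b) : R) /\
              smooth_on U (fun u => complex.Im (F u a b) : R).

Definition dmx n (F : 'rV[R]_d -> 'M[R[i]]_n) (u v : 'rV[R]_d) : 'M[R[i]]_n :=
  \matrix_(a, b) Complex ('D_v (fun w => complex.Re (F w a b) : R) u)
                         ('D_v (fun w => complex.Im (F w a b) : R) u).

End SmoothMaps.

Section Grassmannian.
Variables (R : realType) (n : nat).
Implicit Types P X Y : 'M[R[i]]_n.

(* A complex two-plane of C^n is represented by its orthogonal projector, P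
   acting on column vectors: the plane is the column space of P.  This makes
   G_2(C^n) a submanifold of the Euclidean space of Hermitian matrices.  Lemma
   grass2_column_space below shows that projectors and planes correspond
   bijectively.                                                              *)
Definition grass2 P := [/\ P *m P = P, P ^t* = P & \rank P = 2%N].

Lemma grass2_column_space p (W : 'M[R[i]]_(n, p)) : \rank W = 2%N ->
  exists! P, grass2 P /\ (P^T == W^T)%MS.
Proof.
have adjM a b c (A : 'M[R[i]]_(a, b)) (B : 'M[R[i]]_(b, c)) : (A *m B) ^t* = B ^t* *m A ^t*.
  by rewrite trmx_mul map_mxM.
have adjK (A : 'M[R[i]]_n) : (A ^t*) ^t* = A.
  by apply/matrixP => i j; rewrite !mxE conjCK.
have adjT (A : 'M[R[i]]_n) : A^T ^t* = (A ^t*)^T.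
  by apply/matrixP => i j; rewrite !mxE.
move=> rW; set U := W^T; pose Q := proj_ortho U.
have QQ : Q *m Q = Q by exact: proj_ortho_proj.
have QU : (Q :=: U)%MS by exact: proj_orthoE.
have orthU : (1%:M - Q) *m U ^t* = 0.
  apply/orthomx1P.
  by have := proj_ortho_compl_sub U (1%:M : 'M[R[i]]_n); rewrite mul1mx.
have /submxP[D QD] : (Q <= U)%MS by rewrite QU.
have E : Q ^t* = Q *m Q ^t*.
  apply/eqP; rewrite -subr_eq0 -{1}[Q ^t*]mul1mx -mulmxBl.
  by rewrite {2}QD adjM mulmxA orthU mul0mx.
have Qadj : Q ^t* = Q.
  have := adjM _ _ _ Q (Q ^t*); rewrite -E adjK => F.
  by rewrite E -F.
exists Q^T; split.
  split; last by rewrite trmxK; apply/eqmxP.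
  split; first by rewrite -trmx_mul QQ.
  - by rewrite adjT Qadj.
  - by rewrite mxrank_tr QU mxrank_tr.
move=> P [[PP Padj _]]; rewrite -/U => PU.
have QP : (Q == P^T)%MS by apply/eqmxP/(eqmx_trans QU)/eqmx_sym/eqmxP.
case/andP: QP => /submxP[A QA] /submxP[B PB].
have PtPt : P^T *m P^T = P^T by rewrite -trmx_mul PP.
have Qp : Q *m P^T = Q by rewrite {1}QA -mulmxA PtPt -QA.
have pQ : P^T *m Q = P^T by rewrite {1}PB -mulmxA QQ -PB.
have Qp' : P^T *m Q = Q.
  by rewrite -[RHS]Qadj -[in RHS]Qp adjM adjT Padj Qadj.
by rewrite -Qp' pQ trmxK.
Qed.

(* Linearization of P^2 = P within the Hermitian matrices. *)
Definition grass2_tangent P X := X ^t* = X /\ P *m X + X *m P = X.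

(* The trace form is invariant under X |-> U X U^*.  A tangent vector at P is
   X = Z + Z^* for a unique complex-linear Z from the plane to its orthogonal
   complement, and tr(X^2) = 2 tr(Z^* Z).  In the metric Re tr(Z^* W) the
   maximal sectional curvature is 4, attained on span(Z, iZ) with Z of rank
   one; half of that metric, Re tr(XY) / 4, has maximal sectional curvature 8. *)
Definition gmetric X Y : R := complex.Re (\tr (X *m Y)) / 4.

(* Z |-> i Z on the complex-linear maps Z as above. *)
Definition gJ P X : 'M[R[i]]_n := Complex 0 1 *: (X *m P - P *m X).

(* Orthogonal projection of Hermitian matrices onto the tangent space at P;
   composed with the flat derivative it is the Levi-Civita connection of the
   Riemannian submanifold G_2(C^n).                                          *)
Definition gproj P X : 'M[R[i]]_n :=
  P *m X *m (1%:M - P) + (1%:M - P) *m X *m P.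

Definition gnabla d (F : 'rV[R]_d -> 'M[R[i]]_n) (V : 'rV[R]_d -> 'M[R[i]]_n)
    (u x : 'rV[R]_d) : 'M[R[i]]_n := gproj (F u) (dmx V u x).

End Grassmannian.

(* Riemannian geometry of a coordinate domain whose metric is induced by an
   immersion F into the Grassmannian.  Tangent vectors and vector fields of the
   hypersurface are given by their components in the coordinate frame, so the
   tangent vector x at u is the ambient vector dmx F u x.                    *)
Section Patch.
Variables (R : realType) (n d : nat).
Variable F : 'rV[R]_d -> 'M[R[i]]_n.
Implicit Types (u x y : 'rV[R]_d) (X Y Z : 'rV[R]_d -> 'rV[R]_d).

Definition met u x y : R := gmetric (dmx F u x) (dmx F u y).

Definition coord_vec (i : 'I_d) : 'rV[R]_d := delta_mx 0 i.

Definition gram u : 'M[R]_d :=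
  \matrix_(i, j) met u (coord_vec i) (coord_vec j).

Definition christoffel u (l i j : 'I_d) : R :=
  2^-1 * \sum_k invmx (gram u) l k *
    ('D_(coord_vec i) (fun w => gram w j k : R) u +
     'D_(coord_vec j) (fun w => gram w i k : R) u -
     'D_(coord_vec k) (fun w => gram w i j : R) u).

(* The Levi-Civita connection of the induced metric. *)
Definition nabla X Y u : 'rV[R]_d :=
  'D_(X u) Y u +
  \row_l \sum_i \sum_j christoffel u l i j * X u 0 i * Y u 0 j.

Definition lie_bracket X Y u : 'rV[R]_d := 'D_(X u) Y u - 'D_(Y u) X u.

Definition curvature X Y Z u : 'rV[R]_d :=
  nabla X (nabla Y Z) u - nabla Y (nabla X Z) u - nabla (lie_bracket X Y) Z u.

Definition ricci (e : 'I_d -> 'rV[R]_d -> 'rV[R]_d) X u : 'rV[R]_d :=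
  \sum_i curvature X (e i) (e i) u.

Definition orthonormal_frame (U : set 'rV[R]_d)
    (e : 'I_d -> 'rV[R]_d -> 'rV[R]_d) :=
  (forall i, smooth_on U (e i)) /\
  (forall u, U u -> forall i j, met u (e i u) (e j u) = (i == j)%:R).

(* Components of the orthogonal projection of the ambient vector V onto the
   tangent space of the hypersurface.                                        *)
Definition tangential u (V : 'M[R[i]]_n) : 'rV[R]_d :=
  (\row_j gmetric V (dmx F u (coord_vec j))) *m invmx (gram u).

Definition unit_normal (U : set 'rV[R]_d) (N : 'rV[R]_d -> 'M[R[i]]_n) :=
  smooth_mx_on U N /\
  (forall u, U u -> [/\ grass2_tangent (F u) (N u), gmetric (N u) (N u) = 1 &
                        forall x, gmetric (N u) (dmx F u x) = 0]).

Definition phi u x : 'rV[R]_d := tangential u (gJ (F u) (dmx F u x)).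

Variable N : 'rV[R]_d -> 'M[R[i]]_n.

Definition shape u x : 'rV[R]_d := - tangential u (gnabla F N u x).

(* - J N is tangent to the hypersurface. *)
Definition xi u : 'rV[R]_d := tangential u (- gJ (F u) (N u)).

Definition eta u x : R := met u x (xi u).

Definition gtw (k : R) X Y u : 'rV[R]_d :=
  nabla X Y u + met u (phi u (shape u (X u))) (Y u) *: xi u
  - eta u (Y u) *: phi u (shape u (X u)) - (k * eta u (X u)) *: phi u (Y u).

End Patch.

(* (nab_X S) Y for an operator S on vector fields. *)
Definition cov_op (R : realType) (d : nat)
    (nab : ('rV[R]_d -> 'rV[R]_d) -> ('rV[R]_d -> 'rV[R]_d) ->
           'rV[R]_d -> 'rV[R]_d)
    (S : ('rV[R]_d -> 'rV[R]_d) -> 'rV[R]_d -> 'rV[R]_d)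
    (X Y : 'rV[R]_d -> 'rV[R]_d) (u : 'rV[R]_d) : 'rV[R]_d :=
  nab X (S Y) u - S (nab X Y) u.

Definition hdim (m : nat) : nat := (4 * m).-1.

(* An immersed real hypersurface of G_2(C^(m+2)): a nonempty Hausdorff second
   countable smooth manifold of real dimension 4m-1, given by an atlas, with a
   smooth immersion.  par i is the inverse of the chart map coord i from the
   open set dom i onto the open set img i; their values elsewhere are
   irrelevant.                                                               *)
Record hypersurface (R : realType) (m : nat) := Hypersurface {
  carrier : topologicalType;
  carrier_hausdorff : hausdorff_space carrier;
  carrier_second_countable : @second_countable carrier;
  carrier_nonempty : [set: carrier] !=set0;
  chart_index : Type;
  dom : chart_index -> set carrier;
  img : chart_index -> set 'rV[R]_(hdim m);
  coord : chart_index -> carrier -> 'rV[R]_(hdim m);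
  par : chart_index -> 'rV[R]_(hdim m) -> carrier;
  dom_open : forall i, open (dom i);
  img_open : forall i, open (img i);
  dom_cover : forall p, exists i, dom i p;
  coord_img : forall i p, dom i p -> img i (coord i p);
  par_dom : forall i u, img i u -> dom i (par i u);
  coordK : forall i p, dom i p -> par i (coord i p) = p;
  parK : forall i u, img i u -> coord i (par i u) = u;
  coord_continuous : forall i p, dom i p -> {for p, continuous (coord i)};
  par_continuous : forall i u, img i u -> {for u, continuous (par i)};
  transition_smooth : forall i j,
    smooth_on (img i `&` par i @^-1` dom j) (coord j \o par i);
  immersion : carrier -> 'M[R[i]]_(m + 2);
  immersion_grass : forall p, grass2 (immersion p);
  immersion_smooth : forall i, smooth_mx_on (img i) (immersion \o par i);
  immersion_inj : forall i u, img i u ->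
    forall x, dmx (immersion \o par i) u x = 0 -> x = 0
}.

Section Hypersurface.
Variables (R : realType) (m : nat) (M : hypersurface R m).

Definition patch (i : chart_index M) := @immersion R m M \o @par R m M i.

(* Local unit normals and local orthonormal tangent frames, one for each chart
   domain; no compatibility is required on overlaps.  Every hypersurface has an
   atlas whose chart domains carry such normals and frames.                  *)
Definition local_normals
    (N : chart_index M -> 'rV[R]_(hdim m) -> 'M[R[i]]_(m + 2)) :=
  forall i, unit_normal (patch i) (img i) (N i).

Definition local_frames
    (e : chart_index M -> 'I_(hdim m) -> 'rV[R]_(hdim m) -> 'rV[R]_(hdim m)) :=
  forall i, orthonormal_frame (patch i) (img i) (e i).

Definition hopf (N : chart_index M -> 'rV[R]_(hdim m) -> 'M[R[i]]_(m + 2)) :=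
  forall i u, img i u ->
    let F := patch i in
    let xiu := xi F (N i) u in
    let alpha := met F u (shape F (N i) u xiu) xiu in
    shape F (N i) u xiu = alpha *: xiu.

Definition ricci_gtw_eq_lc (k : R)
    (N : chart_index M -> 'rV[R]_(hdim m) -> 'M[R[i]]_(m + 2))
    (e : chart_index M -> 'I_(hdim m) -> 'rV[R]_(hdim m) -> 'rV[R]_(hdim m)) :=
  forall i X Y, smooth_on (img i) X -> smooth_on (img i) Y ->
    forall u, img i u ->
    let F := patch i in
    let S := ricci F (e i) in
    cov_op (gtw F (N i) k) S X Y u = cov_op (nabla F) S X Y u.

End Hypersurface.

(* Main.v *)
(* Planes are orthogonal projectors P, so a tangent vector is a Hermitian matrix
   anticommuting with the reflection s = 1 - 2 P, and the second derivative
   D_Y (dF Z) of the immersion has normal part g(A Y, Z) N + s (Y Z + Z Y).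
   Gauss' equation, traced with the completeness relation of an orthonormal
   frame, gives the Ricci operator
     S X = (4 m + 8) X - T X + 2 L X + (tr A) A X - A^2 X,
   where T X = N^2 X + X N^2 and L X = N X N.  Differentiating the Hopf condition
   g(D_X N, xi) = - alpha eta(X) once more and antisymmetrizing gives
     A phi A - (alpha / 2) (A phi + phi A) = phi T  orthogonally to xi.

   Equality of the two derivatives of S means that S commutes with the
   difference of the two connections; hence S phi = phi S, S xi = sigma xi and
   A (S - sigma) = 0.  Then xi is an eigenvector of T - 2 L, which forces
   N^3 = c N with c = 2 / rank (P N^2) in {1, 2}.  In either case T and L are
   explicit and A satisfies quadratic equations on their eigenspaces.  Comparing
   traces is contradictory; for c = 1 it leads to 4 q^3 - 45 q - 27 = 0 with
   q = m - 3, which has no natural root. *)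
Require Import Defs.
From mathcomp Require Import all_boot all_order all_algebra.
From mathcomp Require Import spectral complex ring lra zify reals.
Set Implicit Arguments.
Unset Strict Implicit.
Unset Printing Implicit Defensive.
Import Order.TTheory GRing.Theory Num.Theory.
Local Open Scope ring_scope.
Local Open Scope sesquilinear_scope.

(** * Real equations to which the two cases are reduced *)

Section RealEquations.
Variable R : realFieldType.

(** Operators act on the right of coordinate rows, so a product of matrices lists its factors in the
    order of application. The Hopf identity becomes usable through [A' = - Phi A Phi], which off
    [xi] is the conjugate of [A] by the structure tensor: there it reads
    [A A' = (al / 2) (A + A') + T], with a symmetric right-hand side, so [A] and [A'] commute. The
    other source of information is [W = S - sigma]: besides [A W = 0] it satisfies [W T = 0]. For
    [c = 1] the operator [T] is invertible, so [W = 0] and [A ^ 2] is known everywhere. For [c = 2]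
    it has a kernel, on which [W] is not controlled; this is the obstacle in that case. Nothing is
    diagonalized. Eigenspaces of [T] and [L] are represented by projectors, identities are proved
    for an arbitrary block of rows [v], and [v] is then taken to be a projector; multiplicities
    enter as traces of projectors. *)

Lemma rank2_root_cases (h al lam : R) : lam ^+ 2 = h * lam - (h * al - al ^+ 2) ->
  lam = al \/ lam = h - al.
Proof.
move=> E; have /eqP : (lam - al) * (lam - (h - al)) = 0.
  by lra.
by rewrite mulf_eq0 !subr_eq0 => /orP[] /eqP; [left|right].
Qed.

(** [h] is known only through [h * al], so the relations are multiplied by powers of [al] until only
    [t = al ^+ 2 >= 0] remains. The root [lam = al] gives [(t + 4) ^ 2 = (t + 4) (t + 8)]; the root
    [lam = h - al] gives [4 t ^ 2 + 80 t + 512 = 0]. *)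
Lemma rank2_mixed_absurd (h al lam mu : R) (p := h * al - al ^+ 2) :
  h * al = 2 * al ^+ 2 + 8 ->
  lam ^+ 2 = h * lam - p -> mu ^+ 2 = h * mu - (p - 4) ->
  lam * mu = al / 2 * (lam + mu) + 2 -> False.
Proof.
rewrite {}/p => hal lamE muE lammu; have t0 : 0 <= al ^+ 2 by apply: sqr_ge0.
have al2mu : al ^+ 2 * mu ^+ 2 = (h * al) * (al * mu) - al ^+ 2 * (h * al - al ^+ 2 - 4).
  by rewrite muE; ring.
case: (rank2_root_cases lamE) => lamv; rewrite lamv in lammu.
  have almu : al * mu = al ^+ 2 + 4 by lra.
  have : (al * mu) ^+ 2 = (h * al) * (al * mu) - al ^+ 2 * (h * al - al ^+ 2 - 4).
    by rewrite -al2mu; ring.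
  by rewrite almu hal; nra.
have e : mu * (al ^+ 2 + 16) = al * (al ^+ 2 + 12).
  have : al * ((h - al) * mu) = al * (al / 2 * (h - al + mu) + 2) by rewrite lammu.
  have -> : al * ((h - al) * mu) = (h * al) * mu - al ^+ 2 * mu by ring.
  have -> : al * (al / 2 * (h - al + mu) + 2) =
    al / 2 * (h * al) - al / 2 * al ^+ 2 + al ^+ 2 / 2 * mu + 2 * al by field.
  rewrite hal; lra.
have : (mu * (al ^+ 2 + 16)) ^+ 2 =
  h * (mu * (al ^+ 2 + 16)) * (al ^+ 2 + 16) - (h * al - al ^+ 2 - 4) * (al ^+ 2 + 16) ^+ 2.
  by rewrite exprMn muE; ring.
rewrite e.
have -> : h * (al * (al ^+ 2 + 12)) = (2 * al ^+ 2 + 8) * (al ^+ 2 + 12) by rewrite mulrA hal.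
rewrite hal.
rewrite exprMn; move: (al ^+ 2) t0 => t t0; nra.
Qed.

(** From [n = 4] on, [4 n ^ 3 >= 64 n > 45 n + 27]; the smaller values are inspected. *)
Lemma cubic_no_nat_root (n : nat) : 4 * (n%:R : R) ^+ 3 <> 45 * n%:R + 27.
Proof.
move=> E; have : (4 * (n * (n * n)) = 45 * n + 27)%N.
  by apply/eqP; rewrite -(eqr_nat R) natrD !natrM; apply/eqP; rewrite -E; ring.
have [|n4] := leqP n 3; first by case: n {E} => [|[|[|[|n]]]].
have : (16 <= n * n)%N by apply: (leq_mul n4 n4).
move: (n * n)%N => s; nia.
Qed.

(** Here [n] stands for [m - 3], and the last hypothesis is [\tr A] split over spaces of dimension
    [1], [3], [3] and [4 m - 8]. The root [lam = al] would force [z ^+ 2 = - 1]. For [lam = h - al]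
    the trace gives [3 mu = - 4 n z], after which the other relations are two linear equations in
    [z ^+ 2]; eliminating it leaves the cubic. *)
Lemma rank2_equal_absurd (h al lam mu z : R) (n : nat) (p := h * al - al ^+ 2) :
  z ^+ 2 = al * z + 1 -> h - al = - 2 * z ->
  lam ^+ 2 = h * lam - p -> mu ^+ 2 = h * mu - (p - 4) ->
  lam * mu = al / 2 * (lam + mu) + 2 ->
  h = al + 3 * lam + 3 * mu + z * (4 * (n%:R + 3) - 8) -> False.
Proof.
rewrite {}/p => zE hE lamE muE lammu trE.
have t0 : 0 <= al ^+ 2 by apply: sqr_ge0.
have z0 : 0 <= z ^+ 2 by apply: sqr_ge0.
have h_ : h = al - 2 * z by lra.
have alz : al * z = z ^+ 2 - 1 by lra.
case: (rank2_root_cases lamE) => lamv; rewrite lamv in lammu.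
  have almu : al * mu = al ^+ 2 + 4 by lra.
  have : (al * mu) ^+ 2 = (h * al) * (al * mu) - al ^+ 2 * (h * al - al ^+ 2 - 4).
    by rewrite exprMn muE; ring.
  rewrite almu.
  have -> : h * al = al ^+ 2 - 2 * (al * z) by rewrite h_; ring.
  rewrite alz; nra.
have mu3 : 3 * mu = - 4 * n%:R * z.
  by move: trE; rewrite lamv h_; lra.
have e1 : (10 * n%:R + 3) * z ^+ 2 = 2 * n%:R + 9.
  have : 3 * ((h - al) * mu) = 3 * (al / 2 * (h - al + mu) + 2) by rewrite lammu.
  have -> : 3 * ((h - al) * mu) = (h - al) * (3 * mu) by ring.
  have -> : 3 * (al / 2 * (h - al + mu) + 2) = 3 * al / 2 * (h - al) + al / 2 * (3 * mu) + 6 by field.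
  rewrite mu3 hE.
  have -> : 3 * al / 2 * (- 2 * z) + al / 2 * (- 4 * n%:R * z) + 6 = - (3 + 2 * n%:R) * (al * z) + 6.
    by field.
  rewrite alz; lra.
have e2 : (8 * n%:R ^+ 2 - 6 * n%:R - 9) * z ^+ 2 = 6 * n%:R + 9.
  have : (3 * mu) ^+ 2 = 3 * h * (3 * mu) - 9 * (h * al - al ^+ 2 - 4).
    by rewrite exprMn muE; ring.
  rewrite mu3 h_.
  have -> : 3 * (al - 2 * z) * (- 4 * n%:R * z) = - 12 * n%:R * (al * z) + 24 * n%:R * z ^+ 2 by ring.
  have -> : (al - 2 * z) * al - al ^+ 2 = - 2 * (al * z) by ring.
  rewrite alz; lra.
apply: (@cubic_no_nat_root n).
have : (8 * n%:R ^+ 2 - 6 * n%:R - 9) * ((10 * n%:R + 3) * z ^+ 2) =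
  (10 * n%:R + 3) * ((8 * n%:R ^+ 2 - 6 * n%:R - 9) * z ^+ 2) :> R by ring.
rewrite e1 e2; lra.
Qed.

(** The two expressions are the coefficients [x], [y] of a relation [x (v A) + y v = 0] that must
    not be vacuous. In terms of [q] the first one factors as [(h - al) (q - 4 - tau)], and modulo it
    the second is [tau ^+ 2 - q (q - 4)]: this is [4] if [h = al], and [- 4 tau] if
    [q = 4 + tau]. *)
Lemma rank2_scalar_nondegenerate (h al : R) (tau := 2 + al ^+ 2 / 4)
  (p := h * al - al ^+ 2)
  (c1 := h * al / 2 - (p - 4) - al ^+ 2 / 4)
  (c0 := 2 * h + al * (p - 4) / 2 - al) :
  al * (tau + c1) / 2 - c1 * h - c0 = 0 -> al * c0 / 2 + 2 * tau + c1 * p <> 0.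
Proof.
have t0 : 0 <= al ^+ 2 by apply: sqr_ge0.
pose q := h * al / 2 - 3 * al ^+ 2 / 4.
move=> x0 y0.
have E : (h - al) * (q - 4 - tau) = 0.
  by rewrite -[RHS]x0 /q /c1 /c0 /p /tau; field.
have y1 : tau ^+ 2 - q * (q - 4) = 0.
  by rewrite -[RHS]y0 -[LHS](addr0) -(mulr0 (- al / 2)) -E /q /c1 /c0 /p /tau; field.
move/eqP: E; rewrite mulf_eq0 => /orP[]/eqP E.
  have ha : h = al by apply: subr0_eq.
  have /eqP : 4 = 0 :> R by rewrite -y1 /q /tau ha; field.
  by rewrite pnatr_eq0.
have qE : q = 4 + tau by lra.
have : - 4 * tau = 0 by rewrite -y1 qE; ring.
by rewrite /tau; lra.
Qed.
End RealEquations.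

(** * Linear algebra of the shape operator *)

(** After full distribution every remaining product of matrices becomes an opaque atom, so [mxlin]
    only has to check a linear identity, entry by entry. Noncommutative relations are rewritten by
    hand between the two stages. *)
Ltac mxexpand := rewrite
  ?(mulmxDl, mulmxDr, mulmxBl, mulmxBr, mulNmx, mulmxN, =^~scalemxAl, =^~scalemxAr,
    mul1mx, mulmx1, mul0mx, mulmx0, mul_scalar_mx, mul_mx_scalar, mulmxA).
Ltac mxgen := repeat match goal with
  |- context [@mulmx _ ?m ?n ?p ?A ?B] =>
    let x := fresh in set x := (@mulmx _ m n p A B); clearbody x end.
Ltac mxlin := mxgen; apply/matrixP => ? ?; rewrite !mxE /=; first [ring | by field].
Ltac mxring := mxexpand; mxlin.

Section Lincomb.
Variables (R : comRingType) (V : lmodType R).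
(** Closes an equation by writing the difference of its sides as a combination of the differences of
    known equations. *)
Lemma lincomb1 (c : R) (x y z w : V) : x = y -> z - w = c *: (x - y) -> z = w.
Proof. by move=> -> /eqP; rewrite subrr scaler0 subr_eq0 => /eqP. Qed.
Lemma lincomb2 (c d : R) (x y x' y' z w : V) : x = y -> x' = y' ->
  z - w = c *: (x - y) + d *: (x' - y') -> z = w.
Proof.
by move=> -> -> /eqP; rewrite !subrr !scaler0 addr0 subr_eq0 => /eqP.
Qed.
End Lincomb.

Section RealMatrix.
Variable R : realFieldType.

Lemma mxtrace_mulT_ge0 q d (M : 'M[R]_(q, d)) : 0 <= \tr (M *m M^T).
Proof.
by apply: sumr_ge0 => i _; rewrite !mxE; apply: sumr_ge0 => j _; rewrite mxE -expr2 sqr_ge0.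
Qed.

Lemma mulmxT_eq0 q d (M : 'M[R]_(q, d)) : M *m M^T = 0 -> M = 0.
Proof.
move=> M0; apply/matrixP => i j; rewrite mxE.
have := congr1 (fun X : 'M[R]_q => X i i) M0; rewrite !mxE => /eqP.
rewrite psumr_eq0 => [|k _]; last by rewrite mxE -expr2 sqr_ge0.
move=> /allP/(_ j); rewrite mem_index_enum mxE => /(_ isT).
by rewrite -expr2 sqrf_eq0 => /eqP.
Qed.

Lemma scalemx_eq0P q d (c : R) (M : 'M[R]_(q, d)) : c *: M = 0 -> c = 0 \/ M = 0.
Proof. by move/eqP; rewrite scaler_eq0 => /orP[] /eqP; [left|right]. Qed.

(* [p1], [p2] are the two constant terms of the quadratic equations of the
   restrictions of the commuting operators [A] and [B]. *)
Lemma commuting_quadratics q d (A B : 'M[R]_d) (v : 'M[R]_(q, d)) (h al p1 p2 t : R) :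
  v *m A *m A = h *: (v *m A) - p1 *: v ->
  v *m B *m B = h *: (v *m B) - p2 *: v ->
  v *m A *m B = (al / 2) *: (v *m A + v *m B) + t *: v ->
  v *m B *m A = (al / 2) *: (v *m A + v *m B) + t *: v ->
  v *m A *m A *m B = v *m A *m B *m A ->
  v *m B *m B *m A = v *m B *m A *m B ->
  h *: ((al / 2) *: (v *m A + v *m B) + t *: v) - p1 *: (v *m B) =
    (al / 2) *: (h *: (v *m A) - p1 *: v + ((al / 2) *: (v *m A + v *m B) + t *: v))
    + t *: (v *m A) /\
  h *: ((al / 2) *: (v *m A + v *m B) + t *: v) - p2 *: (v *m A) =
    (al / 2) *: (h *: (v *m B) - p2 *: v + ((al / 2) *: (v *m A + v *m B) + t *: v))
    + t *: (v *m B).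
Proof.
move=> AA BB AB BA; rewrite AA BB AB BA => E1 E2; split.
  move: E1; mxexpand; rewrite AA AB BA => E1.
  by apply: (lincomb1 (c := 1) E1); mxlin.
move: E2; mxexpand; rewrite BB AB BA => E2.
by apply: (lincomb1 (c := 1) E2); mxlin.
Qed.

(** In the branch [p = h al / 2], on the eigenvalue [2] of [T], these values turn the symmetric
    relation of [rank1_pair] into a multiple of [a + a' - h v]. *)
Lemma rank1_coefficients (h al : R) : h * al = 2 * al ^+ 2 + 16 ->
  - (al ^+ 2 + 8) / 2 = h * al / 2 - (h * al - al ^+ 2 - 8) - 2 * 2 - al ^+ 2 / 2 /\
  - (- (al ^+ 2 + 8) / 2 * h) = 2 * h * 2 + al * (h * al - al ^+ 2 - 8 + 2) - al * 2.
Proof.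
move=> hal; have halal : al * (h * al) = al * (2 * al ^+ 2 + 16) by rewrite hal.
by split; lra.
Qed.

Lemma rank1_trace_ge0 (al x y : R) :
  - al ^+ 2 / 2 * x + al * (al ^+ 2 + 8) * y = 0 -> 0 <= x ->
  0 <= (al ^+ 2 + 8) * (al * (2^-1 * y)).
Proof.
move=> e x0; have : 0 <= al ^+ 2 * x by rewrite mulr_ge0 ?sqr_ge0.
by lra.
Qed.

(** Multiplied by [al], the trace equation reads [0 = al ^ 2 + (m - 1) (h al) + al y], where no term
    is negative and [h al >= 16]. *)
Lemma rank1_trace_absurd (h al m y : R) : 2 <= m -> h * al = 2 * al ^+ 2 + 16 ->
  0 <= al * y -> h = al + h * m + y -> False.
Proof.
move=> m2 hal y0 E; have al2 : 0 <= al ^+ 2 by apply: sqr_ge0.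
have : 0 <= (m - 2) * (h * al) by apply: mulr_ge0; lra.
have : al * h = al * (al + h * m + y) by rewrite -E.
lra.
Qed.

(** * Consequences of the Hopf identity for [A] and its conjugate *)

Section HopfOperators.
Variables (d : nat) (A Phi T W : 'M[R]_d) (xi : 'rV[R]_d) (al tau : R).
Let Xi := xi^T *m xi.
Definition conjPhi := - (Phi *m A *m Phi).
Local Notation A' := conjPhi.
Hypotheses (Asym : A^T = A) (Phiskew : Phi^T = - Phi) (Tsym : T^T = T)
  (PhiPhi : Phi *m Phi = Xi - 1%:M) (xiPhi : xi *m Phi = 0)
  (xixi : xi *m xi^T = 1%:M) (xiA : xi *m A = al *: xi) (xiT : xi *m T = tau *: xi)
  (TPhi : T *m Phi = Phi *m T)
  (hopfE : A *m Phi *m A = (al / 2) *: (A *m Phi + Phi *m A) + T *m Phi).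

Lemma Phixi : Phi *m xi^T = 0.
Proof. by apply: trmx_inj; rewrite trmx_mul trmxK Phiskew mulmxN xiPhi oppr0 trmx0. Qed.

Lemma Axi : A *m xi^T = al *: xi^T.
Proof. by apply: trmx_inj; rewrite trmx_mul trmxK Asym xiA linearZ /= trmxK. Qed.

Lemma Txi : T *m xi^T = tau *: xi^T.
Proof. by apply: trmx_inj; rewrite trmx_mul trmxK Tsym xiT linearZ /= trmxK. Qed.

Lemma conjPhi_sym : A'^T = A'.
Proof. by rewrite /conjPhi linearN /= !trmx_mul Asym Phiskew mulNmx mulmxN mulmxN opprK mulmxA. Qed.

Lemma conjPhi_xi : A' *m xi^T = 0.
Proof. by rewrite /conjPhi mulNmx -[_ *m xi^T]mulmxA Phixi mulmx0 oppr0. Qed.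

(** [hopfE] multiplied by [Phi] on the right. Each [Phi *m Phi] leaves a sign and a multiple of
    [Xi], which is evaluated because [xi] is an eigenvector of [A] and of [T]. *)
Lemma A_conjPhi : A *m A' = (al / 2) *: (A + A' - al *: Xi) + T - tau *: Xi.
Proof.
have := congr1 (mulmxr Phi) hopfE => /=; mxexpand.
rewrite -[A *m Phi *m Phi]mulmxA -[T *m Phi *m Phi]mulmxA PhiPhi; mxexpand.
rewrite Axi Txi -!scalemxAl -/Xi => E; rewrite /conjPhi; mxexpand; rewrite E.
by mxlin.
Qed.

(** Transposition exchanges the factors of [A *m A'], while the right-hand side of [A_conjPhi] is
    symmetric. *)
Lemma conjPhi_A : A' *m A = (al / 2) *: (A + A' - al *: Xi) + T - tau *: Xi.
Proof.
apply: trmx_inj; rewrite trmx_mul conjPhi_sym Asym A_conjPhi.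
have Xisym : Xi^T = Xi by rewrite trmx_mul trmxK.
move: A' Xi conjPhi_sym Xisym => B X Bsym Xsym.
by apply/matrixP => i j; rewrite -[in LHS]Asym -[in LHS]Bsym -[in LHS]Tsym -[in LHS]Xsym !mxE.
Qed.

(** The inner [Phi *m Phi] also contributes [Xi], but that term vanishes: [A] keeps [xi] on its line
    and [Phi] kills it. *)
Lemma conjPhi_sqr : A' *m A' = - (Phi *m (A *m A) *m Phi).
Proof.
rewrite /conjPhi; mxexpand; rewrite opprK.
rewrite -[Phi *m A *m Phi *m Phi]mulmxA PhiPhi; mxexpand.
by rewrite -[Phi *m A *m xi^T]mulmxA Axi -scalemxAr Phixi scaler0 !mul0mx; mxlin.
Qed.

Section Ortho.
Variables (q : nat) (v : 'M[R]_(q, d)) (t : R).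
Hypotheses (vxi : v *m xi^T = 0) (vT : v *m T = t *: v).

Lemma ortho_Phi2 : v *m Phi *m Phi = - v.
Proof. by rewrite -mulmxA PhiPhi; mxexpand; rewrite vxi mul0mx sub0r. Qed.

Lemma ortho_A : v *m A *m xi^T = 0.
Proof. by rewrite -mulmxA Axi -scalemxAr vxi scaler0. Qed.

Lemma ortho_conjPhi : v *m A' *m xi^T = 0.
Proof. by rewrite -mulmxA conjPhi_xi mulmx0. Qed.

Lemma ortho_Phi : v *m Phi *m xi^T = 0.
Proof. by rewrite -mulmxA Phixi mulmx0. Qed.

Lemma ortho_AA' : v *m A *m A' = (al / 2) *: (v *m A + v *m A') + t *: v.
Proof.
rewrite -mulmxA A_conjPhi; mxexpand; rewrite vT vxi mul0mx.
by mxlin.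
Qed.

Lemma ortho_A'A : v *m A' *m A = (al / 2) *: (v *m A + v *m A') + t *: v.
Proof.
rewrite -mulmxA conjPhi_A; mxexpand; rewrite vT vxi mul0mx.
by mxlin.
Qed.

(** [A'] is a conjugate of [A], so the equation that [A] satisfies on the rows [v Phi] holds for
    [A'] on [v]. *)
Lemma ortho_conjPhi_quadratic (h p : R) :
  v *m Phi *m A *m A = h *: (v *m Phi *m A) - p *: (v *m Phi) ->
  v *m A' *m A' = h *: (v *m A') - p *: v.
Proof.
move=> E; rewrite -mulmxA conjPhi_sqr; mxexpand; rewrite E; mxexpand.
by rewrite ortho_Phi2 /conjPhi; mxexpand; mxlin.
Qed.

End Ortho.

(** [T] commutes with [A] and with [A'], so [v A] and [v A'] stay in the same eigenspace of [T] and
    the product relation applies to them again. The two equations come from computing [v A A A'] and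
    [v A' A' A] in both orders. *)
Lemma hopf_quadratics q (v : 'M[R]_(q, d)) (h p1 p2 t : R) :
  T *m A = A *m T ->
  v *m xi^T = 0 -> v *m T = t *: v ->
  v *m A *m A = h *: (v *m A) - p1 *: v ->
  v *m Phi *m A *m A = h *: (v *m Phi *m A) - p2 *: (v *m Phi) ->
  let a := v *m A in let a' := v *m A' in
  h *: ((al / 2) *: (a + a') + t *: v) - p1 *: a' =
    (al / 2) *: (h *: a - p1 *: v + ((al / 2) *: (a + a') + t *: v)) + t *: a /\
  h *: ((al / 2) *: (a + a') + t *: v) - p2 *: a =
    (al / 2) *: (h *: a' - p2 *: v + ((al / 2) *: (a + a') + t *: v)) + t *: a'.
Proof.
move=> TA vxi vT vAA /(ortho_conjPhi_quadratic vxi) vA'A'.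
have TA' : T *m A' = A' *m T.
  rewrite /conjPhi; mxexpand; rewrite TPhi -[Phi *m T *m A]mulmxA TA.
  by rewrite mulmxA -[Phi *m A *m T *m Phi]mulmxA TPhi mulmxA.
have vAT : v *m A *m T = t *: (v *m A) by rewrite -mulmxA -TA mulmxA vT -scalemxAl.
have vA'T : v *m A' *m T = t *: (v *m A') by rewrite -mulmxA -TA' mulmxA vT -scalemxAl.
have vAxi := ortho_A vxi; have vA'xi := ortho_conjPhi v.
apply: commuting_quadratics => //; first exact: ortho_AA'.
- exact: ortho_A'A.
- by rewrite (ortho_AA' vAxi vAT) (ortho_A'A vAxi vAT).
- by rewrite (ortho_AA' vA'xi vA'T) (ortho_A'A vA'xi vA'T).
Qed.

Hypotheses (WPhi : W *m Phi = Phi *m W) (AW : A *m W = 0) (Wxi : W *m xi^T = 0)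
  (Wsym : W^T = W).

Lemma WA : W *m A = 0.
Proof. by apply: trmx_inj; rewrite trmx_mul Wsym Asym AW trmx0. Qed.

(** Multiplying the Hopf identity by [W] removes every term containing [A], because [W A = 0] and
    [W] commutes with [Phi]. What is left is [W T Phi = 0]; [Phi] can be cancelled off [xi], and on
    [xi] the product [W T] vanishes already. *)
Lemma WT : W *m T = 0.
Proof.
have := congr1 (mulmx W) hopfE; mxexpand.
rewrite WA WPhi -[Phi *m W *m A]mulmxA WA; mxexpand; rewrite addr0 scaler0 add0r.
move=> /esym/(congr1 (mulmxr Phi)) => /=; rewrite mul0mx -mulmxA PhiPhi; mxexpand.
rewrite -[W *m T *m xi^T]mulmxA Txi -scalemxAr Wxi scaler0 mul0mx sub0r => /eqP.
by rewrite oppr_eq0 => /eqP.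
Qed.

Lemma ortho_Xi q (v : 'M[R]_(q, d)) : v *m xi^T = 0 -> v *m Xi = 0.
Proof. by move=> vxi; rewrite mulmxA vxi mul0mx. Qed.

Lemma Xi_tr : Xi^T = Xi.
Proof. by rewrite /Xi trmx_mul trmxK. Qed.

Lemma Xi_trace : \tr Xi = 1.
Proof. by rewrite /Xi mxtrace_mulC xixi mxtrace1. Qed.

Lemma trace_XiA : \tr (Xi *m A) = al.
Proof.
by rewrite /Xi -mulmxA xiA -scalemxAr linearZ /= -/Xi Xi_trace mulr1.
Qed.

Lemma XiT : Xi *m T = tau *: Xi.
Proof. by rewrite /Xi -mulmxA xiT -scalemxAr. Qed.

Lemma XiA_comm : Xi *m A = A *m Xi.
Proof. by rewrite /Xi -mulmxA xiA mulmxA Axi -scalemxAr -scalemxAl. Qed.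

Lemma trace_conjPhi (M : 'M[R]_d) : M *m Phi = Phi *m M -> M *m xi^T = 0 ->
  \tr (M *m A') = \tr (M *m A).
Proof.
move=> MPhi Mxi; rewrite /conjPhi mulmxN linearN /= mulmxA mxtrace_mulC !mulmxA.
rewrite -MPhi -[M *m Phi *m Phi]mulmxA PhiPhi; mxexpand.
by rewrite Mxi !mul0mx sub0r linearN /= opprK.
Qed.

(** * The case [c = 2]: [T] has eigenvalues [4], [2] and [0] *)

Section RankOne.
Variables (h : R) (m : nat).
Hypotheses (m2 : (2 <= m)%N) (tau4 : tau = 4) (trA : \tr A = h)
  (T2 : T *m T = 2 *: T + 8 *: Xi) (trT : \tr T = (4 * m + 4)%:R)
  (Wdef : W = (8 - h * al + al ^+ 2)%:M - T - 4 *: Xi + h *: A - A *m A).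

Let p := h * al - al ^+ 2 - 8.
(** By [T2] the eigenvalues of [T] off [xi] are [2] and [0]; [Pi] and [Pi0] are the projectors onto
    these eigenspaces, and [Pi] has trace [2 m]. *)
Let Pi := 2^-1 *: (T - 4 *: Xi).
Let Pi0 := 1%:M - Xi - Pi.

(** [W] is a polynomial in [A] minus [T + 4 Xi]. It commutes with [A] since both products vanish,
    and so does [Xi]; hence [T] does too. *)
Lemma rank1_TA : T *m A = A *m T.
Proof.
have : W *m A = A *m W by rewrite WA AW.
rewrite Wdef; mxexpand; rewrite XiA_comm => E.
by apply: (lincomb1 (c := -1) E); mxexpand; mxlin.
Qed.

(** [Phi] commutes with [T] and [W], so [A] and [A'] obey the same quadratic equation on these rows.
    The last two relations are the difference and the sum of the two equations of
    [hopf_quadratics]. *)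
Lemma rank1_pair q (v : 'M[R]_(q, d)) t :
  v *m xi^T = 0 -> v *m T = t *: v -> v *m W = 0 ->
  let a := v *m A in let a' := v *m A' in
  [/\ v *m A *m A = h *: (v *m A) - (p + t) *: v,
   (p - h * al / 2) *: (a - a') = 0 &
   (h * al / 2 - p - 2 * t - al ^+ 2 / 2) *: (a + a') +
   (2 * h * t + al * (p + t) - al * t) *: v = 0].
Proof.
move=> vxi vT vW.
have quad (w : 'M[R]_(q, d)) : w *m xi^T = 0 -> w *m T = t *: w -> w *m W = 0 ->
    w *m A *m A = h *: (w *m A) - (p + t) *: w.
  move=> wxi wT; rewrite Wdef; mxexpand; rewrite wT wxi mul0mx => E.
  by apply: (lincomb1 (c := -1) E); rewrite /p; mxexpand; mxlin.
have vAA := quad _ vxi vT vW.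
have vPhiAA : v *m Phi *m A *m A = h *: (v *m Phi *m A) - (p + t) *: (v *m Phi).
  apply: quad; first exact: ortho_Phi.
    by rewrite -mulmxA -TPhi mulmxA vT -scalemxAl.
  by rewrite -mulmxA -WPhi mulmxA vW mul0mx.
have [E1 E2] := hopf_quadratics rank1_TA vxi vT vAA vPhiAA.
split=> //.
  by apply: (lincomb2 (c := 1) (d := -1) E1 E2); mxlin.
by apply: (lincomb2 (c := 1) (d := 1) E1 E2); mxlin.
Qed.

Lemma rank1_Xi_ortho : Pi *m xi^T = 0.
Proof.
rewrite /Pi -scalemxAl mulmxBl Txi -scalemxAl -mulmxA xixi mulmx1 tau4.
by rewrite subrr scaler0.
Qed.

Lemma rank1_PiT : Pi *m T = 2 *: Pi.
Proof. by rewrite /Pi -scalemxAl mulmxBl -scalemxAl T2 XiT tau4; mxlin. Qed.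

Lemma rank1_Pi0_ortho : Pi0 *m xi^T = 0.
Proof. by rewrite /Pi0 !mulmxBl rank1_Xi_ortho -[Xi *m _]mulmxA xixi mul1mx mulmx1 !subrr. Qed.

Lemma rank1_Pi0T : Pi0 *m T = 0.
Proof.
rewrite /Pi0 !mulmxBl rank1_PiT XiT tau4 mul1mx.
by rewrite /Pi; mxlin.
Qed.

Lemma rank1_Pi_tr : Pi^T = Pi.
Proof.
rewrite /Pi; move: Xi Xi_tr => X Xtr.
by rewrite linearZ /= linearB /= linearZ /= Tsym Xtr.
Qed.

Lemma rank1_Pi0_tr : Pi0^T = Pi0.
Proof.
rewrite /Pi0; move: Pi Xi rank1_Pi_tr Xi_tr => P X Ptr Xtr.
by rewrite !linearB /= trmx1 Ptr Xtr.
Qed.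

Lemma rank1_Pi_trace : \tr Pi = (2 * m)%:R.
Proof.
by rewrite /Pi !(linearZ, linearB) /= Xi_trace trT natrD !natrM; field.
Qed.

Lemma rank1_trace : h = al + \tr (Pi *m A) + \tr (Pi0 *m A).
Proof.
rewrite -trace_XiA -!linearD /= -trA; congr (\tr _).
rewrite -!mulmxDl; have -> : Xi + Pi + Pi0 = 1%:M; last by rewrite mul1mx.
by rewrite /Pi0 -[1%:M - Xi - Pi]addrA -opprD [LHS]addrC subrK.
Qed.

Lemma rank1_Pi_neq0 : Pi != 0.
Proof.
apply/eqP => PE; have := rank1_Pi_trace; rewrite PE linear0 => /eqP.
by rewrite eq_sym pnatr_eq0 muln_eq0 /=; case: m m2.
Qed.

Lemma rank1_contra : False.
Proof.
have TA := rank1_TA; have Piperp := rank1_Xi_ortho; have PiT := rank1_PiT.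
have Pi0perp := rank1_Pi0_ortho; have Pi0T := rank1_Pi0T.
have Phi_comm (c c' : R) : (c *: T - c' *: Xi) *m Phi = Phi *m (c *: T - c' *: Xi).
  rewrite mulmxBl mulmxBr -!scalemxAl -!scalemxAr TPhi mulmxA Phixi mul0mx.
  by rewrite -[Xi *m Phi]mulmxA xiPhi mulmx0.
have PiPhi : Pi *m Phi = Phi *m Pi by rewrite /Pi scalerBr scalerA Phi_comm.
have Pi0Phi : Pi0 *m Phi = Phi *m Pi0.
  rewrite /Pi0 mulmxBl mulmxBr PiPhi; congr (_ - _).
  by rewrite mulmxBl mulmxBr mul1mx mulmx1 mulmxA Phixi mul0mx -[Xi *m _]mulmxA xiPhi mulmx0.
have PiW : Pi *m W = 0.
  have := WT; move=> /(congr1 trmx); rewrite trmx_mul trmx0 Wsym Tsym => TW.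
  by apply: (scalerI (_ : (2 : R) != 0)); rewrite ?pnatr_eq0 // scalemxAl -PiT -mulmxA TW mulmx0 scaler0.
have TW : T *m W = 0 by apply: trmx_inj; rewrite trmx_mul trmx0 Wsym Tsym WT.
have Pi0T0 : Pi0 *m T = 0 *: Pi0 by rewrite scale0r.
have [PiAA PiD PiE] := rank1_pair Piperp PiT PiW.
(* [T W = 0] gives no hold on [Pi0 *m W]. The relations are therefore applied to the rows [Pi0 *m A]
   and [Pi0 *m A'], which [W] annihilates. *)
have v1 : Pi0 *m A *m xi^T = 0 by apply: ortho_A.
have v1T : Pi0 *m A *m T = 0 *: (Pi0 *m A) by rewrite -mulmxA -TA mulmxA Pi0T mul0mx scale0r.
have v1W : Pi0 *m A *m W = 0 by rewrite -mulmxA AW mulmx0.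
have v2 : Pi0 *m A' *m xi^T = 0 by apply: ortho_conjPhi.
have TA' : T *m A' = A' *m T.
  rewrite /conjPhi; mxexpand; rewrite TPhi -[Phi *m T *m A]mulmxA TA.
  by rewrite mulmxA -[Phi *m A *m T *m Phi]mulmxA TPhi mulmxA.
have v2T : Pi0 *m A' *m T = 0 *: (Pi0 *m A') by rewrite -mulmxA -TA' mulmxA Pi0T mul0mx scale0r.
have v2W : Pi0 *m A' *m W = 0.
  by rewrite -mulmxA /conjPhi mulNmx -[_ *m Phi *m W]mulmxA -WPhi mulmxA -[Phi *m A *m W]mulmxA AW mulmx0 mul0mx oppr0 mulmx0.
have [E1AA E1D E1E] := rank1_pair v1 v1T v1W.
have [E2AA E2D E2E] := rank1_pair v2 v2T v2W.
have trh := rank1_trace.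
have trPiE : \tr (Pi *m A) = 2^-1 * \tr (Pi *m A + Pi *m A').
  by rewrite linearD /= (trace_conjPhi PiPhi Piperp); field.
have trPi0E : \tr (Pi0 *m A) = 2^-1 * \tr (Pi0 *m A + Pi0 *m A').
  by rewrite linearD /= (trace_conjPhi Pi0Phi Pi0perp); field.
have m2' : 2 <= m%:R :> R by rewrite ler_nat.
have trPi : \tr Pi = 2 * m%:R by rewrite rank1_Pi_trace natrM.
have Pineq0 := rank1_Pi_neq0.
have AA'0 := ortho_AA' Pi0perp Pi0T0; have A'A0 := ortho_A'A Pi0perp Pi0T0.
pose E := A + A'.
have Esym : E^T = E by rewrite /E linearD /= Asym conjPhi_sym.
have Pi0Pi0 : Pi0 *m Pi0 = Pi0.
  rewrite -{2}[Pi0]/(1%:M - Xi - Pi) !mulmxBr mulmx1 ortho_Xi // subr0.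
  by rewrite /Pi -scalemxAr mulmxBr Pi0T -scalemxAr ortho_Xi // scaler0 subrr scaler0 subr0.
have Pi0tr := rank1_Pi0_tr.
clear PiPhi Pi0Phi.
have pdef : p = h * al - al ^+ 2 - 8 by [].
move: p pdef Pi Pi0 Piperp PiT Pi0perp Pi0T PiW Pi0T0 PiAA PiD PiE v1 v1T v1W v2 v2T v2W
  E1AA E1D E1E E2AA E2D E2E trh trPiE trPi0E trPi Pineq0 AA'0 A'A0 Pi0Pi0 Pi0tr.
clear p Pi Pi0 => p pdef Pi Pi0 Piperp PiT Pi0perp Pi0T PiW Pi0T0 PiAA PiD PiE v1 v1T v1W v2 v2T v2W
  E1AA E1D E1E E2AA E2D E2E trh trPiE trPi0E trPi Pineq0 AA'0 A'A0 Pi0Pi0 Pi0tr.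
have [pE|pE] := eqVneq (p - h * al / 2) 0.
(* In this branch the difference relation is vacuous and [A], [A'] cannot be compared; only the sum
   relation and positivity of traces are available. *)
- have hal : h * al = 2 * al ^+ 2 + 16.
    by rewrite -[RHS]addr0 -(mulr0 2) -pE pdef; field.
  have halal : al * (h * al) = al * (2 * al ^+ 2 + 16) by rewrite hal.
  have a8 : 0 < al ^+ 2 + 8 by apply: ltr_wpDl (sqr_ge0 _) _.
  have trE : \tr (Pi *m A) = h * m%:R.
    rewrite trPiE.
    have -> : Pi *m A + Pi *m A' = h *: Pi.
      have: (- (al ^+ 2 + 8) / 2) *: (Pi *m A + Pi *m A' - h *: Pi) = 0.
        rewrite -[RHS]PiE scalerBr scalerA -scaleNr; congr (_ *: _ + _ *: _).
          by rewrite pdef; case: (rank1_coefficients hal).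
        by rewrite pdef; case: (rank1_coefficients hal).
      case/scalemx_eq0P => [/eqP|/subr0_eq //].
      by rewrite mulf_eq0 oppr_eq0 gt_eqF // invr_eq0 pnatr_eq0.
    by rewrite linearZ /= trPi; field.
  (* The sum relations for [Pi0 *m A] and [Pi0 *m A'] add up to an equation in [E = A + A']; its
     trace contains the squared norm of [Pi0 *m E]. *)
  have EE : (- (al ^+ 2) / 2) *: (Pi0 *m E *m E) + (al * (al ^+ 2 + 8)) *: (Pi0 *m E) = 0.
    have pal : p = al ^+ 2 + 8 by rewrite pdef hal; ring.
    move: E1E E2E; rewrite pal hal => E1E E2E.
    by apply: (lincomb2 (c := 1) (d := 1) E1E E2E); rewrite /E; mxexpand; mxlin.
  have trpos : 0 <= al * \tr (Pi0 *m A).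
    have := congr1 mxtrace EE; rewrite mxtrace0 mxtraceD !mxtraceZ => tr1.
    have q0 := mxtrace_mulT_ge0 (Pi0 *m E).
    rewrite trmx_mul Pi0tr Esym mulmxA mxtrace_mulC !mulmxA Pi0Pi0 in q0.
    rewrite trPi0E -mulmxDr -/E.
    rewrite -(pmulr_rge0 _ a8).
    exact: rank1_trace_ge0 tr1 q0.
  by apply: (rank1_trace_absurd m2' hal trpos); rewrite -trE.
have PiDE : Pi *m A = Pi *m A'.
  by case: (scalemx_eq0P PiD) => [e|/subr0_eq //]; rewrite e eqxx in pE.
have D1 : Pi0 *m A *m A = Pi0 *m A *m A'.
  by case: (scalemx_eq0P E1D) => [e|/subr0_eq //]; rewrite e eqxx in pE.
have D2 : Pi0 *m A' *m A = Pi0 *m A' *m A'.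
  by case: (scalemx_eq0P E2D) => [e|/subr0_eq //]; rewrite e eqxx in pE.
(* [D1] and [D2] amount to [Pi0 (A - A') ^ 2 = 0], and [A - A'] is symmetric, so the squared norm of
   [Pi0 (A - A')] vanishes. *)
have Pi0D : Pi0 *m A = Pi0 *m A'.
  apply/subr0_eq; rewrite -mulmxBr; apply: mulmxT_eq0.
  have Dsym : (A - A')^T = A - A' by rewrite (linearB _ A A') /= Asym conjPhi_sym.
  by rewrite trmx_mul Dsym mulmxA !(mulmxBr, mulmxBl) D1 D2 subrr.
have Pi0AA : Pi0 *m A *m A = al *: (Pi0 *m A).
  rewrite D1 AA'0 -Pi0D scale0r addr0 -mulr2n -scaler_nat scalerA.
  by congr (_ *: _); field.
have Pi0A : Pi0 *m A = 0.
  (* The relation [A ^ 2 = al A] on these rows is compared with the quadratic equation of constant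
     term [p = h al - al ^ 2 - 8]; everything but the [8] cancels. *)
  have: 8 *: (Pi0 *m A) = 0.
    move: E1AA; rewrite !Pi0AA -!scalemxAl !Pi0AA => F.
    by apply: (lincomb1 (c := -1) F); rewrite pdef; mxlin.
  by case/scalemx_eq0P => // /eqP; rewrite pnatr_eq0.
have PiAA' : (h - al) *: (Pi *m A) = (al * (h - al) - 4) *: Pi.
  have F := ortho_A'A Piperp PiT; move: F; rewrite -PiDE PiAA => F.
  by apply: (lincomb1 (c := 1) F); rewrite pdef; mxlin.
have [hE|hal] := eqVneq (h - al) 0.
  move: PiAA'; rewrite hE scale0r mulr0 sub0r => /esym/scalemx_eq0P[e|PE].
    by have : (4 : R) = 0 by [rewrite -[RHS]oppr0 -e opprK]; apply/eqP; rewrite pnatr_eq0.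
  by rewrite PE eqxx in Pineq0.
pose lam := (al * (h - al) - 4) / (h - al).
have PiA : Pi *m A = lam *: Pi.
  by apply: (scalerI hal); rewrite PiAA' scalerA /lam; congr (_ *: _); field.
have lamE : (h - al) * (lam - al) = - 4 by rewrite /lam; field.
have lam2 : lam * (lam - al) = 2.
  have F := ortho_A'A Piperp PiT; move: F; rewrite -PiDE PiA -scalemxAl PiA => F.
  have : (lam * (lam - al) - 2) *: Pi = 0.
    by apply: (lincomb1 (c := 1) F); mxlin.
  case/scalemx_eq0P => [/subr0_eq //|PE].
  by rewrite PE eqxx in Pineq0.
(* The trace now reads [h - al = 2 m lam]; together with [lamE] and [lam2] this says [4 m = - 4]. *)
move: trh; rewrite PiA linearZ /= trPi Pi0A linear0 addr0 => trh.
have : 2 * m%:R * (lam * (lam - al)) = - 4.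
  by rewrite -lamE trh; ring.
rewrite lam2 => /eqP; rewrite -subr_eq0 opprK gt_eqF //.
by apply: ltr_wpDl; rewrite ?mulr_ge0 ?ler0n.
Qed.

End RankOne.

(** * The case [c = 1]: [L] has eigenvalues [1], [- 1] and [0] *)

Section RankTwo.
Variables (L : 'M[R]_d) (h : R) (m : nat).
Hypotheses (m3 : (3 <= m)%N) (dE : d.+1 = (4 * m)%N) (trA : \tr A = h)
  (Lsym : L^T = L) (xiL : xi *m L = - xi) (L3 : L *m L *m L = L)
  (LPhi : L *m Phi = - (Phi *m L)) (trL : \tr L = - 1) (trL2 : \tr (L *m L) = 7)
  (Tdef : T = 1%:M + L *m L)
  (Wdef : W = (4 - h * al + al ^+ 2)%:M - T + 2 *: L + h *: A - A *m A).

Let p := h * al - al ^+ 2.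
(** Projectors onto the eigenspaces of [L] for [- 1] (with [xi] taken out), [1] and [0]. The traces
    of [L] and [L ^ 2] give them the ranks [3], [3] and [4 m - 8]; [Phi] anticommutes with [L] and
    exchanges the first two. *)
Let Pia := 2^-1 *: (L *m L - L) - Xi.
Let Pib := 2^-1 *: (L *m L + L).
Let Piu := 1%:M - L *m L.

Lemma Lxi : L *m xi^T = - xi^T.
Proof. by apply: trmx_inj; rewrite trmx_mul trmxK Lsym xiL linearN /= trmxK. Qed.

(** [W T = 0] and [T = 1 + L ^ 2] has the inverse [1 - L ^ 2 / 2], because [L ^ 4 = L ^ 2]. *)
Lemma rank2_W0 : W = 0.
Proof.
have := WT; rewrite Tdef; mxexpand => E.
have E2 := congr1 (mulmxr (L *m L)) E; move: E2 => /=; mxexpand.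
have -> : W *m L *m L *m L = W *m L by rewrite -[in RHS]L3 !mulmxA.
move=> E2; by apply: (lincomb2 (c := 1) (d := - (1/2)) E E2); mxexpand; mxlin.
Qed.

Lemma rank2_AA : A *m A = h *: A + (3 - p)%:M - L *m L + 2 *: L.
Proof.
have := rank2_W0; rewrite Wdef Tdef => E.
by apply: (lincomb1 (c := -1) E); rewrite /p; mxlin.
Qed.

(** [A] commutes with [A ^ 2], hence with [Q = 2 L - L ^ 2]. On the eigenvalues [1], [- 1], [0] of
    [L] the values of [Q] are [1], [- 3], [0]; they are distinct, so interpolation recovers [L] as
    [5/6 Q + 1/6 Q ^ 2]. *)
Lemma rank2_LA : L *m A = A *m L.
Proof.
pose Q := 2 *: L - L *m L.
have QA : Q *m A = A *m Q.
  have : A *m A *m A = A *m (A *m A) by rewrite mulmxA.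
  rewrite rank2_AA /Q; mxexpand => E.
  by apply: (lincomb1 (c := 1) E); mxlin.
have L4 : L *m L *m L *m L = L *m L by rewrite L3.
have LQ : L = (5/6) *: Q + (1/6) *: (Q *m Q).
  by rewrite /Q; mxexpand; rewrite L4 L3; mxlin.
have QQA : Q *m Q *m A = A *m (Q *m Q) by rewrite -mulmxA QA !mulmxA QA.
by clearbody Q; rewrite LQ mulmxDl mulmxDr -!scalemxAl -!scalemxAr QA QQA.
Qed.

Lemma rank2_TA : T *m A = A *m T.
Proof. by rewrite Tdef mulmxDl mulmxDr mul1mx mulmx1 -mulmxA rank2_LA mulmxA rank2_LA mulmxA. Qed.

Lemma rank2_quadratic q (v : 'M[R]_(q, d)) (c : R) : v *m L = c *: v ->
  v *m A *m A = h *: (v *m A) - (p - 3 + c ^+ 2 - 2 * c) *: v.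
Proof.
move=> vL; rewrite -mulmxA rank2_AA; mxexpand; rewrite vL; mxexpand; rewrite vL.
by mxlin.
Qed.

(** [Phi] sends the eigenspace of [L] for [c] to the one for [- c], so the constant terms for [A]
    and [A'] differ by the sign of [c]. *)
Lemma rank2_hopf q (v : 'M[R]_(q, d)) (c : R) : v *m xi^T = 0 -> v *m L = c *: v ->
  let a := v *m A in let a' := v *m A' in
  let t := 1 + c ^+ 2 in
  let p1 := p - 3 + c ^+ 2 - 2 * c in let p2 := p - 3 + c ^+ 2 + 2 * c in
  h *: ((al / 2) *: (a + a') + t *: v) - p1 *: a' =
    (al / 2) *: (h *: a - p1 *: v + ((al / 2) *: (a + a') + t *: v)) + t *: a /\
  h *: ((al / 2) *: (a + a') + t *: v) - p2 *: a =
    (al / 2) *: (h *: a' - p2 *: v + ((al / 2) *: (a + a') + t *: v)) + t *: a'.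
Proof.
move=> vxi vL /=; apply: hopf_quadratics => //; first exact: rank2_TA.
- by rewrite Tdef; mxexpand; rewrite vL; mxexpand; rewrite vL; mxlin.
- exact: rank2_quadratic.
- rewrite (@rank2_quadratic _ _ (- c)).
    by congr (_ - _ *: _); ring.
  by rewrite -mulmxA -[Phi *m L]opprK -LPhi mulmxN mulmxA vL -scalemxAl scaleNr.
Qed.

Lemma rank2_vT q (v : 'M[R]_(q, d)) (c : R) : v *m L = c *: v ->
  v *m T = (1 + c ^+ 2) *: v.
Proof. by move=> vL; rewrite Tdef; mxexpand; rewrite vL; mxexpand; rewrite vL; mxlin. Qed.

Lemma Pia_ortho : Pia *m xi^T = 0.
Proof.
rewrite /Pia; mxexpand; rewrite -!mulmxA Lxi !mulmxN Lxi xixi !mulmx1.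
by mxlin.
Qed.

Lemma Pia_L : Pia *m L = (-1) *: Pia.
Proof.
rewrite /Pia mulmxBl -scalemxAl mulmxBl L3 -[Xi *m L]mulmxA xiL mulmxN.
by rewrite -/Xi; mxlin.
Qed.

Lemma Piu_ortho : Piu *m xi^T = 0.
Proof. by rewrite /Piu; mxexpand; rewrite -!mulmxA Lxi !mulmxN Lxi; mxlin. Qed.

Lemma Piu_L : Piu *m L = 0 *: Piu.
Proof. by rewrite /Piu mulmxBl L3 mul1mx subrr scale0r. Qed.

Lemma Pia_trace : \tr Pia = 3.
Proof. by rewrite /Pia mxtraceD mxtraceZ !raddfN /= mxtraceD raddfN /= trL trL2 Xi_trace; field. Qed.

Lemma Piu_trace : \tr Piu = (4 * m)%:R - 8.
Proof.
rewrite /Piu mxtraceD raddfN /= trL2 mxtrace1 -dE -addn1 natrD; ring.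
Qed.

(** Conjugation by [Phi] carries [Pia] to [Pib], so the trace of [A] over [Pib] is that of [A'] over
    [Pia], and only [Pia] and [Piu] have to be studied. *)
Lemma rank2_trace : h = al + \tr (Pia *m A) + \tr (Pia *m A') + \tr (Piu *m A).
Proof.
have -> : \tr (Pia *m A') = \tr (Pib *m A).
  have <- : - (Phi *m Pia *m Phi) = Pib.
    rewrite /Pia /Pib; mxexpand; rewrite Phixi mul0mx.
    have PL : Phi *m L = - (L *m Phi) by rewrite LPhi opprK.
    rewrite PL; mxexpand; rewrite -[L *m Phi *m L]mulmxA PL; mxexpand.
    rewrite -[L *m L *m Phi *m Phi]mulmxA -[L *m Phi *m Phi]mulmxA PhiPhi; mxexpand.
    by rewrite -[L *m L *m xi^T]mulmxA Lxi; mxexpand; rewrite Lxi; mxexpand; mxlin.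
  by rewrite /conjPhi mulmxN mulNmx !raddfN /= !mulmxA mxtrace_mulC !mulmxA.
rewrite -trace_XiA -!mxtraceD -trA -!mulmxDl.
congr (\tr _); have -> : Xi + Pia + Pib + Piu = 1%:M; last by rewrite mul1mx.
by rewrite /Pia /Pib /Piu; mxlin.
Qed.

Lemma rank2_conjPhi_quadratic q (v : 'M[R]_(q, d)) (c : R) :
  v *m xi^T = 0 -> v *m L = c *: v ->
  v *m A' *m A' = h *: (v *m A') - (p - 3 + c ^+ 2 + 2 * c) *: v.
Proof.
move=> vxi vL; apply: ortho_conjPhi_quadratic => //.
rewrite (@rank2_quadratic _ _ (- c)).
  by congr (_ - _ *: _); ring.
by rewrite -mulmxA -[Phi *m L]opprK -LPhi mulmxN mulmxA vL -scalemxAl scaleNr.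
Qed.

(** The second Hopf equation expresses [v A'] through [v A] and [v], the coefficient [tau'] of
    [v A'] being positive; this is the origin of [c1] and [c0]. Multiplying by [A] and reducing with
    the quadratic and product relations leaves [x (v A) + y v = 0], where [x] is nonzero by
    [rank2_scalar_nondegenerate]. *)
Lemma rank2_Pia_scalar : exists lam mu : R,
  [/\ Pia *m A = lam *: Pia, Pia *m A' = mu *: Pia,
      lam ^+ 2 = h * lam - p, mu ^+ 2 = h * mu - (p - 4) &
      lam * mu = al / 2 * (lam + mu) + 2].
Proof.
have Pn0 : Pia != 0.
  by apply/eqP => P0; move: Pia_trace; rewrite P0 mxtrace0 => /esym/eqP; rewrite pnatr_eq0.
have PL := Pia_L; have Pxi := Pia_ortho; have PT := rank2_vT PL.
have [_ E2] := rank2_hopf Pxi PL.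
have AA := rank2_quadratic PL; have A'A' := rank2_conjPhi_quadratic Pxi PL.
have A'A := ortho_A'A Pxi PT.
move: A' Pia Pn0 PL Pxi PT E2 AA A'A' A'A => B v v0 vL vxi vT E2 AA A'A' A'A.
have v_inj (c : R) : c *: v = 0 -> c = 0.
  by case/scalemx_eq0P => // e; rewrite e eqxx in v0.
pose tau' := 2 + al ^+ 2 / 4.
pose c1 := h * al / 2 - (p - 4) - al ^+ 2 / 4.
pose c0 := 2 * h + al * (p - 4) / 2 - al.
have tau_gt0 : 0 < tau' by apply: ltr_wpDr => //; rewrite divr_ge0 ?sqr_ge0.
have tau'n0 : tau' != 0 by rewrite gt_eqF.
have E3 : tau' *: (v *m B) = c1 *: (v *m A) + c0 *: v.
  by apply: (lincomb1 (c := -1) E2); rewrite /tau' /c1 /c0; mxlin.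
have E4 : (al * (tau' + c1) / 2 - c1 * h - c0) *: (v *m A) +
          (al * c0 / 2 + 2 * tau' + c1 * p) *: v = 0.
  have := congr1 (mulmxr A) E3 => /=; mxexpand; rewrite AA A'A => E4.
  by apply: (lincomb2 (c := 1) (d := - al / 2) E4 E3); mxlin.
have nondeg := @rank2_scalar_nondegenerate _ h al.
have x0 : al * (tau' + c1) / 2 - c1 * h - c0 != 0.
  apply/eqP => x0; move: E4; rewrite x0 scale0r add0r => /v_inj y0.
  exact: nondeg x0 y0.
pose lam := - (al * c0 / 2 + 2 * tau' + c1 * p) / (al * (tau' + c1) / 2 - c1 * h - c0).
pose mu := (c1 * lam + c0) / tau'.
have vA : v *m A = lam *: v.
  apply: (scalerI x0); rewrite scalerA [in RHS]mulrC divfK // scaleNr.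
  by apply/eqP; rewrite -addr_eq0 E4.
have vA' : v *m B = mu *: v.
  by apply: (scalerI tau'n0); rewrite E3 vA !scalerA -scalerDl [in RHS]mulrC divfK.
move: (lam) (mu) vA vA' => {}lam {}mu vA vA'.
exists lam, mu; split=> //.
- apply/subr0_eq/v_inj; move: AA; rewrite vA -scalemxAl vA => E.
  by apply: (lincomb1 (c := 1) E); mxlin.
- apply/subr0_eq/v_inj; move: A'A'; rewrite vA' -scalemxAl vA' => E.
  by apply: (lincomb1 (c := 1) E); mxlin.
- apply/subr0_eq/v_inj; move: A'A; rewrite vA' -scalemxAl vA => E.
  by apply: (lincomb1 (c := 1) E); mxlin.
Qed.

(** On the kernel of [L] both constant terms are [p - 3], so the two Hopf equations differ by a
    multiple of [v A - v A']. Either the factor vanishes, or [A] and [A'] agree there; then [A] is a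
    scalar [z] with [z (z - al) = 1] and [(h - al) (z - al) = - 2]. *)
Lemma rank2_Piu_scalar : h * al = 2 * al ^+ 2 + 8 \/
  exists z : R, [/\ Piu *m A = z *: Piu, z ^+ 2 = al * z + 1 & h - al = - 2 * z].
Proof.
have Pn0 : Piu != 0.
  apply/eqP => P0; move: Piu_trace; rewrite P0 mxtrace0 => /esym/eqP.
  by rewrite subr_eq0 eqr_nat; move: m3; lia.
have PL := Piu_L; have Pxi := Piu_ortho; have PT := rank2_vT PL.
have [E1 E2] := rank2_hopf Pxi PL.
have AA := rank2_quadratic PL; have A'A := ortho_A'A Pxi PT.
move: A' Piu Pn0 PL Pxi PT E1 E2 AA A'A => B v v0 vL vxi vT E1 E2 AA A'A.
have v_inj (c : R) : c *: v = 0 -> c = 0.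
  by case/scalemx_eq0P => // e; rewrite e eqxx in v0.
have : (p - 4 - h * al / 2) *: (v *m A - v *m B) = 0.
  by apply: (lincomb2 (c := 1) (d := -1) E1 E2); mxlin.
case/scalemx_eq0P => [e|/subr0_eq aa']; [left|right].
  by rewrite -[RHS]addr0 -(mulr0 2) -e /p; field.
have hA : (h - al) *: (v *m A) = (al * (h - al) - 2) *: v.
  move: A'A; rewrite -aa' AA => E.
  by apply: (lincomb1 (c := 1) E); rewrite /p; mxlin.
have hal : h - al != 0.
  apply/eqP => e; move: hA; rewrite e scale0r mulr0 sub0r => /esym/v_inj/eqP.
  by rewrite oppr_eq0 pnatr_eq0.
pose z := (al * (h - al) - 2) / (h - al).
have vA : v *m A = z *: v.
  by apply: (scalerI hal); rewrite hA scalerA; congr (_ *: _); rewrite /z; field.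
have z2 : z ^+ 2 = al * z + 1.
  apply/subr0_eq/v_inj; move: A'A; rewrite -aa' vA -scalemxAl vA => E.
  by apply: (lincomb1 (c := 1) E); mxlin.
have zh : (h - al) * (z - al) = - 2 by rewrite /z; field.
exists z; split=> //.
have zn0 : z != 0.
  apply/eqP => z0; move: z2; rewrite z0 expr0n mulr0 add0r => /esym/eqP.
  by rewrite oner_eq0.
apply: (mulIf (x := z - al)); last by rewrite zh; lra.
apply/eqP => e; move/eqP: zh; rewrite e mulr0 eq_sym oppr_eq0 pnatr_eq0.
by [].
Qed.

Lemma rank2_contra : False.
Proof.
have [lam [mu [PA PA' lamE muE lammu]]] := rank2_Pia_scalar.
have [hal|[z [PuA zE hE]]] := rank2_Piu_scalar.
  exact: rank2_mixed_absurd hal lamE muE lammu.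
apply: (@rank2_equal_absurd _ h al lam mu z (m - 3)%N) => //.
rewrite {1}rank2_trace PA PA' PuA !mxtraceZ Pia_trace Piu_trace natrB // natrM.
by ring.
Qed.

End RankTwo.

End HopfOperators.

(** The hypothesis says that [S] commutes with the difference tensor of the two connections. At
    [x = xi] the term [x A Phi] vanishes and [k] times the commutator of [S] and [Phi] remains; at
    [y = xi] what remains is [x A Phi S = sigma (x A Phi)], from which [Phi] is cancelled. *)
Lemma gtw_condition d (A Phi S : 'M[R]_d) (xi : 'rV[R]_d) (k al : R) :
  k != 0 -> S^T = S -> Phi^T = - Phi -> Phi *m Phi = xi^T *m xi - 1%:M -> xi *m Phi = 0 ->
  xi *m xi^T = 1%:M -> xi *m A = al *: xi ->
  (forall x y : 'rV[R]_d,
    (x *m A *m Phi *m (y *m S)^T) 0 0 *: xi - (y *m S *m xi^T) 0 0 *: (x *m A *m Phi)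
      - (k * (x *m xi^T) 0 0) *: (y *m S *m Phi) =
    (x *m A *m Phi *m y^T) 0 0 *: (xi *m S) - (y *m xi^T) 0 0 *: (x *m A *m Phi *m S)
      - (k * (x *m xi^T) 0 0) *: (y *m Phi *m S)) ->
  exists sigma, [/\ S *m Phi = Phi *m S, xi *m S = sigma *: xi & A *m (S - sigma%:M) = 0].
Proof.
move=> k0 Ssym Phiskew PhiPhi xiPhi xixi xiA cond.
have rowP' (M M' : 'M[R]_d) : (forall y : 'rV_d, y *m M = y *m M') -> M = M'.
  by move=> e; apply/row_matrixP => i; rewrite !rowE e.
have Phixi : Phi *m xi^T = 0.
  by apply: trmx_inj; rewrite trmx_mul trmxK Phiskew mulmxN xiPhi oppr0 trmx0.
have SPhi : S *m Phi = Phi *m S.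
  apply: rowP' => y; have := cond xi y.
  rewrite xiA -!scalemxAl xiPhi scaler0 !mul0mx xixi !mxE eqxx /= !(mulr1, mulr0, scale0r, scaler0, subr0, sub0r, oppr0).
  by move=> /oppr_inj e; have := scalerI k0 e; rewrite !mulmxA.
have xiS : xi *m S = (xi *m S *m xi^T) 0 0 *: xi.
  have e : xi *m S *m Phi = 0 by rewrite -mulmxA SPhi mulmxA xiPhi mul0mx.
  have := congr1 (mulmxr Phi) e => /=; rewrite mul0mx -mulmxA PhiPhi mulmxBr mulmx1 mulmxA.
  by move/subr0_eq => {1}<-; rewrite {1}[_ *m xi^T]mx11_scalar mul_scalar_mx.
set sigma := (xi *m S *m xi^T) 0 0 in xiS.
exists sigma; split=> //; apply: rowP' => x.
have Sxi : S *m xi^T = sigma *: xi^T.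
  by apply: trmx_inj; rewrite trmx_mul trmxK Ssym xiS linearZ /= trmxK.
have xAPS : x *m A *m Phi *m S = sigma *: (x *m A *m Phi).
  have := cond x xi; rewrite xiPhi mul0mx xiS -!scalemxAl xiPhi xixi linearZ /= -!scalemxAr.
  rewrite -[x *m A *m Phi *m xi^T]mulmxA Phixi mulmx0 !mxE eqxx /= !(mulr0, mulr1) !(scaler0, scale0r, sub0r, subr0, oppr0) scale1r.
  by move/oppr_inj <-.
have xAS : x *m A *m (S - sigma%:M) *m Phi = 0.
  by rewrite mulmxBr mulmxBl -mulmxA SPhi mulmxA xAPS mul_mx_scalar -scalemxAl subrr.
have := congr1 (mulmxr Phi) xAS => /=; rewrite mul0mx -mulmxA PhiPhi mulmxBr mulmx1 !mulmxA.
have Wxi : (S - sigma%:M) *m xi^T = 0 by rewrite mulmxBl Sxi mul_scalar_mx subrr.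
rewrite -[x *m A *m (S - sigma%:M) *m xi^T]mulmxA Wxi mulmx0 mul0mx sub0r.
by move/eqP; rewrite oppr_eq0 mulmx0 => /eqP.
Qed.

End RealMatrix.

(** * Orthonormal frames of Hermitian tangent matrices *)

Lemma mxtraceN' (F : pzRingType) n (X : 'M[F]_n) : \tr (- X) = - \tr X.
Proof. exact: raddfN. Qed.

(** Idempotence makes the product of [row_base P] and [col_base P], taken in the order opposite to
    the one giving [P], an identity matrix whose size is the rank. *)
Lemma mxtrace_idem (F : fieldType) n (P : 'M[F]_n) : P *m P = P -> \tr P = (\rank P)%:R.
Proof.
move=> PP; have : row_base P *m col_base P = 1%:M.
  apply: (row_free_inj (row_base_free P)); apply: (row_full_inj (col_base_full P)).
  by rewrite /= mul1mx mulmx_base mulmxA mulmxA mulmx_base -mulmxA mulmx_base.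
move=> e; have -> : \tr P = \tr (row_base P *m col_base P) by rewrite mxtrace_mulC mulmx_base.
by rewrite e mxtrace1.
Qed.

Section Adjoint.
Variable C : numClosedFieldType.

Lemma adjmxM a b c (A : 'M[C]_(a, b)) (B : 'M[C]_(b, c)) : (A *m B) ^t* = B ^t* *m A ^t*.
Proof. by rewrite trmx_mul map_mxM. Qed.

Lemma adjmxD a b (A B : 'M[C]_(a, b)) : (A + B) ^t* = A ^t* + B ^t*.
Proof. by rewrite linearD map_mxD. Qed.

Lemma adjmxN a b (A : 'M[C]_(a, b)) : (- A) ^t* = - A ^t*.
Proof. by rewrite linearN map_mxN. Qed.

Lemma adjmxZ a b c (A : 'M[C]_(a, b)) : (c *: A) ^t* = c^* *: A ^t*.
Proof. by rewrite linearZ map_mxZ. Qed.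

Lemma adjmx1 n : (1%:M : 'M[C]_n) ^t* = 1%:M.
Proof. by rewrite trmx1 map_mx1. Qed.

Lemma mxtrace_adj n (A : 'M[C]_n) : \tr (A ^t*) = (\tr A)^*.
Proof. by rewrite rmorph_sum; apply: eq_bigr => i _; rewrite !mxE. Qed.

Lemma adjmx_sum a b (I : finType) (F : I -> 'M[C]_(a, b)) :
  (\sum_i F i) ^t* = \sum_i (F i) ^t*.
Proof. by rewrite raddf_sum /= raddf_sum. Qed.

Lemma mxtrace_mul_adj_ge0 n p (A : 'M[C]_(n, p)) : 0 <= \tr (A *m A ^t*).
Proof.
apply: sumr_ge0 => i _; rewrite !mxE; apply: sumr_ge0 => j _.
by rewrite !mxE mul_conjC_ge0.
Qed.

Lemma mxtrace_mul_adj_eq0 n p (A : 'M[C]_(n, p)) : \tr (A *m A ^t*) = 0 -> A = 0.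
Proof.
move/eqP; rewrite psumr_eq0; last first.
  move=> i _; rewrite !mxE; apply: sumr_ge0 => j _; by rewrite !mxE mul_conjC_ge0.
move=> /allP A0; apply/matrixP => i j.
have := A0 i (mem_index_enum _) => /=; rewrite !mxE psumr_eq0; last first.
  by move=> k _; rewrite !mxE mul_conjC_ge0.
by move=> /allP/(_ j (mem_index_enum _)); rewrite !mxE mul_conjC_eq0 => /eqP.
Qed.

Lemma mxtrace_delta n (M : 'M[C]_n) a b : \tr (M *m delta_mx a b) = M b a.
Proof.
rewrite /mxtrace (bigD1 b) //= big1 ?addr0 => [|i ib].
  rewrite mxE (bigD1 a) //= mxE !eqxx mulr1 big1 ?addr0 // => j ja.
  by rewrite mxE (negPf ja) mulr0.
by rewrite mxE big1 // => j _; rewrite mxE (negPf ib) andbF mulr0.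
Qed.

(** The trace of the operator [X |-> M X N], computed in the orthonormal basis of matrix units. *)
Lemma mxtrace_mul_delta n (M N : 'M[C]_n) :
  \sum_a \sum_b \tr (M *m delta_mx a b *m N *m delta_mx b a) = \tr M * \tr N.
Proof.
have E a b : \tr (M *m delta_mx a b *m N *m delta_mx b a) = M a a * N b b.
  rewrite mxtrace_delta -mulmxA mxE (bigD1 a) //= big1 ?addr0 => [|j ja].
    rewrite mxE (bigD1 b) //= mxE !eqxx mul1r big1 ?addr0 // => j jb.
    by rewrite mxE (negPf jb) andbF mul0r.
  by rewrite [X in _ * X]mxE big1 ?mulr0 // => l _; rewrite mxE (negPf ja) mul0r.
under eq_bigr do under eq_bigr do rewrite E.
by rewrite /mxtrace mulr_suml; apply: eq_bigr => a _; rewrite mulr_sumr.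
Qed.

Lemma mxtrace_sub_adj n (X Y : 'M[C]_n) :
  \tr ((X - Y) *m (X - Y) ^t*) =
  \tr (X *m X ^t*) - \tr (X *m Y ^t*) - \tr (Y *m X ^t*) + \tr (Y *m Y ^t*).
Proof.
rewrite adjmxD adjmxN mulmxDl !mulmxDr !mulmxN !mulNmx !(raddfD, raddfN) /= opprK.
by rewrite addrA.
Qed.

End Adjoint.

(** * Completeness relations of an orthonormal tangent frame *)

Section Frame.
Variables (C : numClosedFieldType) (n : nat) (P Q : 'M[C]_n).
Hypotheses (Qdef : Q = 1%:M - P) (PP : P *m P = P) (Padj : P ^t* = P).

(** The complex span of the tangent vectors consists of the matrices with vanishing diagonal blocks;
    this is the orthogonal projection onto it. *)
Definition offdiag (X : 'M[C]_n) := P *m X *m Q + Q *m X *m P.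
Definition htangent (X : 'M[C]_n) := X ^t* = X /\ P *m X + X *m P = X.

Lemma QQ : Q *m Q = Q.
Proof. by rewrite Qdef mulmxBl mul1mx mulmxBr mulmx1 PP subrr subr0. Qed.

Lemma PQ : P *m Q = 0. Proof. by rewrite Qdef mulmxBr mulmx1 PP subrr. Qed.
Lemma QP : Q *m P = 0. Proof. by rewrite Qdef mulmxBl mul1mx PP subrr. Qed.

Lemma Qadj : Q ^t* = Q.
Proof. by rewrite Qdef adjmxD adjmxN adjmx1 Padj. Qed.

Lemma tangent_PX X : htangent X -> P *m X = X *m Q.
Proof. by move=> [_ e]; rewrite Qdef mulmxBr mulmx1; apply/eqP; rewrite eq_sym subr_eq e. Qed.

Lemma tangent_QX X : htangent X -> Q *m X = X *m P.
Proof. by move=> [_ e]; rewrite Qdef mulmxBl mul1mx; apply/eqP; rewrite subr_eq addrC e. Qed.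

Lemma tangent_PXP X : htangent X -> P *m X *m P = 0.
Proof. by move=> /tangent_PX ->; rewrite -mulmxA QP mulmx0. Qed.

Lemma tangent_trP X : htangent X -> \tr (P *m X) = 0.
Proof. by move=> tX; rewrite -{1}PP -mulmxA mxtrace_mulC tangent_PXP ?mxtrace0. Qed.

Lemma tangent_trQ X : htangent X -> \tr (Q *m X) = 0.
Proof. by move=> tX; rewrite tangent_QX // mxtrace_mulC tangent_trP. Qed.

Lemma offdiag_id X : htangent X -> offdiag X = X.
Proof.
move=> tX; rewrite /offdiag (tangent_PX tX) (tangent_QX tX) -!mulmxA QQ PP -mulmxDr.
by rewrite Qdef subrK mulmx1.
Qed.

Lemma mxtrace_offdiag X Y : htangent Y -> \tr (offdiag X *m Y) = \tr (X *m Y).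
Proof.
move=> tY; rewrite -[in RHS](offdiag_id tY) /offdiag mulmxDl mulmxDr !raddfD /= addrC.
rewrite -!mulmxA [in LHS]mxtrace_mulC -!mulmxA; congr (_ + _).
by rewrite [in LHS]mxtrace_mulC -!mulmxA.
Qed.

Lemma offdiag_adj X : (offdiag X) ^t* = offdiag (X ^t*).
Proof. by rewrite /offdiag adjmxD !adjmxM Padj Qadj !mulmxA addrC. Qed.

Lemma offdiag_offdiag X : offdiag (offdiag X) = offdiag X.
Proof.
rewrite /offdiag !(mulmxDl, mulmxDr) !mulmxA PP QQ PQ QP !mul0mx !addr0 add0r.
by rewrite -![_ *m Q *m Q]mulmxA -![_ *m P *m P]mulmxA QQ PP.
Qed.

Lemma mxtrace_offdiag_sym X Y : \tr (offdiag X *m Y) = \tr (X *m offdiag Y).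
Proof.
rewrite /offdiag mulmxDl mulmxDr !raddfD /= addrC.
by congr (_ + _); rewrite -!mulmxA [LHS]mxtrace_mulC -!mulmxA.
Qed.

Section Normal.
Variable N : 'M[C]_n.
Hypothesis tN : htangent N.

Lemma sqr_comm : P *m (N *m N) = N *m N *m P.
Proof.
have tNN := tangent_PX tN; have tQN := tangent_QX tN.
by rewrite mulmxA tNN -!mulmxA tQN.
Qed.

Lemma sqr_anticomm_tangent X : htangent X ->
  htangent (N *m N *m X + X *m N *m N).
Proof.
move=> [Xh Xt]; case: (tN) => Nh _; split.
  by rewrite adjmxD !adjmxM Xh Nh addrC !mulmxA.
rewrite -[X *m N *m N]mulmxA; have := sqr_comm; move: (N *m N) => M PM.
rewrite mulmxDr mulmxDl !mulmxA PM; have -> : X *m M *m P = X *m P *m M by rewrite -!mulmxA PM.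
have e1 := congr1 (mulmx M) Xt; have e2 := congr1 (mulmxr M) Xt.
by apply: (lincomb2 (c := 1) (d := 1) e1 e2); rewrite /=; mxexpand; mxlin.
Qed.

Lemma sandwich_tangent X : htangent X -> htangent (N *m X *m N).
Proof.
move=> tX; case: (tX) (tN) => Xh _ [Nh Nt]; split.
  by rewrite !adjmxM Xh Nh mulmxA.
have PN := tangent_PX tN.
have QX := tangent_QX tX.
have -> : P *m (N *m X *m N) = N *m X *m N *m (Q).
  by rewrite !mulmxA PN -[N *m (Q) *m X]mulmxA QX !mulmxA -[N *m X *m P *m N]mulmxA PN mulmxA.
by rewrite Qdef mulmxBr mulmx1 subrK.
Qed.

(** [N *m N] preserves the plane and so commutes with [P]. Up to a scalar the commutator with [P] is
    the complex structure, which therefore commutes with [T]. *)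
Lemma sqr_commutator X :
  N *m N *m (X *m P - P *m X) + (X *m P - P *m X) *m N *m N =
  (N *m N *m X + X *m N *m N) *m P - P *m (N *m N *m X + X *m N *m N).
Proof.
rewrite -[_ *m N *m N]mulmxA -[X *m N *m N]mulmxA; have := sqr_comm; move: (N *m N) => G PG.
mxexpand; have -> : X *m P *m G = X *m G *m P by rewrite -!mulmxA PG.
by rewrite PG; mxlin.
Qed.

(** [N] exchanges the plane and its complement, which is why [L], in contrast to [T], anticommutes
    with the complex structure. *)
Lemma sandwich_commutator X : htangent X ->
  N *m (X *m P - P *m X) *m N = - (N *m X *m N *m P - P *m (N *m X *m N)).
Proof.
move=> tX; have PN := tangent_PX tN; have QX := tangent_QX tX.
have QN := tangent_QX tN; have PX := tangent_PX tX.
have -> : P *m (N *m X *m N) = N *m X *m P *m N.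
  by rewrite !mulmxA PN -[N *m Q *m X]mulmxA QX !mulmxA.
have -> : N *m X *m N *m P = N *m P *m X *m N.
  by rewrite -!mulmxA -QN [X *m (Q *m N)]mulmxA -PX !mulmxA.
by rewrite mulmxBr mulmxBl opprB !mulmxA.
Qed.

End Normal.

Variables (q : nat) (B : 'I_q -> 'M[C]_n).
Hypotheses (Btan : forall i, htangent (B i))
  (Bon : forall i j, \tr (B i *m B j) = 4 * (i == j)%:R)
  (qE : q%:R = 2 * \tr P * \tr Q).

Let coef i (H : 'M[C]_n) := \tr (B i *m H).
Let proj (H : 'M[C]_n) := \sum_i (coef i H / 4) *: B i.

(** The defect in Bessel's inequality for [H]; the quarters come from [\tr (B i *m B i) = 4]. *)
Lemma frame_deficit (H : 'M[C]_n) :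
  \tr ((offdiag H - proj H) *m (offdiag H - proj H) ^t*) =
  \tr (offdiag H *m H ^t*) - \sum_i (coef i H * (coef i H)^* ) / 4.
Proof.
have Badj i : (B i) ^t* = B i by case: (Btan i).
have conj4 : (4 : C)^-1^* = 4^-1 by rewrite fmorphV rmorph_nat.
have projadj : (proj H) ^t* = \sum_i ((coef i H)^* / 4) *: B i.
  rewrite /proj adjmx_sum; apply: eq_bigr => i _.
  by rewrite adjmxZ rmorphM /= conj4 Badj.
have t1 : \tr (offdiag H *m (proj H) ^t*) = \sum_i (coef i H * (coef i H)^* ) / 4.
  rewrite projadj mulmx_sumr raddf_sum /=; apply: eq_bigr => i _.
  by rewrite -scalemxAr linearZ /= mxtrace_offdiag // mxtrace_mulC -/(coef i H); ring.
have t2 : \tr (proj H *m (offdiag H) ^t*) = \sum_i (coef i H * (coef i H)^* ) / 4.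
  rewrite /proj mulmx_suml raddf_sum /=; apply: eq_bigr => i _.
  rewrite -scalemxAl linearZ /= offdiag_adj mxtrace_mulC mxtrace_offdiag //.
  by rewrite /coef -mxtrace_adj adjmxM Badj; ring.
have t3 : \tr (proj H *m (proj H) ^t*) = \sum_i (coef i H * (coef i H)^* ) / 4.
  rewrite projadj /proj mulmx_suml raddf_sum /=; apply: eq_bigr => i _.
  rewrite -scalemxAl linearZ /= mulmx_sumr raddf_sum /= (bigD1 i) //= big1 => [|j ji].
    by rewrite -scalemxAr linearZ /= Bon eqxx addr0 /= mulr1; field.
  by rewrite -scalemxAr linearZ /= Bon eq_sym (negPf ji) !mulr0.
rewrite mxtrace_sub_adj t1 t2 t3 offdiag_adj -mxtrace_offdiag_sym offdiag_offdiag.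
by rewrite subrK.
Qed.

(** A dimension count without bases. Summed over all matrix units, the Bessel defects equal the
    trace of [offdiag], which is [2 \tr P \tr Q], minus the number [q] of frame vectors. By [qE] the
    sum is zero, and its terms are nonnegative. *)
Lemma frame_complete_delta a b : proj (delta_mx a b) = offdiag (delta_mx a b).
Proof.
have r0 : \sum_a \sum_b \tr ((offdiag (delta_mx a b) - proj (delta_mx a b)) *m
    (offdiag (delta_mx a b) - proj (delta_mx a b)) ^t*) = 0.
  under eq_bigr do under eq_bigr do rewrite frame_deficit.
  under eq_bigr do rewrite sumrB.
  rewrite sumrB.
  have -> : \sum_a0 \sum_b0 \tr (offdiag (delta_mx a0 b0) *m (delta_mx a0 b0) ^t*) =
      2 * \tr P * \tr Q.
    have dadj (x y : 'I_n) : (delta_mx x y : 'M[C]_n) ^t* = delta_mx y x.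
      by rewrite trmx_delta map_delta_mx.
    under eq_bigr do under eq_bigr do rewrite dadj /offdiag mulmxDl raddfD /=.
    under eq_bigr do rewrite big_split /=.
    by rewrite big_split /= !mxtrace_mul_delta; ring.
  rewrite -qE; apply/eqP; rewrite subr_eq0; apply/eqP.
  under [RHS]eq_bigr do rewrite exchange_big /=.
  rewrite exchange_big /=.
  have -> : (q%:R : C) = \sum_(i < q) 1 by rewrite sumr_const card_ord.
  apply: eq_bigr => i _.
  transitivity (\tr (B i *m (B i) ^t*) / 4).
    by case: (Btan i) => -> _; rewrite Bon eqxx /= mulr1 divff ?pnatr_eq0.
  rewrite [RHS]exchange_big /= /mxtrace mulr_suml; apply: eq_bigr => y _; rewrite !mxE mulr_suml.
  by apply: eq_bigr => x _; rewrite /coef !mxtrace_delta !mxE.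
apply/esym/subr0_eq/mxtrace_mul_adj_eq0.
move: r0 => /eqP; rewrite psumr_eq0 => [/allP/(_ a (mem_index_enum _))/=|x _]; last first.
  by apply: sumr_ge0 => y _; apply: mxtrace_mul_adj_ge0.
rewrite psumr_eq0 => [/allP/(_ b (mem_index_enum _))/= /eqP //|y _].
exact: mxtrace_mul_adj_ge0.
Qed.

Lemma frame_complete H : \sum_i (\tr (B i *m H) / 4) *: B i = offdiag H.
Proof.
have projD X Y : proj (X + Y) = proj X + proj Y.
  rewrite /proj -big_split /=; apply: eq_bigr => i _.
  by rewrite /coef mulmxDr mxtraceD mulrDl scalerDl.
have projZ c X : proj (c *: X) = c *: proj X.
  rewrite /proj scaler_sumr; apply: eq_bigr => i _.
  by rewrite /coef -scalemxAr mxtraceZ scalerA mulrA.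
have proj0 : proj 0 = 0.
  by rewrite /proj big1 // => i _; rewrite /coef mulmx0 mxtrace0 mul0r scale0r.
have offD X Y : offdiag (X + Y) = offdiag X + offdiag Y.
  by rewrite /offdiag !(mulmxDr, mulmxDl) addrACA.
have offZ c X : offdiag (c *: X) = c *: offdiag X.
  by rewrite /offdiag -!(scalemxAl, scalemxAr) scalerDr.
have off0 : offdiag 0 = 0 by rewrite /offdiag !(mulmx0, mul0mx) addr0.
rewrite -/(proj H) [H]matrix_sum_delta.
rewrite (big_morph _ projD proj0) (big_morph _ offD off0); apply: eq_bigr => a _.
rewrite (big_morph _ projD proj0) (big_morph _ offD off0); apply: eq_bigr => b _.
by rewrite projZ offZ frame_complete_delta.
Qed.

Lemma frame_expand X : htangent X -> \sum_i (\tr (B i *m X) / 4) *: B i = X.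
Proof. by move=> tX; rewrite frame_complete offdiag_id. Qed.

Lemma frame_parseval X Y : htangent X ->
  \sum_i \tr (B i *m X) * \tr (B i *m Y) = 4 * \tr (X *m Y).
Proof.
move=> tX; rewrite -[X in _ = 4 * \tr (X *m _)](frame_expand tX) mulmx_suml raddf_sum /= mulr_sumr.
by apply: eq_bigr => i _; rewrite -scalemxAl mxtraceZ; field.
Qed.

(** Each entry of the sum is a contraction of [M] with frame expansions of matrix units, and
    completeness replaces these expansions by [offdiag]. *)
Lemma frame_sandwich M :
  \sum_i B i *m M *m B i = (4 * \tr (Q *m M)) *: P + (4 * \tr (P *m M)) *: Q.
Proof.
apply/matrixP => a d; rewrite summxE.
transitivity (\sum_b \sum_c M b c * (4 * (\sum_i (\tr (B i *m delta_mx d c) / 4) *: B i) a b)).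
  rewrite exchange_big /=; under [RHS]eq_bigr do under eq_bigr do rewrite summxE !mulr_sumr.
  under [RHS]eq_bigr do rewrite exchange_big /=.
  rewrite [RHS]exchange_big /=; apply: eq_bigr => i _.
  rewrite mxE; apply: eq_bigr => c _; rewrite mxE mulr_suml; apply: eq_bigr => b _.
  by rewrite mxtrace_delta mxE; field.
under eq_bigr do under eq_bigr do rewrite frame_complete.
have offE c b : offdiag (delta_mx d c) a b = P a d * Q c b + Q a d * P c b.
  have E (X Y : 'M[C]_n) : (X *m delta_mx d c *m Y) a b = X a d * Y c b.
    rewrite mxE (bigD1 c) //= big1 ?addr0 => [|j jb]; last first.
      by rewrite mxE big1 ?mul0r // => l _; rewrite mxE (negPf jb) andbF mulr0.
    rewrite mxE (bigD1 d) //= big1 ?addr0 => [|j jb]; last first.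
      by rewrite mxE (negPf jb) mulr0.
    by rewrite mxE !eqxx mulr1.
  by rewrite mxE !E.
under eq_bigr do under eq_bigr do rewrite offE.
rewrite !mxE /mxtrace !mulr_sumr !mulr_suml exchange_big /= -big_split /=.
apply: eq_bigr => c _; rewrite !mxE !mulr_sumr !mulr_suml -big_split /=.
by apply: eq_bigr => b _; ring.
Qed.

(** The double commutator is the curvature of the Grassmannian as a symmetric space, so this
    computes its Ricci operator; with [\tr P = 2] and [\tr Q = m] the factor is the [4 m + 8] of the
    hypersurface formula. *)
Lemma frame_casimir X : htangent X ->
  \sum_i ((X *m B i - B i *m X) *m B i - B i *m (X *m B i - B i *m X)) =
  (4 * (\tr P + \tr Q)) *: X.
Proof.
move=> tX.
have sq : \sum_i B i *m B i = (4 * \tr Q) *: P + (4 * \tr P) *: Q.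
  by have := frame_sandwich 1%:M; under eq_bigr do rewrite mulmx1; rewrite !mulmx1.
have sX : \sum_i B i *m X *m B i = 0.
  by rewrite frame_sandwich tangent_trP // tangent_trQ // mulr0 !scale0r addr0.
transitivity (X *m (\sum_i B i *m B i) + (\sum_i B i *m B i) *m X - 2 *: \sum_i B i *m X *m B i).
  rewrite mulmx_suml mulmx_sumr scaler_sumr -big_split -sumrB /=; apply: eq_bigr => i _.
  by rewrite mulmxBl mulmxBr !mulmxA; mxlin.
rewrite sX scaler0 subr0 sq mulmxDl mulmxDr -!scalemxAr -!scalemxAl (tangent_PX tX) (tangent_QX tX).
move: (\tr Q) => t; rewrite Qdef; mxring.
Qed.

(** * The Reeb vector as a matrix, and the equation [N ^ 3 = c N] *)

Section Reeb.
Variables (N : 'M[C]_n) (I : C) (m : nat).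
Hypotheses (tN : htangent N) (NN4 : \tr (N *m N) = 4) (I2 : I * I = - 1) (Iconj : I^* = - I)
  (trP : \tr P = 2) (trQ : \tr Q = m%:R).
Let reeb := - (I *: (N *m P - P *m N)).

(** [N] exchanges the plane and its complement, so [N ^ 2] has equal traces on both, each half of
    [4]. *)
Lemma trPNN : \tr (P *m N *m N) = 2.
Proof.
have e1 : \tr (P *m N *m N) = \tr (Q *m N *m N).
  by rewrite (tangent_PX tN) -mulmxA mxtrace_mulC.
have e2 : \tr (P *m N *m N) + \tr (Q *m N *m N) = 4.
  by rewrite -NN4 -mxtraceD -!mulmxDl Qdef addrC subrK mul1mx.
by move: e2; rewrite -e1 -mulr2n => e; apply: (mulIf (x := 2)); rewrite ?pnatr_eq0 // mulr_natr e -natrM.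
Qed.

Lemma trQNN : \tr (Q *m N *m N) = 2.
Proof. by rewrite -trPNN (tangent_PX tN) -[N *m Q *m N]mulmxA [RHS]mxtrace_mulC. Qed.

Lemma reeb_anticomm : N *m reeb = - (reeb *m N).
Proof.
rewrite /reeb mulmxN mulNmx opprK -scalemxAr -scalemxAl -scalerN; congr (_ *: _).
rewrite mulmxBr mulmxBl !mulmxA -(sqr_comm tN) mulmxA.
by rewrite opprB.
Qed.

Lemma reeb_htangent : htangent reeb.
Proof.
have PNP := tangent_PXP tN; case: (tN) => Nh _; split.
  rewrite /reeb adjmxN adjmxZ Iconj adjmxD adjmxN !adjmxM Nh Padj scaleNr opprK -scalerN.
  by rewrite opprB.
rewrite /reeb; mxexpand; rewrite -[N *m P *m P]mulmxA PP PNP; mxlin.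
Qed.

(** Put [D = N ^ 3 - c N]. The hypothesis says that [D] commutes with [P], that is, [D] is
    block-diagonal; being a combination of tangent matrices it also has no diagonal blocks. *)
Lemma reeb_cube c : N *m N *m reeb = c *: reeb -> N *m N *m N = c *: N.
Proof.
have I0 : I != 0.
  by apply/eqP => I0; move: I2; rewrite I0 mul0r => /esym/eqP; rewrite oppr_eq0 oner_eq0.
rewrite /reeb mulmxN -scalemxAr scalerN scalerA [c * I]mulrC -scalerA => /oppr_inj/(scalerI I0) e.
pose D := N *m N *m N - c *: N.
have t3 : htangent (N *m N *m N) by apply: sandwich_tangent.
have DP : D *m P = P *m D.
  rewrite /D mulmxBl mulmxBr -scalemxAl -scalemxAr.
  move: e; rewrite mulmxBr !mulmxA => e.
  apply: (lincomb1 (c := 1) e); rewrite -(sqr_comm tN) !mulmxA; mxlin.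
have PDP : P *m D *m P = 0.
  rewrite /D mulmxBr mulmxBl -scalemxAr -scalemxAl (tangent_PXP tN) scaler0 subr0.
  exact: (tangent_PXP t3).
have PD : P *m D = 0 by rewrite -PDP -mulmxA DP mulmxA PP.
have DD : P *m D + D *m P = D.
  rewrite /D mulmxBr mulmxBl -scalemxAl -scalemxAr.
  case: t3 => _ e1.
  case: (tN) => _ e2; apply: (lincomb2 (c := 1) (d := - c) e1 e2); mxlin.
by apply: subr0_eq; rewrite -/D -DD DP PD addr0.
Qed.

Section Cube.
Variable c : C.
Hypothesis N3 : N *m N *m N = c *: N.

Lemma cube_coef_neq0 : c != 0.
Proof.
case: (tN) => Nh _; apply/eqP => c0.
have NN0 : N *m N = 0.
  by apply: mxtrace_mul_adj_eq0; rewrite adjmxM Nh mulmxA N3 c0 scale0r mul0mx mxtrace0.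
by move: NN4; rewrite NN0 mxtrace0 => /esym/eqP; rewrite pnatr_eq0.
Qed.

(** [G = c^-1 P N ^ 2] is idempotent of trace [2 / c]. Hence [2 / c] is the rank of [G], a nonzero
    natural number bounded by the rank of [P], which is [2]. *)
Lemma cube_coef : c = 2 \/ c = 1.
Proof.
have c0 := cube_coef_neq0.
pose G := c^-1 *: (P *m N *m N).
have GG : G *m G = G.
  rewrite /G -scalemxAl -scalemxAr scalerA.
  have -> : P *m N *m N *m (P *m N *m N) = c *: (P *m N *m N).
    rewrite -[P *m N *m N]mulmxA (sqr_comm tN) -[N *m N *m P *m _]mulmxA [P *m (N *m N *m P)]mulmxA (sqr_comm tN).
    by rewrite -[N *m N *m P *m P]mulmxA PP !mulmxA N3 -!scalemxAl.
  by rewrite scalerA -mulrA mulVf // mulr1.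
have trG : \tr G = 2 / c by rewrite /G mxtraceZ trPNN mulrC.
have rP : (\rank P <= 2)%N.
  by rewrite -(ler_nat C) -(mxtrace_idem PP) trP.
have rG : (\rank G <= 2)%N.
  apply: leq_trans rP; rewrite /G -mulmxA scalemxAr; exact: mxrankM_maxl.
have e : c * (\rank G)%:R = 2.
  by rewrite -(mxtrace_idem GG) trG mulrC divfK.
case: (\rank G) rG e => [|[|[|]]] // _; rewrite ?mulr0 ?mulr1.
- by move/esym/eqP; rewrite pnatr_eq0.
- by left.
- by move=> e; right; apply: (mulIf (x := 2)); rewrite ?pnatr_eq0 // e mul1r.
Qed.

Lemma reeb_sqr : N *m N *m reeb = c *: reeb.
Proof.
rewrite /reeb mulmxN -scalemxAr scalerN scalerA [c * I]mulrC -scalerA; congr (- (_ *: _)).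
by rewrite mulmxBr !mulmxA N3 -(sqr_comm tN) -!mulmxA [N *m (N *m N)]mulmxA N3 -scalemxAl -scalemxAr scalerBr.
Qed.

Lemma reeb_sandwich : N *m reeb *m N = - c *: reeb.
Proof.
have rN : reeb *m N = - (N *m reeb) by rewrite reeb_anticomm opprK.
by rewrite -mulmxA rN mulmxN mulmxA reeb_sqr scaleNr.
Qed.

Lemma reeb_sqr_r : reeb *m N *m N = c *: reeb.
Proof.
have rN : reeb *m N = - (N *m reeb) by rewrite reeb_anticomm opprK.
by rewrite rN mulNmx -mulmxA rN mulmxN opprK mulmxA reeb_sqr.
Qed.

End Cube.

Lemma frame_sqr_sum : \sum_i B i *m B i = (4 * m%:R) *: P + 8 *: Q.
Proof.
have := frame_sandwich 1%:M; under eq_bigr do rewrite mulmx1.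
have e : 4 * 2 = 8 :> C by rewrite -natrM.
by rewrite !mulmx1 trP trQ e.
Qed.

(** The value is four times [4 m + 8], as the frame vectors have trace norm [4]. *)
Lemma trace_frame_sqr :
  \sum_i \tr ((N *m N *m B i + B i *m N *m N) *m B i) = 16 * (m%:R + 2).
Proof.
have e i : \tr ((N *m N *m B i + B i *m N *m N) *m B i) = 2 * \tr (N *m N *m (B i *m B i)).
  rewrite mulmxDl mxtraceD !mulmxA mulr_natl mulr2n; congr (_ + _).
  by rewrite mxtrace_mulC !mulmxA -[B i *m B i *m N *m N]mulmxA mxtrace_mulC !mulmxA.
under eq_bigr do rewrite e.
rewrite -mulr_sumr -raddf_sum /= -mulmx_sumr frame_sqr_sum mulmxDr -!scalemxAr mxtraceD !mxtraceZ.
rewrite ![\tr (N *m N *m _)]mxtrace_mulC !mulmxA trPNN trQNN; ring.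
Qed.

Lemma trace_frame_sandwich : \sum_i \tr (N *m B i *m N *m B i) = 0.
Proof.
have e i : \tr (N *m B i *m N *m B i) = \tr (N *m (B i *m N *m B i)) by rewrite !mulmxA.
under eq_bigr do rewrite e.
rewrite -raddf_sum /= -mulmx_sumr frame_sandwich (tangent_trP tN) (tangent_trQ tN).
by rewrite !mulr0 !scale0r addr0 mulmx0 mxtrace0.
Qed.

(* For c = 2 the operator X |-> N X N has rank two on the tangent space; the
   sum of the squared norms of its deviations from the expected form over an
   orthonormal frame is zero. *)
Lemma rank1_sandwich X : N *m N *m N = 2 *: N -> htangent X ->
  N *m X *m N = (\tr (X *m N) / 2) *: N - (\tr (X *m reeb) / 2) *: reeb.
Proof.
move=> N3 tX; have [Nh _] := tN; have [rh _] := reeb_htangent.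
have trNr : \tr (N *m reeb) = 0.
  have : \tr (N *m reeb) *+ 2 = 0 by rewrite mulr2n {1}reeb_anticomm mxtraceN' mxtrace_mulC addNr.
  by move/eqP; rewrite mulrn_eq0 => /eqP.
have trrr : \tr (reeb *m reeb) = 4.
  rewrite /reeb mulmxN mulNmx opprK -scalemxAl -scalemxAr scalerA I2 scaleN1r mxtraceN'.
  have PNP := tangent_PXP tN.
  have -> : (N *m P - P *m N) *m (N *m P - P *m N) = - (N *m P *m N) - P *m N *m N *m P.
    mxexpand; rewrite PNP mul0mx -[N *m P *m P]mulmxA PP.
    have -> : N *m P *m N *m P = 0 by rewrite -!mulmxA [P *m (N *m P)]mulmxA PNP mulmx0.
    by mxlin.
  rewrite mxtraceD !mxtraceN' opprD !opprK.
  rewrite -[N *m P *m N]mulmxA [\tr (N *m (P *m N))]mxtrace_mulC trPNN.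
  by rewrite mxtrace_mulC !mulmxA PP trPNN -natrD.
have rt := reeb_htangent; have rs := reeb_sandwich N3.
pose dev Y := N *m Y *m N - (\tr (Y *m N) / 2) *: N + (\tr (Y *m reeb) / 2) *: reeb.
move: reeb rt rs rh trNr trrr @dev => r rt rs rh trNr trrr dev.
have trh Y : Y ^t* = Y -> (\tr (Y *m N))^* = \tr (Y *m N) /\ (\tr (Y *m r))^* = \tr (Y *m r).
  by move=> Yh; rewrite -!mxtrace_adj !adjmxM Yh Nh rh ![\tr (_ *m Y)]mxtrace_mulC.
have devh Y : Y ^t* = Y -> (dev Y) ^t* = dev Y.
  move=> Yh; have [e1 e2] := trh Y Yh.
  by rewrite /dev !adjmxD adjmxN !adjmxZ !adjmxM Yh Nh rh !rmorphM /= e1 e2 fmorphV rmorph_nat mulmxA.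
have tdev Y : \tr (dev Y *m dev Y) = \tr (Y *m (N *m N) *m Y *m (N *m N))
    - \tr (Y *m N) * \tr (Y *m N) - \tr (Y *m r) * \tr (Y *m r).
  have y1 : \tr (N *m Y *m N *m N) = 2 * \tr (Y *m N).
    by rewrite -!mulmxA mxtrace_mulC -!mulmxA [N *m (N *m N)]mulmxA N3 -scalemxAr mxtraceZ.
  have y2 : \tr (N *m Y *m N *m r) = - 2 * \tr (Y *m r).
    rewrite -!mulmxA mxtrace_mulC -!mulmxA [N *m (r *m N)]mulmxA rs.
    by rewrite -scalemxAr mxtraceZ.
  have y3 : \tr (N *m Y *m N *m N *m Y *m N) = \tr (Y *m (N *m N) *m Y *m (N *m N)).
    by rewrite -!mulmxA mxtrace_mulC !mulmxA.
  have y1' : \tr (N *m N *m Y *m N) = 2 * \tr (Y *m N).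
    by rewrite -y1 -!mulmxA [LHS]mxtrace_mulC !mulmxA.
  have y2' : \tr (r *m N *m Y *m N) = - 2 * \tr (Y *m r).
    by rewrite -y2 -!mulmxA [LHS]mxtrace_mulC !mulmxA.
  rewrite /dev; mxexpand; rewrite !(mxtraceD, mxtraceN', mxtraceZ) y3 y1 y1' y2 y2' NN4 trrr.
  by rewrite [\tr (r *m N)]mxtrace_mulC trNr !mulmxA; field.
have sdev : \sum_i \tr (dev (B i) *m dev (B i)) = 0.
  under eq_bigr do rewrite tdev.
  rewrite !sumrB (frame_parseval _ tN) (frame_parseval _ rt) NN4 trrr.
  rewrite -raddf_sum /= -mulmx_suml frame_sandwich mulmxDl -!scalemxAl mxtraceD !mxtraceZ.
  by rewrite !mulmxA trPNN trQNN; ring.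
have devB i : dev (B i) = 0.
  have Bh j : (B j) ^t* = B j by case: (Btan j).
  apply: mxtrace_mul_adj_eq0; rewrite devh //; move/eqP: sdev; rewrite psumr_eq0.
    by move/allP/(_ i (mem_index_enum _))/eqP.
  by move=> j _; rewrite -{2}(devh _ (Bh j)); apply: mxtrace_mul_adj_ge0.
have devD Y Z : dev (Y + Z) = dev Y + dev Z.
  by rewrite /dev !(mulmxDl, mulmxDr, mxtraceD, mulrDl, scalerDl); mxlin.
have devZ a Y : dev (a *: Y) = a *: dev Y.
  by rewrite /dev -!(scalemxAl, scalemxAr) !mxtraceZ; mxlin.
have dev0 : dev 0 = 0 by rewrite -[X in dev X](scale0r (0 : 'M[C]_n)) devZ scale0r.
have : dev X = 0.
  rewrite -(frame_expand tX) (big_morph _ devD dev0) big1 // => i _.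
  by rewrite devZ devB scaler0.
by rewrite /dev => /eqP; rewrite addr_eq0 subr_eq => /eqP ->; rewrite addrC.
Qed.

(* For c = 1 the plane is contained in the range of the projector N^2. *)
Lemma rank2_range : N *m N *m N = N -> P *m N *m N = P.
Proof.
move=> N3; have [Nh _] := tN.
have GG : N *m N *m (N *m N) = N *m N by rewrite mulmxA N3.
pose D := P - P *m N *m N.
have Dh : D ^t* = D by rewrite /D adjmxD adjmxN !adjmxM Padj Nh mulmxA -(sqr_comm tN) mulmxA.
have DD : D *m D = D.
  rewrite /D -mulmxA; move: (N *m N) (sqr_comm tN) GG => G PG GG.
  mxexpand; rewrite PP -[P *m G *m P]mulmxA -PG mulmxA PP -[P *m G *m G]mulmxA GG.
  by mxlin.
apply/esym/subr0_eq/mxtrace_mul_adj_eq0; rewrite -/D Dh DD /D mxtraceD mxtraceN'.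
by rewrite trP trPNN subrr.
Qed.

(** By [rank2_range] the matrix [1 - N ^ 2] is supported on the complement of the plane, where a
    tangent matrix has a zero block; the claim is the expansion of
    [(1 - N ^ 2) X (1 - N ^ 2) = 0]. *)
Lemma rank2_sqr X : N *m N *m N = N -> htangent X ->
  N *m N *m X + X *m N *m N = X + N *m N *m X *m N *m N.
Proof.
move=> N3 tX; have e := rank2_range N3.
have NNQ : (1%:M - N *m N) = (1%:M - N *m N) *m Q.
  by rewrite Qdef mulmxBr mulmx1 mulmxBl mul1mx -(sqr_comm tN) mulmxA e subrr subr0.
have QNN : (1%:M - N *m N) = Q *m (1%:M - N *m N).
  by rewrite Qdef mulmxBl mul1mx mulmxBr mulmx1 mulmxA e subrr subr0.
have QXQ : Q *m X *m Q = 0 by rewrite (tangent_QX tX) -mulmxA PQ mulmx0.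
have : (1%:M - N *m N) *m X *m (1%:M - N *m N) = 0.
  rewrite NNQ {2}QNN !mulmxA -[(1%:M - N *m N) *m Q *m X]mulmxA -[_ *m (Q *m X) *m Q]mulmxA QXQ.
  by rewrite mulmx0 !mul0mx.
by move=> E; apply: (lincomb1 (c := -1) E); mxexpand; mxlin.
Qed.

End Reeb.

End Frame.

(** * Traces involving the reflection in the plane *)

Section Reflection.
Variables (F : numFieldType) (n : nat) (s N : 'M[F]_n).
Implicit Types X Y M D : 'M[F]_n.
Definition anticommutes X := s *m X = - (X *m s).
Local Notation anti := anticommutes.
Hypotheses (ss : s *m s = 1%:M) (tN : anti N).

Lemma trace_reflection_rot X M : anti X ->
  \tr (s *m (X *m M)) = - \tr (s *m (M *m X)).
Proof.
move=> tX; rewrite mulmxA ?tX ?tY mulNmx mxtraceN' -mulmxA mxtrace_mulC.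
by rewrite mulmxA.
Qed.

(** Conjugation by [s] preserves the trace, fixes [D] and negates [X]: tangent matrices are
    orthogonal to block-diagonal ones. *)
Lemma trace_tangent_diag X D : anti X -> s *m D = D *m s -> \tr (X *m D) = 0.
Proof.
move=> tX sD; have e : \tr (X *m D) = - \tr (X *m D).
  transitivity (\tr (s *m (X *m D) *m s)).
    by rewrite [RHS]mxtrace_mulC !mulmxA ss mul1mx.
  rewrite mulmxA ?tX ?tY !mulNmx mxtraceN' -!mulmxA -sD.
  by rewrite [s *m (s *m D)]mulmxA ss mul1mx.
have /eqP : \tr (X *m D) *+ 2 = 0 by rewrite mulr2n {1}e addNr.
by rewrite mulrn_eq0 => /eqP.
Qed.

Lemma reflection_comm X Y : anti X -> anti Y ->
  s *m (X *m Y) = X *m Y *m s.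
Proof.
by move=> tX tY; rewrite mulmxA ?tX ?tY mulNmx -[X *m s *m Y]mulmxA ?tX ?tY mulmxN opprK mulmxA.
Qed.

(** Moving a tangent factor cyclically across [s] costs a sign. Modulo the eight rotations below,
    the traces with [X] or [Y] between the two [N] cancel and those with adjacent [N] add up; this
    is how [T] enters the Hopf identity. *)
Lemma trace_hopf X Y : anti X -> anti Y ->
  \tr (s *m (Y *m N + N *m Y) *m (X *m N - N *m X)) -
  \tr (s *m (X *m N + N *m X) *m (Y *m N - N *m Y)) =
  - 2 * \tr ((N *m N *m X + X *m N *m N) *m s *m Y).
Proof.
move=> tX tY.
have e1 := trace_reflection_rot (N *m X *m N) tY.
have e2 := trace_reflection_rot (N *m Y *m N) tX.
have e3 := trace_reflection_rot (N *m N *m X) tY.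
have e4 := trace_reflection_rot (N *m N *m Y) tX.
have e5 := trace_reflection_rot (Y *m X *m N) tN.
have e6 := trace_reflection_rot (X *m N *m N) tY.
have e7 := trace_reflection_rot (X *m Y *m N) tN.
have e8 := trace_reflection_rot (Y *m N *m N) tX.
have e9 : N *m N *m X *m s *m Y = - (s *m N *m N *m X *m Y).
  rewrite -[N *m N *m X *m s]mulmxA -[X *m s]opprK -?tX ?tY mulmxN mulNmx; congr (- _).
  by rewrite -[s *m N *m N]mulmxA reflection_comm // !mulmxA.
have e10 : X *m N *m N *m s *m Y = - (s *m X *m N *m N *m Y).
  rewrite -[X *m N *m N]mulmxA -[X *m (N *m N) *m s]mulmxA -reflection_comm // !mulmxA.
  by rewrite -[X *m s]opprK -?tX ?tY !mulNmx.
have -> : (N *m N *m X + X *m N *m N) *m s *m Y =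
  N *m N *m X *m s *m Y + X *m N *m N *m s *m Y by rewrite !mulmxDl.
rewrite e9 e10; move: e1 e2 e3 e4 e5 e6 e7 e8; mxexpand.
rewrite !(mxtraceD, mxtraceN') => e1 e2 e3 e4 e5 e6 e7 e8.
rewrite e1 e5 e6 e4 e7 e8 e3 e2.
ring.
Qed.

End Reflection.

(** * The Grassmannian inside the Hermitian matrices *)

Section SecondForm.
Variables (C : numClosedFieldType) (n : nat) (P s : 'M[C]_n).
Implicit Types X Y Z W V : 'M[C]_n.
Hypotheses (sdef : s = 1%:M - 2 *: P) (PP : P *m P = P) (Padj : P ^t* = P).
Local Notation tangent := (htangent P).

(* [s] is the reflection of the plane; it acts as -1 by conjugation on tangent
   vectors, which is what makes the Grassmannian a symmetric space. *)
Lemma tangent_anticommutes X : tangent X -> anticommutes s X.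
Proof.
move=> [_ Xt]; rewrite /anticommutes sdef mulmxBl mulmxBr mul1mx mulmx1 -scalemxAl -scalemxAr.
by apply: (lincomb1 (c := -2) Xt); mxexpand; mxlin.
Qed.

Lemma reflection_involutive : s *m s = 1%:M.
Proof. by rewrite sdef; mxexpand; rewrite PP; mxlin. Qed.

Lemma reflection_adj : s ^t* = s.
Proof. by rewrite sdef adjmxD adjmxN adjmxZ adjmx1 Padj conjC_nat. Qed.

Lemma anticommutator_comm X Y : tangent X -> tangent Y ->
  s *m (X *m Y + Y *m X) = (X *m Y + Y *m X) *m s.
Proof.
move=> /tangent_anticommutes aX /tangent_anticommutes aY.
by rewrite mulmxDr mulmxDl !reflection_comm.
Qed.

Lemma commutator_comm c X Y : tangent X -> tangent Y ->
  s *m (c *: (X *m Y - Y *m X)) = c *: (X *m Y - Y *m X) *m s.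
Proof.
move=> /tangent_anticommutes aX /tangent_anticommutes aY.
by rewrite -scalemxAr -scalemxAl mulmxBr mulmxBl !reflection_comm.
Qed.

(* Differentiating [P W + W P = W] shows that a derivative of a tangent field
   is tangent up to the second fundamental form of the Grassmannian. *)
Lemma tangent_derivative X W V : tangent X -> tangent W -> V ^t* = V ->
  X *m W + P *m V + (V *m P + W *m X) = V ->
  tangent (V - s *m (X *m W + W *m X)).
Proof.
move=> tX tW Vh Ve; have sK := anticommutator_comm tX tW.
case: (tX) => Xh _; case: (tW) => Wh _.
split.
  rewrite adjmxD adjmxN Vh adjmxM reflection_adj adjmxD !adjmxM Xh Wh sK.
  by rewrite [W *m X + _]addrC.
move: sK (reflection_involutive) Ve; set K := X *m W + W *m X => sK ss Ve.
have KE : s *m (s *m K) = K by rewrite mulmxA ss mul1mx.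
have P2 : 2 *: P = 1%:M - s by rewrite sdef; mxlin.
have s2 : 2 *: (P *m (s *m K)) = s *m K - K.
  by rewrite scalemxAl P2 mulmxBl mul1mx KE.
have s3 : 2 *: ((s *m K) *m P) = s *m K - K.
  by rewrite scalemxAr P2 mulmxBr mulmx1 -[X in _ - X]mulmxA -sK KE.
have two : (2 : C) != 0 by rewrite pnatr_eq0.
apply: (scalerI two).
have e : P *m V + V *m P = V - K by rewrite -[in RHS]Ve /K; mxlin.
rewrite mulmxBr mulmxBl.
have -> : P *m V - P *m (s *m K) + (V *m P - s *m K *m P) =
  (P *m V + V *m P) - (P *m (s *m K) + s *m K *m P) by mxlin.
by rewrite e scalerBr [2 *: (P *m _ + _)]scalerDr s2 s3; mxlin.
Qed.

Lemma trace_diag_mul K K' : s *m K = K *m s -> s *m K' = K' *m s ->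
  \tr (s *m K *m (s *m K')) = \tr (K *m K').
Proof. by move=> sK sK'; rewrite sK -mulmxA [s *m (s *m _)]mulmxA reflection_involutive mul1mx. Qed.

(** The second fundamental form of the Grassmannian is an anticommutator up to [s]; Gauss' equation
    combines two products of such terms, and here they are recognized as the double commutator. *)
Lemma trace_gauss X Y Z W :
  \tr ((Y *m Z + Z *m Y) *m (X *m W + W *m X)) - \tr ((X *m Z + Z *m X) *m (Y *m W + W *m Y)) =
  \tr (((X *m Y - Y *m X) *m Z - Z *m (X *m Y - Y *m X)) *m W).
Proof.
have e (A B : 'M[C]_n) : \tr (A *m (B *m W + W *m B)) = \tr (A *m B *m W) + \tr (B *m A *m W).
  by rewrite mulmxDr mxtraceD !mulmxA [\tr (A *m W *m B)]mxtrace_mulC !mulmxA.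
rewrite !e; mxexpand; rewrite !(mxtraceD, mxtraceN'); ring.
Qed.

End SecondForm.

(** * Coordinates in an adapted frame *)

Section FrameMatrices.
Variables (R : realFieldType) (V : zmodType) (d : nat) (tangent : V -> Prop)
  (g : V -> V -> R) (J : V -> V) (N : V) (E : 'I_d -> V).
Hypotheses (gC : forall X Y, g X Y = g Y X) (gNr : forall X Y, g X (- Y) = - g X Y)
  (tangentN : forall X, tangent X -> tangent (- X))
  (JT : forall X, tangent X -> tangent (J X)) (JN : forall X, J (- X) = - J X)
  (JJ : forall X, tangent X -> J (J X) = - X) (gJ : forall X Y, g (J X) Y = - g X (J Y))
  (tN : tangent N) (gNN : g N N = 1) (tE : forall i, tangent (E i))
  (gEE : forall i j, g (E i) (E j) = (i == j)%:R) (gEN : forall i, g (E i) N = 0)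
  (parseval : forall X Y, tangent X ->
     g X Y = g X N * g Y N + \sum_i g X (E i) * g Y (E i)).

(* Row [i] of [frame_mx f] holds the coordinates of [f (E i)]. *)
Definition frame_mx (f : V -> V) : 'M[R]_d := \matrix_(i, j) g (f (E i)) (E j).
Definition frame_row (X : V) : 'rV[R]_d := \row_j g X (E j).
Let reeb := - J N.
Let xi := frame_row reeb.
Let Phi := frame_mx J.

Lemma gNl X Y : g (- X) Y = - g X Y.
Proof. by rewrite gC gNr gC. Qed.

(** [h'] is the adjoint of [h] applied to [E j]. The frame lacks the direction [N], so by Parseval
    the product of matrices is the composition minus a normal contribution; in the applications one
    of its two factors vanishes, or it produces the [xi] terms. *)
Lemma frame_mx_mul f h h' i j : tangent (f (E i)) ->
  (forall X, tangent X -> g (h X) (E j) = g X h') ->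
  (frame_mx f *m frame_mx h) i j = g (f (E i)) h' - g (f (E i)) N * g h' N.
Proof.
move=> tf hh; rewrite mxE (parseval h' tf) addrC addKr.
by apply: eq_bigr => k _; rewrite !mxE hh // [g h' _]gC.
Qed.

Lemma frame_row_mul X h h' j : tangent X ->
  (forall Y, tangent Y -> g (h Y) (E j) = g Y h') ->
  (frame_row X *m frame_mx h) 0 j = g X h' - g X N * g h' N.
Proof.
move=> tX hh; rewrite mxE (parseval h' tX) addrC addKr.
by apply: eq_bigr => k _; rewrite !mxE hh // [g h' _]gC.
Qed.

Lemma gJNN : g (J N) N = 0.
Proof. have e : g (J N) N = - g (J N) N by rewrite {1}gJ gC. lra. Qed.

Lemma reeb_tangent : tangent reeb. Proof. exact/tangentN/JT. Qed.
Lemma reebN : g reeb N = 0. Proof. by rewrite gNl gJNN oppr0. Qed.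
Lemma J_reeb : J reeb = N. Proof. by rewrite /reeb JN JJ ?opprK. Qed.
Lemma gJ_normal X : g (J X) N = g X reeb. Proof. by rewrite gJ gNr. Qed.
Lemma reeb_reeb : g reeb reeb = 1. Proof. by rewrite -gJ_normal J_reeb. Qed.
Lemma gJ' X Y : g (J X) Y = g X (- J Y). Proof. by rewrite gJ gNr. Qed.

Lemma frame_outer i j : (xi^T *m xi) i j = g reeb (E i) * g reeb (E j).
Proof. by rewrite mxE big_ord1 !mxE. Qed.

Lemma frame_Phi_skew : Phi^T = - Phi.
Proof. by apply/matrixP => i j; rewrite !mxE gJ gC. Qed.

Lemma frame_Phi_sqr : Phi *m Phi = xi^T *m xi - 1%:M.
Proof.
apply/matrixP => i j; rewrite (frame_mx_mul (h' := - J (E j))); [|exact: JT|by move=> X _; exact: gJ'].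
rewrite mxE frame_outer mxE [_%:M _ _]mxE gJ_normal gNl gJ_normal gJ' JN JJ // opprK gNr gEE.
by rewrite [g (E i) reeb]gC [g (E j) reeb]gC; ring.
Qed.

Lemma frame_reeb_Phi : xi *m Phi = 0.
Proof.
apply/rowP => j; rewrite (frame_row_mul (h' := - J (E j))); [|exact: reeb_tangent|by move=> X _; exact: gJ'].
by rewrite -gJ' J_reeb gC gEN reebN mul0r subr0 mxE.
Qed.

Lemma frame_reeb_norm : xi *m xi^T = 1%:M.
Proof.
apply/matrixP => i j; rewrite !ord1 !mxE -reeb_reeb (parseval _ reeb_tangent).
by rewrite reebN mul0r add0r; apply: eq_bigr => k _; rewrite !mxE.
Qed.

Lemma frame_mx_sym f : (forall X Y, g (f X) Y = g X (f Y)) -> (frame_mx f)^T = frame_mx f.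
Proof. by move=> fs; apply/matrixP => i j; rewrite !mxE fs gC. Qed.

Section Operator.
Variables (T L : V -> V) (c : R).
Hypotheses (Tt : forall X, tangent X -> tangent (T X)) (Lt : forall X, tangent X -> tangent (L X))
  (Tadj : forall X Y, g (T X) Y = g X (T Y)) (Ladj : forall X Y, g (L X) Y = g X (L Y))
  (TJ : forall X, tangent X -> T (J X) = J (T X))
  (LJ : forall X, tangent X -> L (J X) = - J (L X))
  (TN : forall X, g X (T N) = 2 * c * g X N) (LN : forall X, g X (L N) = c * g X N)
  (Treeb : forall X, g X (T reeb) = 2 * c * g X reeb) (Lreeb : forall X, g X (L reeb) = - c * g X reeb).

Lemma frame_T_Phi : frame_mx T *m Phi = Phi *m frame_mx T.
Proof.
apply/matrixP => i j.
rewrite (frame_mx_mul (h' := - J (E j))); [|exact: Tt|by move=> X _; exact: gJ'].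
rewrite (frame_mx_mul (h' := T (E j))); [|exact: JT|by move=> X _; exact: Tadj].
rewrite [g (T (E i)) N]Tadj TN gEN [g (T (E j)) N]Tadj TN gEN !(mulr0, mul0r) !subr0.
by rewrite -gJ' -TJ // Tadj.
Qed.

Lemma frame_L_Phi : frame_mx L *m Phi = - (Phi *m frame_mx L).
Proof.
apply/matrixP => i j; rewrite [RHS]mxE.
rewrite (frame_mx_mul (h' := - J (E j))); [|exact: Lt|by move=> X _; exact: gJ'].
rewrite (frame_mx_mul (h' := L (E j))); [|exact: JT|by move=> X _; exact: Ladj].
rewrite [g (L (E i)) N]Ladj LN gEN [g (L (E j)) N]Ladj LN gEN !(mulr0, mul0r) !subr0.
by rewrite -Ladj LJ // gNl opprK gJ'.
Qed.

Lemma frame_reeb_T : xi *m frame_mx T = (2 * c) *: xi.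
Proof.
apply/rowP => j; rewrite (frame_row_mul (h' := T (E j))); [|exact: reeb_tangent|by move=> X _; exact: Tadj].
by rewrite reebN mul0r subr0 -Tadj gC Treeb gC !mxE.
Qed.

Lemma frame_reeb_L : xi *m frame_mx L = - c *: xi.
Proof.
apply/rowP => j; rewrite (frame_row_mul (h' := L (E j))); [|exact: reeb_tangent|by move=> X _; exact: Ladj].
by rewrite reebN mul0r subr0 -Ladj gC Lreeb gC !mxE.
Qed.

Lemma frame_mul_adj f h i j : (forall X, tangent X -> tangent (f X)) ->
  (forall X Y, g (h X) Y = g X (h Y)) -> (forall X, tangent X -> g (h X) N = c * g X N \/ g (h X) N = 2 * c * g X N) ->
  (frame_mx f *m frame_mx h) i j = g (f (E i)) (h (E j)).
Proof.
move=> ft hadj hN; rewrite (frame_mx_mul (h' := h (E j))); [|exact: ft|by move=> X _; exact: hadj].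
by case: (hN (E j)) => // ->; rewrite gEN !mulr0 subr0.
Qed.

Lemma LN' X : g (L X) N = c * g X N. Proof. by rewrite Ladj LN. Qed.
Lemma TN' X : g (T X) N = 2 * c * g X N. Proof. by rewrite Tadj TN. Qed.

Lemma frame_rank1_L :
  (forall X Y, tangent X -> tangent Y -> g (L X) Y = 2 * g X N * g Y N - 2 * g X reeb * g Y reeb) ->
  frame_mx L = - 2 *: (xi^T *m xi).
Proof.
move=> Lrk; apply/matrixP => i j; rewrite mxE Lrk // !gEN [RHS]mxE frame_outer.
by rewrite [g (E i) reeb]gC [g (E j) reeb]gC; ring.
Qed.

Lemma frame_rank1_T :
  (forall X Y, tangent X -> tangent Y -> g (L X) Y = 2 * g X N * g Y N - 2 * g X reeb * g Y reeb) ->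
  (forall X Y, tangent X -> tangent Y -> g (T X) (T Y) = 2 * g (T X) Y + 2 * g (L X) (L Y)) ->
  frame_mx T *m frame_mx T = 2 *: frame_mx T + 8 *: (xi^T *m xi).
Proof.
move=> Lrk TT; apply/matrixP => i j.
rewrite frame_mul_adj //; last by move=> X _; right; exact: TN'.
rewrite TT // Lrk //; last exact: Lt.
rewrite !LN' !gEN [g (L _) reeb]Lrk //; last exact: reeb_tangent.
rewrite !gEN reebN reeb_reeb.
have -> : (2 *: frame_mx T + 8 *: (xi^T *m xi)) i j =
  2 * g (T (E i)) (E j) + 8 * (g reeb (E i) * g reeb (E j)).
  by rewrite mxE; congr (_ + _); rewrite mxE ?frame_outer // [frame_mx T i j]mxE.
by rewrite [g (E i) reeb]gC [g (E j) reeb]gC; ring.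
Qed.

Lemma frame_rank2_T :
  (forall X Y, tangent X -> tangent Y -> g (T X) Y = g X Y + g (L X) (L Y)) ->
  frame_mx T = 1%:M + frame_mx L *m frame_mx L.
Proof.
move=> TL; apply/matrixP => i j; rewrite mxE TL // [RHS]mxE [_%:M _ _]mxE gEE.
by rewrite frame_mul_adj // => X _; left; exact: LN'.
Qed.

Lemma frame_rank2_L3 : (forall X, tangent X -> L (L (L X)) = L X) ->
  frame_mx L *m frame_mx L *m frame_mx L = frame_mx L.
Proof.
move=> L3; have -> : frame_mx L *m frame_mx L = frame_mx (L \o L).
  apply/matrixP => i j; rewrite frame_mul_adj //; first by rewrite [RHS]mxE -Ladj.
  by move=> X _; left; exact: LN'.
apply/matrixP => i j; rewrite frame_mul_adj //; first by rewrite [RHS]mxE -Ladj /= L3.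
- by move=> X tX; apply/Lt/Lt.
- by move=> X _; left; exact: LN'.
Qed.

Section Contradiction.
Variables (m : nat) (A : 'M[R]_d) (k al : R).
Let S := (4 * m%:R + 8)%:M - frame_mx T + 2 *: frame_mx L + \tr A *: A - A *m A.
Hypotheses (m3 : (3 <= m)%N) (dE : d.+1 = (4 * m)%N) (k0 : k != 0)
  (Asym : A^T = A) (xiA : xi *m A = al *: xi)
  (cond : forall x y : 'rV[R]_d,
    (x *m A *m Phi *m (y *m S)^T) 0 0 *: xi - (y *m S *m xi^T) 0 0 *: (x *m A *m Phi)
      - (k * (x *m xi^T) 0 0) *: (y *m S *m Phi) =
    (x *m A *m Phi *m y^T) 0 0 *: (xi *m S) - (y *m xi^T) 0 0 *: (x *m A *m Phi *m S)
      - (k * (x *m xi^T) 0 0) *: (y *m Phi *m S)).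

Lemma frame_S_sym : S^T = S.
Proof.
have Ts : (frame_mx T)^T = frame_mx T by apply: frame_mx_sym.
have Ls : (frame_mx L)^T = frame_mx L by apply: frame_mx_sym.
rewrite /S; move: (frame_mx T) (frame_mx L) Ts Ls => T' L' Ts Ls.
rewrite linearB linearD linearD linearB /= tr_scalar_mx !linearZ /= Ts Ls Asym trmx_mul Asym.
by [].
Qed.

Lemma frame_cond : exists sigma,
  [/\ S *m Phi = Phi *m S, xi *m S = sigma *: xi & A *m (S - sigma%:M) = 0].
Proof.
apply: gtw_condition cond => //; first exact: frame_S_sym.
- exact: frame_Phi_skew.
- exact: frame_Phi_sqr.
- exact: frame_reeb_Phi.
- exact: frame_reeb_norm.
- exact: xiA.
Qed.

Hypotheses
  (hopfE : forall x y : 'rV[R]_d, x *m xi^T = 0 -> y *m xi^T = 0 ->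
    x *m (A *m Phi *m A - (al / 2) *: (A *m Phi + Phi *m A) - frame_mx T *m Phi) *m y^T = 0)
  (trT : \tr (frame_mx T) = 4 * m%:R + 8 - 2 * c) (trL : \tr (frame_mx L) = - c).

(** [hopfE] gives information off [xi] only. The difference [M] of the two sides kills [xi] on the
    left and on the right, so replacing any row by its projection off [xi] changes nothing. *)
Lemma frame_hopf :
  A *m Phi *m A = (al / 2) *: (A *m Phi + Phi *m A) + frame_mx T *m Phi.
Proof.
pose M := A *m Phi *m A - (al / 2) *: (A *m Phi + Phi *m A) - frame_mx T *m Phi.
suff : M = 0 by rewrite /M => /subr0_eq/eqP; rewrite subr_eq addrC => /eqP.
have xP := frame_reeb_Phi; have xx := frame_reeb_norm; have Pskew := frame_Phi_skew.
have Pxi : Phi *m xi^T = 0.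
  by apply: trmx_inj; rewrite trmx_mul trmxK Pskew mulmxN xP oppr0 trmx0.
have Axi : A *m xi^T = al *: xi^T.
  by apply: trmx_inj; rewrite trmx_mul trmxK Asym xiA linearZ /= trmxK.
have xM : xi *m M = 0.
  rewrite /M; mxexpand; rewrite xiA frame_reeb_T; mxexpand; rewrite xP.
  by mxexpand; rewrite ?scaler0 !(mul0mx, addr0, subr0, scaler0).
have Mx : M *m xi^T = 0.
  rewrite /M; mxexpand; rewrite -![_ *m Phi *m xi^T]mulmxA Pxi !mulmx0.
  rewrite -[_ *m A *m xi^T]mulmxA -[Phi *m A *m xi^T]mulmxA Axi -!scalemxAr -[_ *m Phi *m xi^T]mulmxA Pxi.
  by rewrite ?mulmx0 !(scaler0, addr0, subr0).
pose pr (z : 'rV[R]_d) := z - (z *m xi^T) *m xi.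
have px z : pr z *m xi^T = 0.
  by rewrite mulmxBl -[_ *m xi *m xi^T]mulmxA xx mulmx1 subrr.
have prM z : pr z *m M = z *m M.
  by rewrite mulmxBl -[_ *m xi *m M]mulmxA xM mulmx0 subr0.
have Mpr z : M *m (pr z)^T = M *m z^T.
  rewrite /pr linearB /= mulmxBr [(_ *m xi)^T]trmx_mul mulmxA Mx mul0mx subr0.
  by [].
apply/matrixP => i j; have := hopfE (px (delta_mx 0 i)) (px (delta_mx 0 j)).
rewrite -/M prM -mulmxA Mpr mulmxA -rowE trmx_delta -colE => /matrixP/(_ 0 0).
by rewrite !mxE.
Qed.

(** This is [S - sigma]. On [xi] the operators [T], [L], [A] are the scalars [2 c], [- c], [al],
    which determines [sigma = 4 m + 8 - 4 c + \tr A * al - al ^ 2]. *)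
Let W := (4 * c - \tr A * al + al ^+ 2)%:M - frame_mx T + 2 *: frame_mx L + \tr A *: A - A *m A.

Lemma frame_W : [/\ W *m Phi = Phi *m W, A *m W = 0, W *m xi^T = 0 & W^T = W].
Proof.
have [sigma [SPhi xiS AS]] := frame_cond.
have sE : sigma = 4 * m%:R + 8 - 4 * c + \tr A * al - al ^+ 2.
  have e : xi *m S = (4 * m%:R + 8 - 4 * c + \tr A * al - al ^+ 2) *: xi.
    rewrite /S; mxexpand; rewrite frame_reeb_T frame_reeb_L xiA -scalemxAl xiA.
    by mxlin.
  have : (sigma - (4 * m%:R + 8 - 4 * c + \tr A * al - al ^+ 2)) *: xi = 0.
    by rewrite scalerBl -xiS e subrr.
  case/scalemx_eq0P => [/subr0_eq //|x0].
  move: frame_reeb_norm; rewrite -/xi x0 mul0mx => /(congr1 mxtrace)/eqP.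
  rewrite mxtrace0 mxtrace1 eq_sym oner_eq0; by [].
have WE : W = S - sigma%:M by rewrite /W /S sE; mxlin.
have Ws : W^T = W by rewrite WE linearB /= frame_S_sym tr_scalar_mx.
split=> //.
- by rewrite WE mulmxBl mulmxBr SPhi mul_scalar_mx mul_mx_scalar.
- by rewrite WE.
- apply: trmx_inj; rewrite trmx_mul trmxK Ws trmx0 WE mulmxBr xiS mul_mx_scalar subrr.
  by [].
Qed.

Lemma frame_contra_rank1 : c = 2 ->
  (forall X Y, tangent X -> tangent Y -> g (L X) Y = 2 * g X N * g Y N - 2 * g X reeb * g Y reeb) ->
  (forall X Y, tangent X -> tangent Y -> g (T X) (T Y) = 2 * g (T X) Y + 2 * g (L X) (L Y)) ->
  False.
Proof.
move=> c2 Lrk TT; have [WPhi AW Wxi Wsym] := frame_W.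
have m2 : (2 <= m)%N by apply: leq_trans m3.
have T2 := frame_rank1_T Lrk TT; have L1 := frame_rank1_L Lrk.
apply: (@rank1_contra R d A Phi (frame_mx T) W xi al (2 * c)) m2 _ erefl T2 _ _ => //.
- exact: frame_Phi_skew.
- by apply: frame_mx_sym.
- exact: frame_Phi_sqr.
- exact: frame_reeb_Phi.
- exact: frame_reeb_norm.
- exact: frame_reeb_T.
- exact: frame_T_Phi.
- exact: frame_hopf.
- by rewrite c2 -natrM.
- by rewrite trT c2 natrD natrM; ring.
- by rewrite /W L1 c2; mxlin.
Qed.

Lemma frame_contra_rank2 : c = 1 ->
  (forall X Y, tangent X -> tangent Y -> g (T X) Y = g X Y + g (L X) (L Y)) ->
  (forall X, tangent X -> L (L (L X)) = L X) -> False.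
Proof.
move=> c1 TL L3; have [WPhi AW Wxi Wsym] := frame_W.
have T2 := frame_rank2_T TL; have L3' := frame_rank2_L3 L3.
apply: (@rank2_contra R d A Phi (frame_mx T) W xi al (2 * c)) (frame_mx L) _ m m3 dE erefl _ _ L3' _ _ _ (T2) _ => //.
- exact: frame_Phi_skew.
- by apply: frame_mx_sym.
- exact: frame_Phi_sqr.
- exact: frame_reeb_Phi.
- exact: frame_reeb_norm.
- exact: frame_reeb_T.
- exact: frame_T_Phi.
- exact: frame_hopf.
- by apply: frame_mx_sym.
- by rewrite frame_reeb_L c1 scaleN1r.
- exact: frame_L_Phi.
- by rewrite trL c1.
- have := trT; rewrite T2 mxtraceD mxtrace1 c1.
  have -> : d%:R = 4 * m%:R - 1 :> R by rewrite -natrM -dE -addn1 natrD addrK.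
  by move: (\tr _) => x; lra.
- by rewrite /W c1; mxlin.
Qed.

End Contradiction.
End Operator.
End FrameMatrices.

(** * The tangent space of the Grassmannian *)

Section Gmetric.
Variables (R : realType) (n : nat).
Implicit Types X Y Z M : 'M[R[i]]_n.
Local Notation "r %:C" := (real_complex R r).

Lemma Re_add (a b : R[i]) : complex.Re (a + b) = complex.Re a + complex.Re b.
Proof. by case: a; case: b. Qed.
Lemma Re_opp (a : R[i]) : complex.Re (- a) = - complex.Re a.
Proof. by case: a. Qed.
Lemma Re_scale (r : R) (a : R[i]) : complex.Re (r%:C * a) = r * complex.Re a.
Proof. by case: a => a b /=; rewrite mul0r subr0. Qed.
Lemma Im_add (a b : R[i]) : complex.Im (a + b) = complex.Im a + complex.Im b.
Proof. by case: a; case: b. Qed.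

Lemma gmetricC X Y : gmetric X Y = gmetric Y X.
Proof. by rewrite /gmetric mxtrace_mulC. Qed.
Lemma gmetricDl X Y Z : gmetric (X + Y) Z = gmetric X Z + gmetric Y Z.
Proof. by rewrite /gmetric mulmxDl mxtraceD Re_add mulrDl. Qed.
Lemma gmetricDr X Y Z : gmetric X (Y + Z) = gmetric X Y + gmetric X Z.
Proof. by rewrite /gmetric mulmxDr mxtraceD Re_add mulrDl. Qed.
Lemma gmetricNl X Y : gmetric (- X) Y = - gmetric X Y.
Proof. by rewrite /gmetric mulNmx raddfN /= Re_opp mulNr. Qed.
Lemma gmetricNr X Y : gmetric X (- Y) = - gmetric X Y.
Proof. by rewrite gmetricC gmetricNl gmetricC. Qed.
Lemma gmetricBl X Y Z : gmetric (X - Y) Z = gmetric X Z - gmetric Y Z.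
Proof. by rewrite gmetricDl gmetricNl. Qed.
Lemma gmetricBr X Y Z : gmetric X (Y - Z) = gmetric X Y - gmetric X Z.
Proof. by rewrite gmetricDr gmetricNr. Qed.
Lemma gmetricZl (r : R) X Y : gmetric (r%:C *: X) Y = r * gmetric X Y.
Proof. by rewrite /gmetric -scalemxAl mxtraceZ Re_scale mulrA. Qed.
Lemma gmetricZr (r : R) X Y : gmetric X (r%:C *: Y) = r * gmetric X Y.
Proof. by rewrite gmetricC gmetricZl gmetricC. Qed.
Lemma gmetric0l X : gmetric 0 X = 0.
Proof. by rewrite /gmetric mul0mx mxtrace0 mul0r. Qed.
Lemma gmetric_suml (I : finType) (F : I -> 'M[R[i]]_n) Y :
  gmetric (\sum_i F i) Y = \sum_i gmetric (F i) Y.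
Proof. exact: (big_morph (fun X => gmetric X Y) (fun X Z => gmetricDl X Z Y) (gmetric0l Y)). Qed.
Lemma gmetric_sumr (I : finType) (F : I -> 'M[R[i]]_n) Y :
  gmetric Y (\sum_i F i) = \sum_i gmetric Y (F i).
Proof. by rewrite gmetricC gmetric_suml; apply: eq_bigr => i _; rewrite gmetricC. Qed.
Lemma gmetricA X M Y : gmetric (X *m M) Y = gmetric X (M *m Y).
Proof. by rewrite /gmetric mulmxA. Qed.
Lemma gmetric_cycle M X Y : gmetric (M *m X) Y = gmetric X (Y *m M).
Proof. by rewrite /gmetric -mulmxA mxtrace_mulC mulmxA. Qed.

(** Lets identities proved for complex traces be read as identities for the real metric, and
    conversely. *)
Lemma hermitian_trace X Y : X ^t* = X -> Y ^t* = Y -> \tr (X *m Y) = (4 * gmetric X Y)%:C.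
Proof.
move=> Xh Yh; rewrite /gmetric mulrC divfK ?pnatr_eq0 //.
have : (\tr (X *m Y))^* = \tr (X *m Y).
  by rewrite -mxtrace_adj adjmxM Xh Yh mxtrace_mulC.
case: (\tr _) => a b /= e; have {}e : Complex a (- b) = Complex a b by exact: e.
case: e => /eqP; rewrite eq_sym -subr_eq0 opprK -mulr2n mulrn_eq0 /= => /eqP ->.
by [].
Qed.

Lemma gmetric_eq0 X : X ^t* = X -> gmetric X X = 0 -> X = 0.
Proof.
move=> Xh X0; apply: mxtrace_mul_adj_eq0; rewrite Xh hermitian_trace // X0 mulr0.
by [].
Qed.

End Gmetric.

Section Tangent.
Variables (R : realType) (n : nat) (P : 'M[R[i]]_n).
Local Notation "r %:C" := (real_complex R r).
Local Notation g := gmetric.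
Local Notation J := (gJ P).
Hypotheses (PP : P *m P = P) (Padj : P ^t* = P).
Implicit Types X Y N : 'M[R[i]]_n.

Local Notation ci := (Complex 0 1 : R[i]).

Lemma ci2 : ci * ci = - 1.
Proof. by apply/eqP; rewrite eq_complex /= !(mul0r, mulr0, mulr1, addr0, add0r, sub0r, oppr0) !eqxx. Qed.

Lemma ci_conj : ci^* = - ci.
Proof. by apply/eqP; rewrite eq_complex /= oppr0 !eqxx. Qed.

Lemma grass2_tangentD X Y : grass2_tangent P X -> grass2_tangent P Y -> grass2_tangent P (X + Y).
Proof.
move=> [Xh Xt] [Yh Yt]; split; first by rewrite adjmxD Xh Yh.
by rewrite mulmxDr mulmxDl addrACA Xt Yt.
Qed.

Lemma grass2_tangentN X : grass2_tangent P X -> grass2_tangent P (- X).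
Proof.
move=> [Xh Xt]; split; first by rewrite adjmxN Xh.
by rewrite mulmxN mulNmx -opprD Xt.
Qed.

Lemma grass2_tangentZ (r : R) X : grass2_tangent P X -> grass2_tangent P (r%:C *: X).
Proof.
move=> [Xh Xt]; split; last by rewrite -scalemxAr -scalemxAl -scalerDr Xt.
rewrite adjmxZ Xh; congr (_ *: _).
by apply/eqP; rewrite eq_complex /= oppr0 !eqxx.
Qed.

Lemma gJ_tangent X : grass2_tangent P X -> grass2_tangent P (J X).
Proof.
move=> tX; case: (tX) => Xh Xt; split.
  by rewrite /gJ adjmxZ ci_conj adjmxD adjmxN !adjmxM Xh Padj scaleNr -scalerN opprB.
rewrite /gJ -scalemxAr -scalemxAl -scalerDr; congr (_ *: _).
mxexpand; rewrite -[X *m P *m P]mulmxA PP (tangent_PXP (Q := 1%:M - P)) //.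
by mxlin.
Qed.

Lemma gJ_gJ X : grass2_tangent P X -> J (J X) = - X.
Proof.
move=> tX; rewrite /gJ -scalemxAr -scalemxAl -scalerBr scalerA ci2 scaleN1r; congr (- _).
rewrite -[RHS](proj2 tX); mxexpand; rewrite -[X *m P *m P]mulmxA PP (tangent_PXP (Q := 1%:M - P)) //.
by mxlin.
Qed.

Lemma gJD X Y : J (X + Y) = J X + J Y.
Proof. by rewrite /gJ mulmxDl mulmxDr -scalerDr opprD addrACA. Qed.

Lemma gJN X : J (- X) = - J X.
Proof. by rewrite /gJ mulNmx mulmxN -scalerN opprD. Qed.

Lemma gmetric_J X Y : g (J X) Y = - g X (J Y).
Proof.
rewrite /gmetric /gJ -scalemxAl -scalemxAr !mxtraceZ mulmxBl mulmxBr !mxtraceD !raddfN /=.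
rewrite -mulmxA -[P *m X *m Y]mulmxA [\tr (P *m (X *m Y))]mxtrace_mulC -!mulmxA.
by rewrite -opprB mulrN Re_opp mulNr.
Qed.

Lemma gmetric_J_self X : g (J X) X = 0.
Proof. by have e : g (J X) X = - g (J X) X by [rewrite {1}gmetric_J gmetricC]; lra. Qed.

Variable N : 'M[R[i]]_n.
Hypothesis tN : grass2_tangent P N.
Variable s : 'M[R[i]]_n.
Hypothesis sdef : s = 1%:M - 2 *: P.

Lemma gJE X : grass2_tangent P X -> J X = - ci *: (X *m s).
Proof.
move=> [_ Xt]; rewrite /gJ sdef mulmxBr mulmx1 -scalemxAr scaleNr -scalerN; congr (_ *: _).
by rewrite -[X in _ = - (X - _)]Xt; mxlin.
Qed.

(** [AX] stands for the image of [X] under the shape operator. This formula and the next one are the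
    flat derivatives of [N] and of [- J N] along [X], as [normal_derivativeE] and [reeb_derivativeE]
    confirm; their second summands are block-diagonal, that is, normal to the Grassmannian. *)
Definition normal_derivative X AX := - AX + s *m (X *m N + N *m X).
Definition reeb_derivative X AX := J AX + ci *: (X *m N - N *m X).

(** Tangent and block-diagonal summands are orthogonal, so each pairing splits: the tangent parts
    give the term quadratic in the shape operator, the diagonal parts are handled by
    [trace_hopf]. *)
Lemma hopf_algebra X Y AX AY : grass2_tangent P X -> grass2_tangent P Y ->
  grass2_tangent P AX -> grass2_tangent P AY ->
  g (normal_derivative Y AY) (reeb_derivative X AX) -
  g (normal_derivative X AX) (reeb_derivative Y AY) =
  - 2 * g (J AX) AY + 2 * g (J (N *m N *m X + X *m N *m N)) Y.
Proof.
move=> tX tY tAX tAY; rewrite /normal_derivative /reeb_derivative.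
have aN := tangent_anticommutes sdef tN.
have reflection_comm' U V : grass2_tangent P U -> grass2_tangent P V -> s *m (U *m V) = U *m V *m s.
  by move=> tU tV; apply: reflection_comm; apply: (tangent_anticommutes sdef).
have diagA Z : grass2_tangent P Z -> s *m (s *m (Z *m N + N *m Z)) = s *m (Z *m N + N *m Z) *m s.
  by move=> tZ; rewrite -mulmxA; congr (_ *m _); rewrite mulmxDl mulmxDr !reflection_comm' //.
have diagB Z : grass2_tangent P Z -> s *m (ci *: (Z *m N - N *m Z)) = ci *: (Z *m N - N *m Z) *m s.
  by move=> tZ; rewrite -scalemxAr -scalemxAl; congr (_ *: _); rewrite mulmxBl mulmxBr !reflection_comm' //.
have g0 W D : grass2_tangent P W -> s *m D = D *m s -> g W D = 0.
  by move=> tW sD; rewrite /gmetric (trace_tangent_diag (reflection_involutive sdef PP) (tangent_anticommutes sdef tW)) // mul0r.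
have gsum W D W' D' : grass2_tangent P W -> grass2_tangent P W' -> s *m D = D *m s ->
    s *m D' = D' *m s -> g (- W + D) (W' + D') = - g W W' + g D D'.
  move=> tW tW' sD sD'; have z1 := g0 W D' tW sD'; have z2 := g0 W' D tW' sD.
  by rewrite gmetricDl !gmetricDr !gmetricNl z1 [g D W']gmetricC z2 oppr0 addr0 add0r.
rewrite !gsum //; try exact: gJ_tangent; try exact: diagA; try exact: diagB.
have tr := trace_hopf aN (tangent_anticommutes sdef tX) (tangent_anticommutes sdef tY).
have gJJ : - g AX (J AY) = g (J AX) AY by rewrite gmetric_J.
rewrite [g AY _]gmetricC.
have tT : grass2_tangent P (N *m N *m X + X *m N *m N).
  exact: (sqr_anticomm_tangent erefl).
have -> : 2 * g (J (N *m N *m X + X *m N *m N)) Y =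
   g (s *m (Y *m N + N *m Y)) (ci *: (X *m N - N *m X)) -
   g (s *m (X *m N + N *m X)) (ci *: (Y *m N - N *m Y)).
  rewrite gJE // /gmetric -!scalemxAr -!scalemxAl !mxtraceZ -mulrBl -Re_opp -Re_add -mulrBr tr.
  have -> (t : R[i]) : ci * (- 2 * t) = - ci * t + - ci * t by ring.
  by rewrite Re_add; field.
by rewrite gJJ; move: (g (J AX) AY) (g (s *m _) _) (g (s *m _) _) => x y z; ring.
Qed.

End Tangent.

(** * The contradiction at a single point *)

Section PointFrame.
Variables (R : realType) (n m d : nat) (P N : 'M[R[i]]_n) (E : 'I_d -> 'M[R[i]]_n).
Local Notation "r %:C" := (real_complex R r).
Local Notation g := (@gmetric R n).
Local Notation J := (gJ P).
Local Notation tangent := (grass2_tangent P).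
Implicit Types X Y : 'M[R[i]]_n.
Hypotheses (PP : P *m P = P) (Padj : P ^t* = P) (trP : \tr P = 2) (trQ : \tr (1%:M - P) = m%:R)
  (tN : tangent N) (gNN : g N N = 1) (tE : forall i, tangent (E i))
  (gEE : forall i j, g (E i) (E j) = (i == j)%:R) (gEN : forall i, g (E i) N = 0)
  (dE : d.+1 = (4 * m)%N).

(** [N] takes index [0]; with it the [4 m - 1] frame vectors become the [4 m] that completeness
    requires. *)
Definition full_frame (i : 'I_d.+1) := if unlift ord0 i is Some j then E j else N.
Local Notation B := full_frame.

Lemma full_frame0 : B ord0 = N. Proof. by rewrite /B unlift_none. Qed.
Lemma full_frameS j : B (lift ord0 j) = E j. Proof. by rewrite /B liftK. Qed.

Lemma full_frame_tangent i : tangent (B i).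
Proof. by case: (unliftP ord0 i) => [j ->|->]; rewrite ?full_frameS ?full_frame0. Qed.

Lemma full_frame_on i j : \tr (B i *m B j) = 4 * (i == j)%:R.
Proof.
have [Bi _] := full_frame_tangent i; have [Bj _] := full_frame_tangent j.
have gB : g (B i) (B j) = (i == j)%:R; last by rewrite hermitian_trace // gB rmorphM /= !rmorph_nat.
case: (unliftP ord0 i) => [a ->|->]; case: (unliftP ord0 j) => [b ->|->];
  rewrite ?full_frameS ?full_frame0 ?gEE ?gEN ?gNN //.
by rewrite gmetricC gEN.
Qed.

Lemma full_frame_dim : d.+1%:R = 2 * \tr P * \tr (1%:M - P).
Proof. by rewrite trP trQ dE !natrM; ring. Qed.

Local Notation frame lem := (lem _ _ _ _ erefl PP Padj _ _ full_frame_tangent full_frame_on full_frame_dim).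

Lemma sum_full_frame (V : nmodType) (F : 'M[R[i]]_n -> V) :
  \sum_i F (B i) = F N + \sum_i F (E i).
Proof.
rewrite big_ord_recl full_frame0; congr (_ + _).
by apply: eq_bigr => i _; rewrite full_frameS.
Qed.

Lemma tangent_expand X : tangent X ->
  X = (g X N)%:C *: N + \sum_i (g X (E i))%:C *: E i.
Proof.
move=> tX; rewrite -[LHS](frame frame_expand) //.
rewrite (sum_full_frame (fun Y => (\tr (Y *m X) / 4) *: Y)).
have e Y : tangent Y -> \tr (Y *m X) / 4 = (g X Y)%:C.
  move=> [Yh _]; case: tX => Xh _; rewrite hermitian_trace // gmetricC rmorphM /= rmorph_nat.
  by rewrite mulrAC divff ?mul1r // pnatr_eq0.
by rewrite e //; congr (_ + _); apply: eq_bigr => i _; rewrite e.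
Qed.

Lemma tangent_parseval X Y : tangent X ->
  g X Y = g X N * g Y N + \sum_i g X (E i) * g Y (E i).
Proof.
move=> tX; rewrite {1}(tangent_expand tX) gmetricDl gmetricZl gmetric_suml [g N Y]gmetricC; congr (_ + _).
by apply: eq_bigr => i _; rewrite gmetricZl [g (E i) Y]gmetricC.
Qed.

Lemma tangent_eq0 X : tangent X -> g X N = 0 -> (forall i, g X (E i) = 0) -> X = 0.
Proof.
move=> tX XN XE; rewrite (tangent_expand tX) XN scale0r add0r big1 // => i _.
by rewrite XE scale0r.
Qed.

(** The Casimir sum over the full frame minus its term at [N], which is the double commutator
    [T X - 2 L X]. *)
Lemma gmetric_casimir X Y : tangent X -> tangent Y ->
  \sum_i g ((X *m E i - E i *m X) *m E i - E i *m (X *m E i - E i *m X)) Y =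
  (4 * m%:R + 8) * g X Y - g (N *m N *m X + X *m N *m N) Y + 2 * g (N *m X *m N) Y.
Proof.
move=> tX tY; rewrite -gmetric_suml.
have e := frame frame_casimir tX.
rewrite (sum_full_frame (fun Z => (X *m Z - Z *m X) *m Z - Z *m (X *m Z - Z *m X))) trP trQ in e.
have -> : \sum_i ((X *m E i - E i *m X) *m E i - E i *m (X *m E i - E i *m X)) =
    (4 * m%:R + 8)%:C *: X - (N *m N *m X + X *m N *m N) + (2 : R)%:C *: (N *m X *m N).
  rewrite !rmorphD !rmorphM /= !rmorph_nat.
  apply: (lincomb1 (c := 1) e); move: (\sum_i _) => Z; mxexpand; mxlin.
by rewrite gmetricDl gmetricBl !gmetricZl.
Qed.

Let ci : R[i] := Complex 0 1.
Local Notation T := (fun X => N *m N *m X + X *m N *m N).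
Local Notation L := (fun X => N *m X *m N).
Local Notation reeb := (- J N).

Lemma reeb_gJ : reeb = - (ci *: (N *m P - P *m N)). Proof. by []. Qed.

Lemma trNN : \tr (N *m N) = 4.
Proof. by case: tN => Nh _; rewrite hermitian_trace // gNN mulr1 rmorph_nat. Qed.

Lemma T_adj X Y : g (T X) Y = g X (T Y).
Proof.
rewrite gmetricDl gmetricDr addrC; congr (_ + _); first by rewrite !gmetricA mulmxA.
by rewrite gmetric_cycle mulmxA.
Qed.

Lemma L_adj X Y : g (L X) Y = g X (L Y).
Proof. by rewrite gmetricA gmetric_cycle. Qed.

Lemma T_J X : tangent X -> T (J X) = J (T X).
Proof.
move=> tX; rewrite /gJ -!scalemxAr -!scalemxAl -scalerDr; congr (_ *: _).
exact: (sqr_commutator erefl tN).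
Qed.

Lemma L_J X : tangent X -> L (J X) = - J (L X).
Proof.
move=> tX; rewrite /gJ -scalemxAr -scalemxAl -scalerN; congr (_ *: _).
exact: (sandwich_commutator erefl tN).
Qed.

Section Cube.
Variable c : R.
Hypothesis N3 : N *m N *m N = c%:C *: N.

Lemma T_N X : g X (T N) = 2 * c * g X N.
Proof.
have -> : T N = (2 * c)%:C *: N; last by rewrite gmetricZr.
by rewrite /= N3 -scalerDl -rmorphD /= mulr_natl mulr2n.
Qed.

Lemma L_N X : g X (L N) = c * g X N. Proof. by rewrite /= N3 gmetricZr. Qed.

Lemma T_reeb X : g X (T reeb) = 2 * c * g X reeb.
Proof.
have -> : T reeb = (2 * c)%:C *: reeb; last by rewrite gmetricZr.
rewrite /= reeb_gJ (reeb_sqr erefl ci tN N3) (reeb_sqr_r erefl ci tN N3) -scalerDl -rmorphD /= mulr_natl mulr2n.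
by [].
Qed.

Lemma L_reeb X : g X (L reeb) = - c * g X reeb.
Proof.
have -> : L reeb = (- c)%:C *: reeb; last by rewrite gmetricZr.
by rewrite /= reeb_gJ (reeb_sandwich erefl ci tN N3) rmorphN.
Qed.

(** A trace over the hypersurface is the trace over the full frame minus the contribution of [N],
    which is [2 c] for [T] and [c] for [L]. *)
Lemma trace_full_frame f (r : R) : (forall Z, tangent Z -> tangent (f Z)) ->
  \sum_i \tr (f (B i) *m B i) = (4 * r)%:C -> \sum_i g (f (E i)) (E i) = r - g (f N) N.
Proof.
move=> ft; rewrite (sum_full_frame (fun Z => \tr (f Z *m Z))).
have e Z : tangent Z -> \tr (f Z *m Z) = (4 * g (f Z) Z)%:C.
  by move=> tZ; apply: hermitian_trace; [case: (ft _ tZ) | case: tZ].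
rewrite e //; under eq_bigr do rewrite e //.
rewrite -rmorph_sum -rmorphD /= => /complexI; rewrite -mulr_sumr -mulrDr => /(mulfI _) <- //.
  by rewrite addrC addKr.
by rewrite pnatr_eq0.
Qed.

Lemma trace_T : \sum_i g (T (E i)) (E i) = 4 * m%:R + 8 - 2 * c.
Proof.
rewrite (trace_full_frame (f := T) (r := 4 * m%:R + 8)).
- by rewrite gmetricC T_N gNN mulr1.
- by move=> Z tZ; apply: (sqr_anticomm_tangent erefl).
- rewrite (trace_frame_sqr erefl PP Padj full_frame_tangent full_frame_on full_frame_dim tN trNN trP trQ).
  by rewrite !(rmorphM, rmorphD) /= !rmorph_nat; ring.
Qed.

Lemma trace_L : \sum_i g (L (E i)) (E i) = - c.
Proof.
rewrite (trace_full_frame (f := L) (r := 0)).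
- by rewrite gmetricC L_N gNN mulr1 sub0r.
- by move=> Z tZ; apply: (sandwich_tangent erefl).
- rewrite (trace_frame_sandwich erefl PP Padj full_frame_tangent full_frame_on full_frame_dim tN).
  by rewrite mulr0.
Qed.

End Cube.

Lemma rank1_L X Y : N *m N *m N = (2 : R)%:C *: N -> tangent X -> tangent Y ->
  g (L X) Y = 2 * g X N * g Y N - 2 * g X reeb * g Y reeb.
Proof.
move=> N3 tX tY; have N3' : N *m N *m N = 2 *: N by rewrite N3 rmorph_nat.
have LX : N *m X *m N = (\tr (X *m N) / 2) *: N - (\tr (X *m reeb) / 2) *: reeb.
  exact: (rank1_sandwich erefl PP Padj full_frame_tangent full_frame_on full_frame_dim tN trNN (ci2 R) (ci_conj R) N3' tX).
have Xh : X ^t* = X by case: tX.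
have Nh : N ^t* = N by case: tN.
have rh : reeb ^t* = reeb by case: (grass2_tangentN (gJ_tangent PP Padj tN)).
have e Z : Z ^t* = Z -> \tr (X *m Z) / 2 = (2 * g X Z)%:C.
  by move=> Zh; rewrite hermitian_trace // !rmorphM /= !rmorph_nat; field.
rewrite /= LX !e // gmetricBl !gmetricZl [g N Y]gmetricC [g reeb Y]gmetricC.
by [].
Qed.

Lemma rank1_T X Y : N *m N *m N = (2 : R)%:C *: N -> tangent X -> tangent Y ->
  g (T X) (T Y) = 2 * g (T X) Y + 2 * g (L X) (L Y).
Proof.
move=> N3 tX tY; rewrite -T_adj -L_adj.
have -> : T (T X) = (2 : R)%:C *: T X + (2 : R)%:C *: L (L X).
  rewrite /=; mxexpand; rewrite N3; mxexpand.
  have -> : X *m N *m N *m N *m N = (2 : R)%:C *: (X *m N *m N).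
    transitivity (X *m (N *m N *m N) *m N); first by rewrite !mulmxA.
    by rewrite N3 -scalemxAr -scalemxAl.
  by rewrite rmorph_nat; mxlin.
by rewrite gmetricDl !gmetricZl.
Qed.

Lemma rank2_T X Y : N *m N *m N = N -> tangent X -> tangent Y ->
  g (T X) Y = g X Y + g (L X) (L Y).
Proof.
move=> N3 tX tY; rewrite /= (rank2_sqr erefl PP Padj tN trNN trP N3 tX) gmetricDl -L_adj.
by rewrite /= !mulmxA.
Qed.

Lemma rank2_L X : N *m N *m N = N -> L (L (L X)) = L X.
Proof.
move=> N3; rewrite /=.
have -> : N *m (N *m (N *m X *m N) *m N) *m N = N *m N *m N *m X *m (N *m N *m N).
  by rewrite !mulmxA.
by rewrite N3.
Qed.

(** [r] anticommutes with [N], so [T r = 2 N ^ 2 r] and [L r = - N ^ 2 r]: the hypothesis concerns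
    [4 N ^ 2 r], whence [rho / 4]. It only controls components along the hypersurface; the component
    along [N] vanishes, again by anticommutation. *)
Lemma normal_cube r rho : r = reeb ->
  (forall j, g (T r) (E j) - 2 * g (L r) (E j) = rho * g r (E j)) ->
  N *m N *m N = (rho / 4)%:C *: N.
Proof.
move=> rE TL; have tr : tangent r by rewrite rE; apply/grass2_tangentN/gJ_tangent.
have rN0 : g r N = 0 by rewrite rE gmetricNl gmetric_J_self oppr0.
have Nr : N *m r = - (r *m N) by rewrite rE; apply: (reeb_anticomm erefl ci tN).
have rN : r *m N = - (N *m r) by rewrite Nr opprK.
have rNN : r *m N *m N = N *m N *m r by rewrite rN mulNmx -[N *m r *m N]mulmxA rN mulmxN opprK mulmxA.
have NrN : N *m r *m N = - (N *m N *m r) by rewrite -[N *m r *m N]mulmxA rN mulmxN mulmxA.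
have gNNrN : g (N *m N *m r) N = 0.
  have e1 : g (N *m N *m r) N = g r (N *m N *m N) by rewrite gmetric_cycle mulmxA.
  have e2 : g (N *m N *m r) N = - g r (N *m N *m N).
    by rewrite -[N *m N *m r]mulmxA gmetric_cycle Nr gmetricNl gmetricA mulmxA.
  by move: e2; rewrite e1; move: (g _ _) => x e2; lra.
have tNNr : tangent (N *m N *m r).
  have -> : N *m N *m r = (2^-1)%:C *: T r.
    rewrite /= rNN -mulr2n -scaler_nat scalerA fmorphV rmorph_nat mulVf ?scale1r //.
    by rewrite pnatr_eq0.
  by apply/grass2_tangentZ/(sqr_anticomm_tangent erefl).
have gNNrE j : 4 * g (N *m N *m r) (E j) = rho * g r (E j).
  by rewrite -TL /= rNN NrN gmetricDl gmetricNl; ring.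
have D0 : N *m N *m r = (rho / 4)%:C *: r.
  apply: subr0_eq; apply: tangent_eq0.
  - by apply: grass2_tangentD => //; apply/grass2_tangentN/grass2_tangentZ.
  - by rewrite gmetricBl gmetricZl rN0 gNNrN mulr0 subr0.
  - by move=> j; rewrite gmetricBl gmetricZl mulrAC -gNNrE; field.
by move: D0; rewrite rE; apply: (reeb_cube erefl PP tN (ci2 R)).
Qed.

Lemma pointwise_absurd (A : 'M[R]_d) (k al : R)
  (Phi := frame_mx g E J) (xi := frame_row g E reeb)
  (S := (4 * m%:R + 8)%:M - frame_mx g E T + 2 *: frame_mx g E L + \tr A *: A - A *m A) :
  (3 <= m)%N -> k != 0 -> A^T = A -> xi *m A = al *: xi ->
  (forall x y : 'rV[R]_d,
    (x *m A *m Phi *m (y *m S)^T) 0 0 *: xi - (y *m S *m xi^T) 0 0 *: (x *m A *m Phi)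
      - (k * (x *m xi^T) 0 0) *: (y *m S *m Phi) =
    (x *m A *m Phi *m y^T) 0 0 *: (xi *m S) - (y *m xi^T) 0 0 *: (x *m A *m Phi *m S)
      - (k * (x *m xi^T) 0 0) *: (y *m Phi *m S)) ->
  (forall x y : 'rV[R]_d, x *m xi^T = 0 -> y *m xi^T = 0 ->
    x *m (A *m Phi *m A - (al / 2) *: (A *m Phi + Phi *m A) - frame_mx g E T *m Phi) *m y^T = 0) ->
  False.
Proof.
move=> m3 k0 Asym xiA cond hopfE.
have gC := @gmetricC R n; have gNr := @gmetricNr R n.
have tN' := @grass2_tangentN R n P; have JT := gJ_tangent PP Padj.
have JN := @gJN R n P; have JJ := gJ_gJ PP; have gJ := @gmetric_J R n P.
have Tt X : tangent X -> tangent (T X) by apply: (sqr_anticomm_tangent erefl).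
have Lt X : tangent X -> tangent (L X) by apply: (sandwich_tangent erefl).
have [sigma [_ xiS _]] := frame_cond gC gNr tN' JT JN JJ gJ tN gNN tE gEE gEN tangent_parseval T_adj L_adj k0 Asym xiA cond.
(* By the definition of [S], [T - 2 L] is [4 m + 8 + \tr A * A - A ^ 2 - S], and [xi] is an
   eigenvector of [A] and of [S]. *)
pose rho := 4 * m%:R + 8 + \tr A * al - al ^+ 2 - sigma.
have xiTL : xi *m frame_mx g E T - 2 *: (xi *m frame_mx g E L) = rho *: xi.
  move: xiS; rewrite /S -/xi; mxexpand; rewrite xiA -scalemxAl xiA => e.
  by apply: (lincomb1 (c := -1) e); rewrite /rho; mxlin.
have N3 : N *m N *m N = (rho / 4)%:C *: N.
  have tr : tangent reeb by apply/tN'/JT.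
  have rN0 : g reeb N = 0 by rewrite gmetricNl gmetric_J_self oppr0.
  have rowT (f : 'M[R[i]]_n -> 'M[R[i]]_n) j : (forall X Y, g (f X) Y = g X (f Y)) ->
      (xi *m frame_mx g E f) 0 j = g (f reeb) (E j).
    move=> fadj; rewrite (frame_row_mul gC tE tangent_parseval (h' := f (E j)) tr) => [|Y _ //].
    by rewrite rN0 mul0r subr0 fadj.
  apply: (normal_cube erefl) => j; have /rowP/(_ j) := xiTL.
  have lin (u v : 'rV[R]_d) : (u - 2 *: v) 0 j = u 0 j - 2 * v 0 j by rewrite !mxE.
  have scl (u : 'rV[R]_d) : (rho *: u) 0 j = rho * u 0 j by rewrite mxE.
  have xij : xi 0 j = g reeb (E j) by rewrite mxE.
  by rewrite lin scl (rowT _ _ T_adj) (rowT _ _ L_adj) xij.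
move: (rho / 4) N3 => c N3.
have TN := T_N N3; have LN := L_N N3; have Tr := T_reeb N3; have Lr := L_reeb N3.
have trT : \tr (frame_mx g E T) = 4 * m%:R + 8 - 2 * c.
  by rewrite -(trace_T N3); apply: eq_bigr => i _; rewrite mxE.
have trL : \tr (frame_mx g E L) = - c.
  by rewrite -(trace_L N3); apply: eq_bigr => i _; rewrite mxE.
have c0 := cube_coef erefl PP tN trNN trP N3.
case: c0 => cE.
  have c2 : c = 2 by apply: complexI; rewrite cE rmorph_nat.
  rewrite c2 in N3.
  apply: (frame_contra_rank1 gC gNr tN' JT JN JJ gJ tN gNN tE gEE gEN tangent_parseval Tt Lt T_adj L_adj T_J TN LN Tr Lr m3 k0 Asym xiA cond hopfE trT c2).
    by move=> X Y tX tY; apply: rank1_L.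
  by move=> X Y tX tY; apply: rank1_T.
have c1 : c = 1 by apply: complexI; rewrite cE rmorph1.
have N31 : N *m N *m N = N by rewrite N3 cE scale1r.
apply: (frame_contra_rank2 gC gNr tN' JT JN JJ gJ tN gNN tE gEE gEN tangent_parseval Tt Lt T_adj L_adj T_J L_J TN LN Tr Lr m3 dE k0 Asym xiA cond hopfE trT trL c1).
  by move=> X Y tX tY; apply: rank2_T.
by move=> X _; apply: rank2_L.
Qed.

End PointFrame.

(** * Differential calculus *)

From mathcomp Require Import all_classical all_reals all_analysis.
Import numFieldNormedType.Exports.
Local Open Scope classical_set_scope.

Lemma near_eq_differentiable (R : numFieldType) (V W : normedModType R) (f g : V -> W) (x : V) :
  (\forall y \near x, f y = g y) -> differentiable f x -> differentiable g x.
Proof.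
move=> fg df; have fgx : f x = g x by apply: nbhs_singleton fg.
have E : g \o shift x = cst (g x) + 'd f x +o_ 0 id.
  apply/eqaddoP => e e0; have /diff_locally/eqaddoP/(_ e e0) := df.
  have : \forall h \near 0, f (h + x) = g (h + x).
    by have := fg; rewrite (near_shift 0 x); apply: filterS => h /=; rewrite /= subr0.
  apply: filterS2 => h fgh /=.
  by rewrite !fctE /= fgh fgx.
apply/diff_locallyP; rewrite (diff_unique (diff_continuous df) E); split => //.
exact: diff_continuous.
Qed.

Section Smooth.
Variables (R : realType) (d : nat) (U : set 'rV[R]_d).
Hypothesis Uo : open U.
Implicit Types f g : 'rV[R]_d -> R.

Lemma near_open u : U u -> \forall w \near u, U w.
Proof. by move=> Uu; apply: open_nbhs_nbhs; split. Qed.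

Lemma smooth_differentiable (V : normedModType R) (f : 'rV[R]_d -> V) u :
  smooth_on U f -> U u -> differentiable f u.
Proof. by move=> sf Uu; apply: (sf [::]). Qed.

(** [iter_deriv] applies the last direction of its list first, whence [rcons]. *)
Lemma smooth_derive (V : normedModType R) (f : 'rV[R]_d -> V) v :
  smooth_on U f -> smooth_on U (fun u => 'D_v f u).
Proof. by move=> sf s u Uu; have := sf (rcons s v) u Uu; rewrite /iter_deriv foldr_rcons. Qed.

(* A class of functions stable under directional derivatives up to equality on
   [U] consists of smooth functions. *)
Lemma smooth_coind (V : normedModType R) (K : ('rV[R]_d -> V) -> Prop) :
  (forall f : 'rV[R]_d -> V, K f -> forall u, U u -> differentiable f u) ->
  (forall (f : 'rV[R]_d -> V) v, K f ->
    exists2 g : 'rV[R]_d -> V, K g & forall u, U u -> 'D_v f u = g u) ->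
  forall f : 'rV[R]_d -> V, K f -> smooth_on U f.
Proof.
move=> Kd KD f Kf s.
have [g Kg fg] : exists2 g : 'rV[R]_d -> V, K g & forall u, U u -> iter_deriv s f u = g u.
  elim: s => [|v s [g Kg fg]]; first by exists f.
  have [g' Kg' gg'] := KD _ v Kg; exists g' => // u Uu.
  rewrite -gg' //=; apply: near_eq_derive; near=> w; apply: fg; near: w; exact: near_open.
move=> u Uu; apply: (near_eq_differentiable (f := g)); last exact: Kd.
by near=> w; apply/esym/fg; near: w; exact: near_open.
Unshelve. all: by end_near. Qed.

Lemma smooth_eq (V : normedModType R) (f g : 'rV[R]_d -> V) :
  (forall u, U u -> f u = g u) -> smooth_on U f -> smooth_on U g.
Proof.
move=> fg sf; apply: (@smooth_coind _ (fun h : 'rV[R]_d -> V => exists2 k : 'rV[R]_d -> V, smooth_on U k & forall u, U u -> k u = h u)).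
- move=> h [k sk kh] u Uu; apply: (near_eq_differentiable (f := k)); last exact: smooth_differentiable.
  by near=> w; apply: kh; near: w; exact: near_open.
- move=> h v [k sk kh]; exists (fun u => 'D_v k u).
    by exists (fun u => 'D_v k u) => //; apply: smooth_derive.
  move=> u Uu; apply: near_eq_derive; near=> w; apply/esym/kh; near: w; exact: near_open.
- by exists f.
Unshelve. all: by end_near. Qed.

Lemma smooth_cst (V : normedModType R) (c : V) : smooth_on U (fun=> c).
Proof.
apply: (@smooth_coind _ (fun h : 'rV[R]_d -> V => exists a : V, h = cst a)); last by exists c.
  by move=> f [a ->] u _; apply: differentiable_cst.
by move=> f v [a ->]; exists (cst 0) => [|u _]; [exists 0 | rewrite derive_cst].
Qed.

(** The products of two smooth functions are not closed under differentiation, but the algebra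
    generated by smooth functions is, by the Leibniz rule; [smooth_coind] is applied to that
    algebra. *)
Inductive smooth_alg : ('rV[R]_d -> R) -> Prop :=
| Smooth_base f of smooth_on U f : smooth_alg f
| Smooth_add f g of smooth_alg f & smooth_alg g : smooth_alg (f + g)
| Smooth_mul f g of smooth_alg f & smooth_alg g : smooth_alg (f * g).

Lemma smooth_algP f : smooth_alg f -> smooth_on U f.
Proof.
have Kd g : smooth_alg g -> forall u, U u -> differentiable g u.
  elim=> [{}g sg u Uu|{}g h _ IHg _ IHh u Uu|{}g h _ IHg _ IHh u Uu].
  - exact: smooth_differentiable.
  - by apply: differentiableD; [exact: IHg|exact: IHh].
  - by apply: differentiableM; [exact: IHg|exact: IHh].
apply: smooth_coind => // g v; elim=> [{}g sg|{}g h Kg [g' Kg' gg'] Kh [h' Kh' hh']|{}g h Kg [g' Kg' gg'] Kh [h' Kh' hh']].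
- by exists (fun u => 'D_v g u) => //; apply/Smooth_base/smooth_derive.
- exists (g' + h') => [|u Uu]; first exact: Smooth_add.
  rewrite deriveD; last 2 first.
  - exact/diff_derivable/Kd.
  - exact/diff_derivable/Kd.
  by rewrite gg' // hh'.
- exists (g * h' + h * g') => [|u Uu]; first by apply: Smooth_add; apply: Smooth_mul.
  rewrite deriveM; last 2 first.
  - exact/diff_derivable/Kd.
  - exact/diff_derivable/Kd.
  by rewrite gg' // hh'.
Qed.

Lemma smoothD f g : smooth_on U f -> smooth_on U g -> smooth_on U (fun u => f u + g u).
Proof. by move=> sf sg; apply: smooth_algP; apply: Smooth_add; apply: Smooth_base. Qed.

Lemma smoothM f g : smooth_on U f -> smooth_on U g -> smooth_on U (fun u => f u * g u).
Proof. by move=> sf sg; apply: smooth_algP; apply: Smooth_mul; apply: Smooth_base. Qed.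

Lemma smoothZ (c : R) f : smooth_on U f -> smooth_on U (fun u => c * f u).
Proof. by apply: smoothM; apply: smooth_cst. Qed.

Lemma smoothN f : smooth_on U f -> smooth_on U (fun u => - f u).
Proof.
by move=> sf; apply: (smooth_eq (f := fun u => (-1) * f u)) => [u _|]; [rewrite mulN1r|exact: smoothZ].
Qed.

Lemma smoothB f g : smooth_on U f -> smooth_on U g -> smooth_on U (fun u => f u - g u).
Proof. by move=> sf sg; apply: smoothD => //; apply: smoothN. Qed.

Lemma smooth_sum (I : finType) (F : I -> 'rV[R]_d -> R) :
  (forall i, smooth_on U (F i)) -> smooth_on U (fun u => \sum_i F i u).
Proof.
move=> sF; have : smooth_alg (\sum_i F i).
  elim/big_rec: _ => [|i f _ Kf]; first exact/Smooth_base/smooth_cst.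
  by apply: Smooth_add => //; apply: Smooth_base.
by move/smooth_algP; apply: smooth_eq => u _; rewrite fct_sumE.
Qed.

End Smooth.

(** * Symmetry of second derivatives *)

Section Schwarz.
Variables (R : realType) (d : nat).
Implicit Types (f g : 'rV[R]_d -> R) (p u v w : 'rV[R]_d).

Lemma is_derive_line g p v (s : R) : derivable g (s *: v + p) v ->
  is_derive s 1 (fun r : R => g (r *: v + p)) ('D_v g (s *: v + p)).
Proof.
have e : (fun h : R => h^-1 *: (((fun r : R => g (r *: v + p)) \o shift s) (h *: 1) - g (s *: v + p))) =
         (fun h : R => h^-1 *: ((g \o shift (s *: v + p)) (h *: v) - g (s *: v + p))).
  by rewrite funeqE => h /=; rewrite [h *: 1]mulr1 scalerDl addrA.
move=> dg; apply: DeriveDef; first by rewrite /derivable e.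
by rewrite /derive e.
Qed.

Lemma mvt_line g p v (t : R) : 0 < t ->
  (forall s, 0 <= s <= t -> differentiable g (s *: v + p)) ->
  exists2 s, 0 < s < t & g (t *: v + p) - g p = t * 'D_v g (s *: v + p).
Proof.
move=> t0 dg.
have dl s : s \in `]0, t[%R -> is_derive s 1 (fun r : R => g (r *: v + p)) ('D_v g (s *: v + p)).
  rewrite in_itv /= => /andP[s0 st]; apply/is_derive_line/diff_derivable/dg.
  by rewrite !ltW.
have [|s] := MVT t0 dl.
  apply: continuous_in_subspaceT => s; rewrite inE /= in_itv /= => sI.
  have /derivable1_diffP/differentiable_continuous // : derivable (fun r : R => g (r *: v + p)) s 1.
  by have [] := is_derive_line (@diff_derivable _ _ _ g _ v (dg s sI)).
rewrite in_itv /= => sI; rewrite scale0r add0r subr0 => e; exists s => //.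
by rewrite e mulrC.
Qed.

Variable U : set 'rV[R]_d.
Hypothesis Uo : open U.

(** The mean value theorem twice: along [v] for the increment [g y = f (t w + y) - f y], then along
    [w] for ['D_v f]. *)
Lemma mixed_difference f u v w (t : R) : smooth_on U f -> 0 < t ->
  (forall s r, 0 <= s <= t -> 0 <= r <= t -> U (s *: v + (r *: w + u))) ->
  exists s r, [/\ 0 < s < t, 0 < r < t &
    f (t *: v + (t *: w + u)) - f (t *: v + u) - (f (t *: w + u) - f u) =
    t ^+ 2 * 'D_w (fun y => 'D_v f y) (s *: v + (r *: w + u))].
Proof.
move=> sf t0 box; pose g (y : 'rV[R]_d) : R := f (t *: w + y) - f y.
have t01 : 0 <= t <= t by rewrite lexx ltW.
have z01 : (0 : R) <= 0 <= t by rewrite lexx ltW.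
have sh : (fun z : 'rV[R]_d => f (t *: w + z)) = f \o (fun z => z + t *: w).
  by rewrite funeqE => z /=; rewrite addrC.
have dsh (y : 'rV[R]_d) : differentiable f (t *: w + y) -> differentiable (fun z : 'rV[R]_d => f (t *: w + z)) y.
  move=> df; rewrite sh; apply: differentiable_comp; last by rewrite addrC.
  by apply: differentiableD => //; apply: differentiable_cst.
have Dsh (y : 'rV[R]_d) : 'D_v (fun z : 'rV[R]_d => f (t *: w + z)) y = 'D_v f (t *: w + y).
  have e : (fun h : R => h^-1 *: (((fun z : 'rV[R]_d => f (t *: w + z)) \o shift y) (h *: v) - f (t *: w + y))) =
      (fun h : R => h^-1 *: ((f \o shift (t *: w + y)) (h *: v) - f (t *: w + y))).
    by rewrite funeqE => h /=; rewrite addrCA.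
  by rewrite /derive e.
have pts s : 0 <= s <= t -> U (t *: w + (s *: v + u)) /\ U (s *: v + u).
  move=> sI; split; first by rewrite addrCA; apply: box.
  by have := box s 0 sI z01; rewrite scale0r add0r.
have dg s : 0 <= s <= t -> differentiable g (s *: v + u).
  move=> /pts[U1 U2]; apply: differentiableB.
    by apply: dsh; apply: (smooth_differentiable sf).
  exact: (smooth_differentiable sf).
have [s sI eg] := mvt_line t0 dg.
have sI' : 0 <= s <= t by case/andP: sI => ? ?; rewrite !ltW.
have sDf := smooth_derive v sf.
have [|r rI eh] := @mvt_line (fun y => 'D_v f y) (s *: v + u) w t t0.
  by move=> r rI; apply: (smooth_differentiable sDf); rewrite addrCA; apply: box.
exists s, r; split; [exact: sI|exact: rI|].
have -> : f (t *: v + (t *: w + u)) - f (t *: v + u) - (f (t *: w + u) - f u) =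
    g (t *: v + u) - g u by rewrite /g addrCA.
rewrite eg expr2 -mulrA; congr (_ * _).
have [U1 U2] := pts s sI'.
rewrite -[s *: v + (r *: w + u)]addrCA -eh /g deriveB ?Dsh //.
  by apply/diff_derivable/dsh/(smooth_differentiable sf).
exact/diff_derivable/(smooth_differentiable sf).
Qed.

(** The second difference is symmetric in [v] and [w], so arbitrarily close to [u] a value of one
    mixed derivative equals a value of the other; both are continuous at [u]. *)
Lemma schwarz f u v w : smooth_on U f -> U u ->
  'D_v (fun y => 'D_w f y) u = 'D_w (fun y => 'D_v f y) u.
Proof.
move=> sf Uu; pose Y (y : 'rV[R]_d) : R := 'D_w (fun z => 'D_v f z) y.
have sX : smooth_on U (fun y => 'D_v (fun z => 'D_w f z) y) by do 2 apply: smooth_derive.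
have sY : smooth_on U Y by do 2 apply: smooth_derive.
pose X' (y : 'rV[R]_d) : R := 'D_v (fun z => 'D_w f z) y.
have cX : {for u, continuous X'} by apply/differentiable_continuous/(smooth_differentiable sX).
have cY : {for u, continuous Y} by apply/differentiable_continuous/(smooth_differentiable sY).
apply/eqP; rewrite -subr_eq0 -normr_le0; apply/ler_addgt0Pr => e e0; rewrite add0r.
have e2 : 0 < e / 2 by rewrite divr_gt0.
have nX : \forall y \near u, `|X' u - X' y| <= e / 2 by move/cvgrPdist_le: cX => /(_ _ e2).
have nY : \forall y \near u, `|Y u - Y y| <= e / 2 by move/cvgrPdist_le: cY => /(_ _ e2).
have nU : \forall y \near u, U y by exact: (near_open Uo Uu).
have : \forall y \near u, [/\ U y, `|X' u - X' y| <= e / 2 & `|Y u - Y y| <= e / 2].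
  by move: nU nX nY; apply: filterS3 => y hU hX hY; split.
move=> /nbhs_ballP[r /= r0 ball_r].
(* The [1] keeps [M] positive even for [v = w = 0], and [t M = r / 2] puts the whole box inside the
   ball. *)
pose M := `|v| + `|w| + 1.
have M0 : 0 < M by rewrite ltr_wpDl // addr_ge0.
pose t := r / 2 / M.
have t0 : 0 < t by rewrite !divr_gt0.
have box a b : 0 <= a <= t -> 0 <= b <= t -> ball u r (a *: v + (b *: w + u)).
  move=> /andP[a0 at_] /andP[b0 bt]; rewrite -ball_normE /= addrA opprD addrCA subrr addr0 normrN.
  apply: (le_lt_trans (ler_normD _ _)); rewrite !normrZ !ger0_norm //.
  apply: (@le_lt_trans _ _ (t * `|v| + t * `|w|)); first by rewrite lerD // ler_wpM2r.
  rewrite -mulrDr; apply: (@lt_trans _ _ (t * M)); first by rewrite ltr_pM2l // ltrDl.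
  by rewrite /t divfK ?gt_eqF // ltr_pdivrMr // mulr_natr mulr2n ltrDl.
have [s1 [r1 [s1I r1I e1]]] := @mixed_difference f u v w t sf t0
  (fun a b aI bI => let: And3 h _ _ := ball_r _ (box a b aI bI) in h).
have box' a b : 0 <= a <= t -> 0 <= b <= t -> ball u r (a *: w + (b *: v + u)).
  by move=> aI bI; rewrite addrCA; apply: box.
have [s3 [r3 [s3I r3I e3]]] := @mixed_difference f u w v t sf t0
  (fun a b aI bI => let: And3 h _ _ := ball_r _ (box' a b aI bI) in h).
have lew (x : R) : 0 < x < t -> 0 <= x <= t by case/andP => ? ?; rewrite !ltW.
have [_ _ y1] := ball_r _ (box _ _ (lew _ s1I) (lew _ r1I)).
have [_ x3 _] := ball_r _ (box' _ _ (lew _ s3I) (lew _ r3I)).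
have XY : X' (s3 *: w + (r3 *: v + u)) = Y (s1 *: v + (r1 *: w + u)).
  have t2 : t ^+ 2 != 0 by rewrite expf_neq0 // gt_eqF.
  apply: (mulfI t2); apply: (etrans (esym e3)); apply: (etrans _ e1).
  rewrite [t *: w + (t *: v + u)]addrCA.
  by move: (f (t *: v + (t *: w + u))) (f (t *: w + u)) (f (t *: v + u)) (f u) => a b c z; ring.
rewrite -/(X' u) -/(Y u).
have -> : X' u - Y u = (X' u - X' (s3 *: w + (r3 *: v + u))) - (Y u - Y (s1 *: v + (r1 *: w + u))).
  by rewrite XY opprB addrA subrK.
apply: (le_trans (ler_normB (X' u - X' (s3 *: w + (r3 *: v + u))) (Y u - Y (s1 *: v + (r1 *: w + u))))).
by rewrite [X in _ <= X]splitr; exact: (lerD x3 y1).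
Qed.

End Schwarz.

Section Directional.
Variables (R : realType) (d : nat).
Implicit Types (u v w x y : 'rV[R]_d).

Lemma derive_dirD (f : 'rV[R]_d -> R) u x y : differentiable f u ->
  'D_(x + y) f u = 'D_x f u + 'D_y f u.
Proof. by move=> df; rewrite !deriveE // linearD. Qed.

Lemma derive_dirZ (f : 'rV[R]_d -> R) u (a : R) x : differentiable f u ->
  'D_(a *: x) f u = a * 'D_x f u.
Proof. by move=> df; rewrite !deriveE // linearZ. Qed.

Lemma differentiable_row (Y : 'rV[R]_d -> 'rV[R]_d) u :
  (forall j, differentiable (fun w => Y w 0 j) u) -> differentiable Y u.
Proof.
move=> dY; have -> : Y = \sum_j (fun w => Y w 0 j *: delta_mx 0 j).
  by rewrite funeqE => w; rewrite fct_sumE -row_sum_delta.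
by apply: differentiable_sum => j; apply: differentiableZl.
Qed.

Lemma differentiable_row_coord (Y : 'rV[R]_d -> 'rV[R]_d) u j :
  differentiable Y u -> differentiable (fun w => Y w 0 j) u.
Proof.
move=> dY; apply: (@differentiable_comp _ _ _ _ Y (fun z : 'rV[R]_d => z 0 j)) => //.
exact: differentiable_coord.
Qed.

Lemma derive_row (Y : 'rV[R]_d -> 'rV[R]_d) u v j : differentiable Y u ->
  ('D_v Y u) 0 j = 'D_v (fun w => Y w 0 j) u.
Proof. by move=> dY; rewrite derive_mx ?mxE //; apply: diff_derivable. Qed.

Variable U : set 'rV[R]_d.
Hypothesis Uo : open U.

Lemma smooth_row (Y : 'rV[R]_d -> 'rV[R]_d) :
  (forall j, smooth_on U (fun w => Y w 0 j)) -> smooth_on U Y.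
Proof.
move=> sY; apply: (@smooth_coind _ _ _ Uo _
  (fun Z : 'rV[R]_d -> 'rV[R]_d => forall j, smooth_on U (fun w => Z w 0 j))) sY.
- by move=> Z sZ u Uu; apply: differentiable_row => j; apply: (smooth_differentiable (sZ j)).
- move=> Z v sZ; exists (fun u => 'D_v Z u) => // j.
  apply: (smooth_eq Uo (f := fun u => 'D_v (fun w => Z w 0 j) u)).
    move=> u Uu; rewrite derive_row //.
    by apply: differentiable_row => k; apply: (smooth_differentiable (sZ k)).
  exact: smooth_derive.
Qed.

Lemma smooth_row_coord (Y : 'rV[R]_d -> 'rV[R]_d) j :
  smooth_on U Y -> smooth_on U (fun w => Y w 0 j).
Proof.
move=> sY; apply: (@smooth_coind _ _ _ Uo _ (fun f : 'rV[R]_d -> R =>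
  exists2 Z : 'rV[R]_d -> 'rV[R]_d, smooth_on U Z & f = fun w => Z w 0 j)); last by exists Y.
- move=> f [Z sZ ->] u Uu; apply: differentiable_row_coord.
  exact: (smooth_differentiable sZ).
- move=> f v [Z sZ ->]; exists (fun w => ('D_v Z w) 0 j).
    by exists (fun w => 'D_v Z w) => //; apply: smooth_derive.
  by move=> u Uu; rewrite derive_row //; apply: (smooth_differentiable sZ).
Qed.

End Directional.

(** * Calculus of maps into complex numbers and complex matrices *)

Section ComplexCalculus.
Variables (R : realType) (d : nat).
Local Notation Re := (@complex.Re R).
Local Notation Im := (@complex.Im R).
Implicit Types (z t : 'rV[R]_d -> R[i]) (u v x : 'rV[R]_d).

Definition cdiff z u := differentiable (fun w => Re (z w)) u /\ differentiable (fun w => Im (z w)) u.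
Definition cderive z u v : R[i] :=
  Complex ('D_v (fun w => Re (z w)) u) ('D_v (fun w => Im (z w)) u).

Lemma Re_mul (a b : R[i]) : Re (a * b) = Re a * Re b - Im a * Im b.
Proof. by case: a; case: b. Qed.
Lemma Im_mul (a b : R[i]) : Im (a * b) = Re a * Im b + Im a * Re b.
Proof. by case: a => ? ?; case: b. Qed.

Lemma complex_eq (a b : R[i]) : Re a = Re b -> Im a = Im b -> a = b.
Proof. by case: a => ? ?; case: b => ? ? /= -> ->. Qed.

Lemma cdiffD z t u : cdiff z u -> cdiff t u -> cdiff (fun w => z w + t w) u.
Proof.
move=> [z1 z2] [t1 t2]; split.
  have -> : (fun w => Re (z w + t w)) = (fun w => Re (z w)) + (fun w => Re (t w)).
    by rewrite funeqE => w; rewrite Re_add.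
  exact: differentiableD.
have -> : (fun w => Im (z w + t w)) = (fun w => Im (z w)) + (fun w => Im (t w)).
  by rewrite funeqE => w; rewrite Im_add.
exact: differentiableD.
Qed.

Lemma cderiveD z t u v : cdiff z u -> cdiff t u ->
  cderive (fun w => z w + t w) u v = cderive z u v + cderive t u v.
Proof.
move=> [z1 z2] [t1 t2]; apply: complex_eq; rewrite /=.
  have -> : (fun w => Re (z w + t w)) = (fun w => Re (z w)) + (fun w => Re (t w)).
    by rewrite funeqE => w; rewrite Re_add.
  by rewrite deriveD //; apply: diff_derivable.
have -> : (fun w => Im (z w + t w)) = (fun w => Im (z w)) + (fun w => Im (t w)).
  by rewrite funeqE => w; rewrite Im_add.
by rewrite deriveD //; apply: diff_derivable.
Qed.

Let ReM z t : (fun w => Re (z w * t w)) =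
  (fun w => Re (z w)) * (fun w => Re (t w)) - (fun w => Im (z w)) * (fun w => Im (t w)).
Proof. by rewrite funeqE => w; rewrite Re_mul. Qed.
Let ImM z t : (fun w => Im (z w * t w)) =
  (fun w => Re (z w)) * (fun w => Im (t w)) + (fun w => Im (z w)) * (fun w => Re (t w)).
Proof. by rewrite funeqE => w; rewrite Im_mul. Qed.

Lemma cdiffM z t u : cdiff z u -> cdiff t u -> cdiff (fun w => z w * t w) u.
Proof.
move=> [z1 z2] [t1 t2]; split; rewrite ?ReM ?ImM.
  by apply: differentiableB; apply: differentiableM.
by apply: differentiableD; apply: differentiableM.
Qed.

Lemma cderiveM z t u v : cdiff z u -> cdiff t u ->
  cderive (fun w => z w * t w) u v = cderive z u v * t u + z u * cderive t u v.
Proof.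
move=> [z1 z2] [t1 t2].
have dv (f : 'rV[R]_d -> R) : differentiable f u -> derivable f u v by apply: diff_derivable.
apply: complex_eq; rewrite /cderive /= ?ReM ?ImM.
  rewrite deriveB; [|by apply: derivableM; apply: dv|by apply: derivableM; apply: dv].
  rewrite !deriveM; try exact: dv.
  rewrite /GRing.scale /=.
  move: ('D_v (fun w => Re (z w)) u) ('D_v (fun w => Im (z w)) u) ('D_v (fun w => Re (t w)) u)
    ('D_v (fun w => Im (t w)) u) (z u) (t u) => a b a' b' zu tu.
  by rewrite Re_add !Re_mul /=; move: (Re zu) (Im zu) (Re tu) (Im tu) => *; ring.
rewrite deriveD; [|by apply: derivableM; apply: dv|by apply: derivableM; apply: dv].
rewrite !deriveM; try exact: dv.
  rewrite /GRing.scale /=.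
  move: ('D_v (fun w => Re (z w)) u) ('D_v (fun w => Im (z w)) u) ('D_v (fun w => Re (t w)) u)
    ('D_v (fun w => Im (t w)) u) (z u) (t u) => a b a' b' zu tu.
by rewrite Im_add !Im_mul /=; move: (Re zu) (Im zu) (Re tu) (Im tu) => *; ring.
Qed.

Lemma cdiff_cst c u : cdiff (fun=> c) u.
Proof. by split; apply: differentiable_cst. Qed.

Lemma cderive_cst c u v : cderive (fun=> c) u v = 0.
Proof. by apply: complex_eq; rewrite /= derive_cst. Qed.

Lemma cdiff_sum (I : finType) (F : I -> 'rV[R]_d -> R[i]) u :
  (forall i, cdiff (F i) u) -> cdiff (fun w => \sum_i F i w) u.
Proof.
move=> dF; have : cdiff (\sum_i F i) u.
  elim/big_rec: _ => [|i f _ df]; first exact: cdiff_cst.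
  exact: cdiffD.
by congr (cdiff _ _); rewrite funeqE => w; rewrite fct_sumE.
Qed.

Lemma cderive_sum (I : finType) (F : I -> 'rV[R]_d -> R[i]) u v :
  (forall i, cdiff (F i) u) ->
  cderive (fun w => \sum_i F i w) u v = \sum_i cderive (F i) u v.
Proof.
move=> dF; have [_ <-] : cdiff (\sum_i F i) u /\ cderive (\sum_i F i) u v = \sum_i cderive (F i) u v.
  elim/big_rec2: _ => [|i f g _ [dg <-]]; first by split; [exact: cdiff_cst|exact: cderive_cst].
  by split; [exact: cdiffD|exact: cderiveD].
by congr (cderive _ _ _); rewrite funeqE => w; rewrite fct_sumE.
Qed.

Lemma cdiff_real (f : 'rV[R]_d -> R) u : differentiable f u -> cdiff (fun w => real_complex R (f w)) u.
Proof. by move=> df; split => //=; apply: differentiable_cst. Qed.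

Lemma cderive_real (f : 'rV[R]_d -> R) u v :
  cderive (fun w => real_complex R (f w)) u v = real_complex R ('D_v f u).
Proof. by apply: complex_eq; rewrite //= derive_cst. Qed.

Lemma cderive_near_eq z t u v : (\forall w \near u, z w = t w) -> cderive z u v = cderive t u v.
Proof.
move=> e; apply: complex_eq; rewrite /=; apply: near_eq_derive; apply: filterS e => w ->; by [].
Qed.

Variable U : set 'rV[R]_d.
Hypothesis Uo : open U.

Definition csmooth z := smooth_on U (fun w => Re (z w)) /\ smooth_on U (fun w => Im (z w)).

Lemma csmooth_cdiff z u : csmooth z -> U u -> cdiff z u.
Proof. by move=> [s1 s2] Uu; split; [apply: (smooth_differentiable s1)|apply: (smooth_differentiable s2)]. Qed.

Lemma csmooth_cderive z v : csmooth z -> csmooth (fun u => cderive z u v).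
Proof. by move=> [s1 s2]; split; apply: smooth_derive. Qed.

Lemma csmooth_eq z t : (forall u, U u -> z u = t u) -> csmooth z -> csmooth t.
Proof.
by move=> e [s1 s2]; split; [apply: (smooth_eq Uo) s1|apply: (smooth_eq Uo) s2] => u Uu; rewrite e.
Qed.

Lemma csmoothD z t : csmooth z -> csmooth t -> csmooth (fun w => z w + t w).
Proof.
move=> [z1 z2] [t1 t2]; split.
  by apply: (smooth_eq Uo (f := fun w => Re (z w) + Re (t w))) => [u _|]; [rewrite Re_add|exact: smoothD].
by apply: (smooth_eq Uo (f := fun w => Im (z w) + Im (t w))) => [u _|]; [rewrite Im_add|exact: smoothD].
Qed.

Lemma csmoothM z t : csmooth z -> csmooth t -> csmooth (fun w => z w * t w).
Proof.
move=> [z1 z2] [t1 t2]; split.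
  apply: (smooth_eq Uo (f := fun w => Re (z w) * Re (t w) - Im (z w) * Im (t w))) => [u _|].
    by rewrite Re_mul.
  by apply: smoothB => //; apply: smoothM.
apply: (smooth_eq Uo (f := fun w => Re (z w) * Im (t w) + Im (z w) * Re (t w))) => [u _|].
  by rewrite Im_mul.
by apply: smoothD => //; apply: smoothM.
Qed.

Lemma csmooth_cst c : csmooth (fun=> c).
Proof. by split; apply: smooth_cst. Qed.

Lemma csmooth_sum (I : finType) (F : I -> 'rV[R]_d -> R[i]) :
  (forall i, csmooth (F i)) -> csmooth (fun w => \sum_i F i w).
Proof.
move=> sF; have : csmooth (\sum_i F i).
  elim/big_rec: _ => [|i f _ sf]; first exact: csmooth_cst.
  exact: csmoothD.
by apply: csmooth_eq => w _; rewrite fct_sumE.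
Qed.

Lemma csmooth_real (f : 'rV[R]_d -> R) : smooth_on U f -> csmooth (fun w => real_complex R (f w)).
Proof. by move=> sf; split => //; apply: smooth_cst. Qed.

End ComplexCalculus.

Section MatrixCalculus.
Variables (R : realType) (d n : nat).
Local Notation "r %:C" := (real_complex R r).
Implicit Types (F G : 'rV[R]_d -> 'M[R[i]]_n) (u v x y : 'rV[R]_d) (f : 'rV[R]_d -> R).

Lemma dmxE F u v a b : dmx F u v a b = cderive (fun w => F w a b) u v.
Proof. by rewrite mxE. Qed.

Definition mxdiff F u := forall a b, cdiff (fun w => F w a b) u.

Lemma dmx_near_eq F G u v : (\forall w \near u, F w = G w) -> dmx F u v = dmx G u v.
Proof.
move=> e; apply/matrixP => a b; rewrite !dmxE; apply: cderive_near_eq.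
by apply: filterS e => w ->.
Qed.

Let entryD F G a b : (fun w => (F w + G w) a b) = (fun w => F w a b + G w a b).
Proof. by rewrite funeqE => w; rewrite mxE. Qed.

Lemma mxdiffD F G u : mxdiff F u -> mxdiff G u -> mxdiff (fun w => F w + G w) u.
Proof. by move=> dF dG a b; rewrite entryD; apply: cdiffD; [exact: dF|exact: dG]. Qed.

Lemma dmxD F G u v : mxdiff F u -> mxdiff G u ->
  dmx (fun w => F w + G w) u v = dmx F u v + dmx G u v.
Proof.
move=> dF dG; apply/matrixP => a b; rewrite dmxE entryD cderiveD; [|exact: dF|exact: dG].
by rewrite mxE -!dmxE.
Qed.

Let entryM F G a b : (fun w => (F w *m G w) a b) = (fun w => \sum_c F w a c * G w c b).
Proof. by rewrite funeqE => w; rewrite mxE. Qed.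

Lemma mxdiffM F G u : mxdiff F u -> mxdiff G u -> mxdiff (fun w => F w *m G w) u.
Proof.
move=> dF dG a b; rewrite entryM; apply: cdiff_sum => c.
by apply: cdiffM; [exact: dF|exact: dG].
Qed.

Lemma dmxM F G u v : mxdiff F u -> mxdiff G u ->
  dmx (fun w => F w *m G w) u v = dmx F u v *m G u + F u *m dmx G u v.
Proof.
move=> dF dG; apply/matrixP => a b; rewrite dmxE entryM cderive_sum; last first.
  by move=> c; apply: cdiffM; [exact: dF|exact: dG].
rewrite !mxE -big_split; apply: eq_bigr => c _.
by rewrite cderiveM; [rewrite !dmxE|exact: dF|exact: dG].
Qed.

Let entryZ (z : 'rV[R]_d -> R[i]) F a b : (fun w => (z w *: F w) a b) = (fun w => z w * F w a b).
Proof. by rewrite funeqE => w; rewrite mxE. Qed.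

Lemma mxdiffZ (z : 'rV[R]_d -> R[i]) F u : cdiff z u -> mxdiff F u -> mxdiff (fun w => z w *: F w) u.
Proof. by move=> dz dF a b; rewrite entryZ; apply: cdiffM; [exact: dz|exact: dF]. Qed.

Lemma dmxZ (z : 'rV[R]_d -> R[i]) F u v : cdiff z u -> mxdiff F u ->
  dmx (fun w => z w *: F w) u v = cderive z u v *: F u + z u *: dmx F u v.
Proof.
move=> dz dF; apply/matrixP => a b; rewrite dmxE entryZ cderiveM; [|exact: dz|exact: dF].
by rewrite !mxE.
Qed.

Lemma dmxZc (c : R[i]) F u v : mxdiff F u -> dmx (fun w => c *: F w) u v = c *: dmx F u v.
Proof.
by move=> dF; rewrite (dmxZ (z := fun=> c)) // ?cderive_cst ?scale0r ?add0r //; apply: cdiff_cst.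
Qed.

Lemma dmxZr f F u v : differentiable f u -> mxdiff F u ->
  dmx (fun w => (f w)%:C *: F w) u v = ('D_v f u)%:C *: F u + (f u)%:C *: dmx F u v.
Proof.
move=> df dF; rewrite (dmxZ (z := fun w => (f w)%:C)) ?cderive_real //.
exact: cdiff_real.
Qed.

Let oppE F : (fun w => - F w) = (fun w => -1 *: F w).
Proof. by rewrite funeqE => w; rewrite scaleN1r. Qed.

Lemma mxdiffN F u : mxdiff F u -> mxdiff (fun w => - F w) u.
Proof. by move=> dF; rewrite oppE; apply: mxdiffZ => //; apply: cdiff_cst. Qed.

Lemma dmxN F u v : mxdiff F u -> dmx (fun w => - F w) u v = - dmx F u v.
Proof. by move=> dF; rewrite oppE dmxZc // scaleN1r. Qed.

Lemma mxdiffB F G u : mxdiff F u -> mxdiff G u -> mxdiff (fun w => F w - G w) u.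
Proof. by move=> dF dG; apply: mxdiffD => //; apply: mxdiffN. Qed.

Lemma dmxB F G u v : mxdiff F u -> mxdiff G u ->
  dmx (fun w => F w - G w) u v = dmx F u v - dmx G u v.
Proof. by move=> dF dG; rewrite dmxD ?dmxN //; apply: mxdiffN. Qed.

Let entry_sum (I : finType) (H : I -> 'rV[R]_d -> 'M[R[i]]_n) a b :
  (fun w => (\sum_i H i w) a b) = (fun w => \sum_i H i w a b).
Proof. by rewrite funeqE => w; rewrite summxE. Qed.

Lemma dmx_sum (I : finType) (H : I -> 'rV[R]_d -> 'M[R[i]]_n) u v :
  (forall i, mxdiff (H i) u) ->
  dmx (fun w => \sum_i H i w) u v = \sum_i dmx (H i) u v.
Proof.
move=> dH; apply/matrixP => a b; rewrite dmxE entry_sum cderive_sum; last by move=> i; exact: dH.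
by rewrite summxE; apply: eq_bigr => i _; rewrite dmxE.
Qed.

Lemma dmx_hermitian F u v : (\forall w \near u, (F w) ^t* = F w) -> mxdiff F u ->
  (dmx F u v) ^t* = dmx F u v.
Proof.
move=> herm dF; apply/matrixP => a b.
have adjE (A : 'M[R[i]]_n) a' b' : (A ^t*) a' b' = Complex (complex.Re (A b' a')) (- complex.Im (A b' a')).
  by rewrite mxE mxE; case: (A b' a').
rewrite adjE !dmxE; apply: complex_eq; rewrite /=.
  by apply: near_eq_derive; apply: filterS herm => w e; rewrite -[in RHS]e adjE.
rewrite -deriveN; last by apply: diff_derivable; case: (dF b a).
by apply: near_eq_derive; apply: filterS herm => w e; rewrite -[in RHS]e adjE.
Qed.

Lemma dmx_dirD F u x y : mxdiff F u -> dmx F u (x + y) = dmx F u x + dmx F u y.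
Proof.
move=> dF; apply/matrixP => a b; case: (dF a b) => dR dI.
have e (A B : 'M[R[i]]_n) : (A + B) a b = A a b + B a b by rewrite mxE.
by rewrite e !dmxE; apply: complex_eq; rewrite /= derive_dirD.
Qed.

Lemma dmx_dirZ F u (r : R) x : mxdiff F u -> dmx F u (r *: x) = r%:C *: dmx F u x.
Proof.
move=> dF; apply/matrixP => a b; case: (dF a b) => dR dI.
have e (A : 'M[R[i]]_n) : (r%:C *: A) a b = r%:C * A a b by rewrite mxE.
rewrite e !dmxE; apply: complex_eq; rewrite /= derive_dirZ //.
  by rewrite mul0r subr0.
by rewrite mul0r addr0.
Qed.

Lemma dmx_dir0 F u : mxdiff F u -> dmx F u 0 = 0.
Proof. by move=> dF; rewrite -(scale0r 0) dmx_dirZ // scale0r. Qed.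

Lemma dmx_dirN F u x : mxdiff F u -> dmx F u (- x) = - dmx F u x.
Proof. by move=> dF; rewrite -scaleN1r dmx_dirZ // rmorphN1 scaleN1r. Qed.

Lemma dmx_dirB F u x y : mxdiff F u -> dmx F u (x - y) = dmx F u x - dmx F u y.
Proof. by move=> dF; rewrite dmx_dirD // dmx_dirN. Qed.

Lemma dmx_dir_sum F u (I : finType) (x : I -> 'rV[R]_d) : mxdiff F u ->
  dmx F u (\sum_i x i) = \sum_i dmx F u (x i).
Proof.
by move=> dF; apply: (big_morph _ (fun a b => dmx_dirD a b dF) (dmx_dir0 dF)).
Qed.

Lemma dmx_dirE F u x : mxdiff F u ->
  dmx F u x = \sum_i (x 0 i)%:C *: dmx F u (delta_mx 0 i).
Proof.
move=> dF; rewrite {1}(row_sum_delta x) dmx_dir_sum //.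
by apply: eq_bigr => i _; rewrite dmx_dirZ.
Qed.

Lemma derive_gmetric F G u x : mxdiff F u -> mxdiff G u ->
  'D_x (fun w => gmetric (F w) (G w)) u = gmetric (dmx F u x) (G u) + gmetric (F u) (dmx G u x).
Proof.
move=> dF dG; pose z w := \tr (F w *m G w).
have zE : z = fun w => \sum_a (F w *m G w) a a by [].
have dz : cdiff z u by rewrite zE; apply: cdiff_sum => a; apply: mxdiffM.
have -> : (fun w => gmetric (F w) (G w)) = 4^-1 \*: (fun w => complex.Re (z w)).
  by rewrite funeqE => w; rewrite /gmetric mulrC.
rewrite deriveZ; last by apply: diff_derivable; case: dz.
have -> : 'D_x (fun w => complex.Re (z w)) u = complex.Re (cderive z u x) by [].
rewrite zE cderive_sum; last by move=> a; apply: mxdiffM.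
have -> : \sum_a cderive (fun w => (F w *m G w) a a) u x = \tr (dmx F u x *m G u + F u *m dmx G u x).
  by rewrite -dmxM //; apply: eq_bigr => a _; rewrite dmxE.
by rewrite mxtraceD Re_add /gmetric /GRing.scale /= mulrC mulrDl.
Qed.

Lemma gmetric_diff F G u : mxdiff F u -> mxdiff G u ->
  differentiable (fun w => gmetric (F w) (G w)) u.
Proof.
move=> dF dG.
have -> : (fun w => gmetric (F w) (G w)) = 4^-1 \*: (fun w => complex.Re (\tr (F w *m G w))).
  by rewrite funeqE => w; rewrite /gmetric mulrC.
apply: differentiableZ.
by case: (@cdiff_sum _ _ _ (fun a w => (F w *m G w) a a) u (fun a => mxdiffM dF dG a a)).
Qed.

Lemma gJ_diff F G u : mxdiff F u -> mxdiff G u -> mxdiff (fun w => gJ (F w) (G w)) u.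
Proof.
move=> dF dG; apply: mxdiffZ; first exact: cdiff_cst.
by apply: mxdiffB; apply: mxdiffM.
Qed.

Lemma dmx_gJ F G u v : mxdiff F u -> mxdiff G u ->
  dmx (fun w => gJ (F w) (G w)) u v =
  gJ (F u) (dmx G u v) + Complex 0 1 *: (G u *m dmx F u v - dmx F u v *m G u).
Proof.
move=> dF dG; rewrite dmxZc; last by apply: mxdiffB; apply: mxdiffM.
rewrite dmxB; [|exact: mxdiffM|exact: mxdiffM].
rewrite !dmxM // /gJ -scalerDr; congr (_ *: _).
by rewrite opprD [- _ - _]addrC addrACA.
Qed.

Variable U : set 'rV[R]_d.
Hypothesis Uo : open U.

Lemma smooth_mxdiff F u : smooth_mx_on U F -> U u -> mxdiff F u.
Proof. by move=> sF Uu a b; apply: (csmooth_cdiff (sF a b)). Qed.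

Lemma smooth_mx_eq F G : (forall u, U u -> F u = G u) -> smooth_mx_on U F -> smooth_mx_on U G.
Proof. by move=> e sF a b; apply: (csmooth_eq Uo) (sF a b) => u Uu; rewrite e. Qed.

Lemma smooth_mx_cst (A : 'M[R[i]]_n) : smooth_mx_on U (fun=> A).
Proof. by move=> a b; apply: csmooth_cst. Qed.

Lemma smooth_mxD F G : smooth_mx_on U F -> smooth_mx_on U G -> smooth_mx_on U (fun w => F w + G w).
Proof.
move=> sF sG a b; have := csmoothD Uo (sF a b) (sG a b).
by apply: (csmooth_eq Uo) => u Uu; rewrite mxE.
Qed.

Lemma smooth_mxM F G : smooth_mx_on U F -> smooth_mx_on U G -> smooth_mx_on U (fun w => F w *m G w).
Proof.
move=> sF sG a b.
have := csmooth_sum Uo (F := fun c w => F w a c * G w c b) (fun c => csmoothM Uo (sF a c) (sG c b)).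
by apply: (csmooth_eq Uo) => u Uu; rewrite mxE.
Qed.

Lemma smooth_mxZ (z : 'rV[R]_d -> R[i]) F : csmooth U z -> smooth_mx_on U F ->
  smooth_mx_on U (fun w => z w *: F w).
Proof.
move=> sz sF a b; have := csmoothM Uo sz (sF a b).
by apply: (csmooth_eq Uo) => u Uu; rewrite mxE.
Qed.

Lemma smooth_mxZr f F : smooth_on U f -> smooth_mx_on U F -> smooth_mx_on U (fun w => (f w)%:C *: F w).
Proof. by move=> sf sF; apply: smooth_mxZ => //; apply: csmooth_real. Qed.

Lemma smooth_mxZc (c : R[i]) F : smooth_mx_on U F -> smooth_mx_on U (fun w => c *: F w).
Proof. by move=> sF; apply: smooth_mxZ => //; apply: csmooth_cst. Qed.

Lemma smooth_mxN F : smooth_mx_on U F -> smooth_mx_on U (fun w => - F w).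
Proof.
move=> sF; apply: (smooth_mx_eq (F := fun w => -1 *: F w)); last exact: smooth_mxZc.
by move=> u Uu; rewrite scaleN1r.
Qed.

Lemma smooth_mxB F G : smooth_mx_on U F -> smooth_mx_on U G -> smooth_mx_on U (fun w => F w - G w).
Proof. by move=> sF sG; apply: smooth_mxD => //; apply: smooth_mxN. Qed.

Lemma smooth_mx_sum (I : finType) (H : I -> 'rV[R]_d -> 'M[R[i]]_n) :
  (forall i, smooth_mx_on U (H i)) -> smooth_mx_on U (fun w => \sum_i H i w).
Proof.
move=> sH a b; have := csmooth_sum Uo (F := fun i w => H i w a b) (fun i => sH i a b).
by apply: (csmooth_eq Uo) => u Uu; rewrite summxE.
Qed.

Lemma smooth_dmx F v : smooth_mx_on U F -> smooth_mx_on U (fun w => dmx F w v).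
Proof.
move=> sF a b; have := csmooth_cderive v (sF a b).
by apply: (csmooth_eq Uo) => u Uu; rewrite dmxE.
Qed.

Lemma smooth_dmx_dir F (Y : 'rV[R]_d -> 'rV[R]_d) : smooth_mx_on U F -> smooth_on U Y ->
  smooth_mx_on U (fun w => dmx F w (Y w)).
Proof.
move=> sF sY; apply: (smooth_mx_eq (F := fun w => \sum_i (Y w 0 i)%:C *: dmx F w (delta_mx 0 i))).
  by move=> u Uu; rewrite [RHS]dmx_dirE //; apply: smooth_mxdiff.
apply: smooth_mx_sum => i; apply: smooth_mxZr; last exact: smooth_dmx.
exact: smooth_row_coord.
Qed.

Lemma smooth_gJ F G : smooth_mx_on U F -> smooth_mx_on U G -> smooth_mx_on U (fun w => gJ (F w) (G w)).
Proof. by move=> sF sG; apply: smooth_mxZc; apply: smooth_mxB; apply: smooth_mxM. Qed.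

Lemma smooth_gmetric F G : smooth_mx_on U F -> smooth_mx_on U G ->
  smooth_on U (fun w => gmetric (F w) (G w)).
Proof.
move=> sF sG.
have [sR _] := csmooth_sum Uo (F := fun a w => (F w *m G w) a a) (fun a => smooth_mxM sF sG a a).
by apply: (smooth_eq Uo) (smoothZ Uo 4^-1 sR) => w Uw; rewrite /gmetric mulrC.
Qed.

(** Leibniz rule: one term differentiates the direction field, the other is the second derivative of
    [F] with the direction frozen at [Y u]. *)
Lemma dmx_dir_field F (Y : 'rV[R]_d -> 'rV[R]_d) u x : smooth_mx_on U F -> smooth_on U Y -> U u ->
  dmx (fun w => dmx F w (Y w)) u x = dmx F u ('D_x Y u) + dmx (fun w => dmx F w (Y u)) u x.
Proof.
move=> sF sY Uu; have dF w : U w -> mxdiff F w := smooth_mxdiff sF.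
have dY : differentiable Y u := smooth_differentiable sY Uu.
have dE i : mxdiff (fun w => dmx F w (delta_mx 0 i)) u := smooth_mxdiff (smooth_dmx _ sF) Uu.
have expand (Z : 'rV[R]_d -> 'rV[R]_d) : differentiable Z u ->
    dmx (fun w => dmx F w (Z w)) u x =
    \sum_i (('D_x (fun w => Z w 0 i) u)%:C *: dmx F u (delta_mx 0 i) +
            (Z u 0 i)%:C *: dmx (fun w => dmx F w (delta_mx 0 i)) u x).
  move=> dZ; have dZi i : differentiable (fun w => Z w 0 i) u by apply: differentiable_row_coord.
  rewrite (@dmx_near_eq _ (fun w => \sum_i (Z w 0 i)%:C *: dmx F w (delta_mx 0 i))); last first.
    by apply: filterS (near_open Uo Uu) => w Uw; apply/dmx_dirE/dF.
  rewrite dmx_sum => [|i]; last by apply: mxdiffZ => //; apply: cdiff_real.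
  by apply: eq_bigr => i _; rewrite dmxZr.
rewrite (expand Y dY) (expand (fun=> Y u) (differentiable_cst _ _)).
rewrite (dmx_dirE _ (dF u Uu)) !big_split /= [X in _ = _ + (X + _)]big1 ?add0r => [|i _].
  by congr (_ + _); apply: eq_bigr => i _; rewrite derive_row.
by rewrite derive_cst scale0r.
Qed.

Lemma dmx_schwarz F u x y : smooth_mx_on U F -> U u ->
  dmx (fun w => dmx F w y) u x = dmx (fun w => dmx F w x) u y.
Proof.
move=> sF Uu; apply/matrixP => a b; rewrite [LHS]dmxE [RHS]dmxE; case: (sF a b) => sR sI.
have eR z : (fun w => complex.Re (dmx F w z a b)) = (fun w => 'D_z (fun t => complex.Re (F t a b) : R) w).
  by rewrite funeqE => w; rewrite dmxE.
have eI z : (fun w => complex.Im (dmx F w z a b)) = (fun w => 'D_z (fun t => complex.Im (F t a b) : R) w).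
  by rewrite funeqE => w; rewrite dmxE.
apply: complex_eq; rewrite /= ?eR ?eI.
  exact: (schwarz Uo x y sR Uu).
exact: (schwarz Uo x y sI Uu).
Qed.

End MatrixCalculus.

(** * Hypersurface patches *)

Lemma gmetric_gauss (R : realType) n (X Y Z W : 'M[R[i]]_n) :
  gmetric (Y *m Z + Z *m Y) (X *m W + W *m X) - gmetric (X *m Z + Z *m X) (Y *m W + W *m Y) =
  gmetric ((X *m Y - Y *m X) *m Z - Z *m (X *m Y - Y *m X)) W.
Proof. by rewrite /gmetric -trace_gauss Re_add Re_opp mulrDl mulNr. Qed.

Lemma derive_oppM (R : realType) d (f h : 'rV[R]_d -> R) u v :
  derivable f u v -> derivable h u v ->
  'D_v (fun w => - (f w * h w)) u = - (f u * 'D_v h u + 'D_v f u * h u).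
Proof.
move=> df dh; have -> : (fun w => - (f w * h w)) = - (f * h) by [].
rewrite (deriveN (derivableM df dh)) (deriveM df dh).
by apply: (congr1 -%R); apply: (congr1 (fun r => f u * 'D_v h u + r)); exact: mulrC.
Qed.

(** The arithmetic of [hopf_equation]. Subtracting the two differentiated Hopf conditions cancels
    the symmetric second derivatives [a1 = a2] and [d1 = d2]; [v] and [t] are derivatives of [al],
    multiplied by components along [xi] that are zero. *)
Lemma antisymmetrize (R : realFieldType) (a1 a2 b1 b2 al c1 c2 d1 d2 p q t v p' q' : R) :
  a1 + b1 = - (al * (c1 + d1) + v * 0) -> a2 + b2 = - (al * (c2 + d2) + t * 0) ->
  a2 = a1 -> d2 = d1 -> b2 - b1 = - 2 * p + 2 * q -> c1 = - p' -> c2 = q' ->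
  p - q = al / 2 * (q' + p').
Proof.
move=> k1 k2 a12 d12 b12 c1E <-.
have -> : p - q = (b1 - b2) / 2 by lra.
move: k1 k2; rewrite !mulr0 !addr0 a12 d12 c1E => k1 k2.
have -> : b1 = - (al * (- p' + d1)) - a1 by lra.
have -> : b2 = - (al * (c2 + d1)) - a1 by lra.
by field.
Qed.

Lemma row_combE (R : comPzRingType) d (p q r : R) (a b c v w : 'rV[R]_d) j :
  (p *: a - b + q *: c + r *: v - w) 0 j = p * a 0 j - b 0 j + q * c 0 j + r * v 0 j - w 0 j.
Proof. by rewrite !mxE. Qed.

Lemma row_mul_comb (R : comPzRingType) d (p q r : R) (a : 'rV[R]_d) (T L A : 'M[R]_d) :
  a *m (p%:M - T + q *: L + r *: A - A *m A) =
  p *: a - a *m T + q *: (a *m L) + r *: (a *m A) - a *m A *m A.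
Proof. by rewrite mulmxBr !mulmxDr mulmxN mul_mx_scalar -!scalemxAr mulmxA. Qed.

(** [a] and [b] are the Levi-Civita contributions, common to both sides; cancelling them leaves a
    condition on the difference tensor alone. *)
Lemma row_condition (R : comPzRingType) d (k : R) (a b v w z : 'rV[R]_d) (S A P : 'M[R]_d) :
  a + ((v *m A *m P *m (w *m S)^T) 0 0 *: z - (w *m S *m z^T) 0 0 *: (v *m A *m P)
       - (k * (v *m z^T) 0 0) *: (w *m S *m P))
    - (b + ((v *m A *m P *m w^T) 0 0 *: z - (w *m z^T) 0 0 *: (v *m A *m P)
       - (k * (v *m z^T) 0 0) *: (w *m P))) *m S = a - b *m S ->
  (v *m A *m P *m (w *m S)^T) 0 0 *: z - (w *m S *m z^T) 0 0 *: (v *m A *m P)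
    - (k * (v *m z^T) 0 0) *: (w *m S *m P) =
  (v *m A *m P *m w^T) 0 0 *: (z *m S) - (w *m z^T) 0 0 *: (v *m A *m P *m S)
    - (k * (v *m z^T) 0 0) *: (w *m P *m S).
Proof.
rewrite mulmxDl opprD addrACA => /eqP.
rewrite eq_sym addrC -subr_eq subrr eq_sym subr_eq0 => /eqP ->.
by rewrite !mulmxBl -!scalemxAl.
Qed.

Lemma hopf_row_expand (R : comPzRingType) d (r : R) (v w : 'rV[R]_d) (A P T : 'M[R]_d) :
  (v *m (A *m P *m A - r *: (A *m P + P *m A) - T *m P) *m w^T) 0 0 =
  (v *m A *m P *m A *m w^T) 0 0 - (v *m T *m P *m w^T) 0 0 -
  r * ((v *m A *m P *m w^T) 0 0 + (v *m P *m A *m w^T) 0 0).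
Proof.
rewrite !(mulmxBr, mulmxBl) -scalemxAr -scalemxAl mulmxDr mulmxDl !mulmxA addrAC.
by move: (_ *m w^T) (_ *m w^T) (_ *m w^T) (_ *m w^T) => a b c e; rewrite !mxE.
Qed.

Lemma gJ_scale (R : realType) n (P V : 'M[R[i]]_n) (c : R[i]) : gJ P (c *: V) = c *: gJ P V.
Proof. by rewrite /gJ -scalemxAl -scalemxAr -scalerBr !scalerA mulrC. Qed.

Lemma mulmx_sym_tr (R : comPzRingType) d (v w : 'rV[R]_d) (A : 'M[R]_d) : A^T = A ->
  v *m A *m w^T = v *m (w *m A)^T.
Proof. by move=> As; rewrite trmx_mul As mulmxA. Qed.

Section Rows.
Variables (R : realType) (d : nat) (U : set 'rV[R]_d).
Hypothesis Uo : open U.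

Lemma smooth_rowZ (f : 'rV[R]_d -> R) (Y : 'rV[R]_d -> 'rV[R]_d) :
  smooth_on U f -> smooth_on U Y -> smooth_on U (fun w => f w *: Y w).
Proof.
move=> sf sY; apply: (smooth_row Uo) => j.
apply: (smooth_eq Uo) (smoothM Uo sf (smooth_row_coord Uo j sY)) => w _.
by rewrite mxE.
Qed.

Lemma smooth_rowD (X Y : 'rV[R]_d -> 'rV[R]_d) :
  smooth_on U X -> smooth_on U Y -> smooth_on U (fun w => X w + Y w).
Proof.
move=> sX sY; apply: (smooth_row Uo) => j.
apply: (smooth_eq Uo) (smoothD Uo (smooth_row_coord Uo j sX) (smooth_row_coord Uo j sY)) => w _.
by rewrite mxE.
Qed.

Lemma smooth_row_cst (x : 'rV[R]_d) : smooth_on U (fun=> x).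
Proof. by apply: (smooth_row Uo) => j; apply: smooth_cst. Qed.

Lemma smooth_rowN (Y : 'rV[R]_d -> 'rV[R]_d) : smooth_on U Y -> smooth_on U (fun w => - Y w).
Proof.
move=> sY; have -> : (fun w => - Y w) = (fun w => -1 *: Y w).
  by rewrite funeqE => w; rewrite scaleN1r.
by apply: smooth_rowZ => //; apply: smooth_cst.
Qed.

Lemma smooth_row_sum (I : finType) (Y : I -> 'rV[R]_d -> 'rV[R]_d) :
  (forall i, smooth_on U (Y i)) -> smooth_on U (fun w => \sum_i Y i w).
Proof.
move=> sY; apply: (smooth_row Uo) => j.
apply: (smooth_eq Uo) (smooth_sum Uo (fun i => smooth_row_coord Uo j (sY i))) => w _.
by rewrite summxE.
Qed.

End Rows.

Section Patch.
Variables (R : realType) (m d : nat) (U : set 'rV[R]_d) (F N : 'rV[R]_d -> 'M[R[i]]_(m + 2))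
  (e : 'I_d -> 'rV[R]_d -> 'rV[R]_d).
Local Notation "r %:C" := (real_complex R r).
Local Notation g := (@gmetric R (m + 2)).
Hypotheses (Uo : open U) (grF : forall u, U u -> grass2 (F u)) (sF : smooth_mx_on U F)
  (injF : forall u, U u -> forall x, dmx F u x = 0 -> x = 0)
  (uN : unit_normal F U N) (oe : orthonormal_frame F U e) (dm : d.+1 = (4 * m)%N).
Implicit Types (u w x y z : 'rV[R]_d) (X Y Z : 'rV[R]_d -> 'rV[R]_d) (V W : 'M[R[i]]_(m + 2)).
Local Notation met := (met F).

Lemma patch_idem u : U u -> F u *m F u = F u. Proof. by case/grF. Qed.
Lemma patch_adj u : U u -> F u ^t* = F u. Proof. by case/grF. Qed.
Lemma patch_trace u : U u -> \tr (F u) = 2.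
Proof. by move=> /grF[PP _ rP]; rewrite (mxtrace_idem PP) rP. Qed.
Lemma patch_cotrace u : U u -> \tr (1%:M - F u) = m%:R.
Proof. by move=> Uu; rewrite mxtraceD mxtraceN' mxtrace1 patch_trace // natrD addrK. Qed.

Lemma patch_mxdiff u : U u -> mxdiff F u. Proof. exact: smooth_mxdiff. Qed.
Lemma normal_smooth : smooth_mx_on U N. Proof. by case: uN. Qed.
Lemma normal_mxdiff u : U u -> mxdiff N u. Proof. exact/smooth_mxdiff/normal_smooth. Qed.
Lemma normal_tangent u : U u -> grass2_tangent (F u) (N u).
Proof. by case: uN => _ h /h[]. Qed.
Lemma normal_unit u : U u -> g (N u) (N u) = 1.
Proof. by case: uN => _ h /h[]. Qed.
Lemma normal_perp u x : U u -> g (N u) (dmx F u x) = 0.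
Proof. by case: uN => _ h /h[]. Qed.

Lemma patch_tangent u x : U u -> grass2_tangent (F u) (dmx F u x).
Proof.
move=> Uu; have dF := patch_mxdiff Uu; split.
  by apply: dmx_hermitian => //; apply: filterS (near_open Uo Uu) => w; exact: patch_adj.
have FF : \forall w \near u, F w *m F w = F w.
  by apply: filterS (near_open Uo Uu) => w; exact: patch_idem.
by rewrite -[RHS](dmx_near_eq x FF) dmxM // addrC.
Qed.

Definition frame_vec u (i : 'I_d) := dmx F u (e i u).
Local Notation E := frame_vec.

Lemma frame_tangent u i : U u -> grass2_tangent (F u) (E u i).
Proof. exact: patch_tangent. Qed.
Lemma frame_on u i j : U u -> g (E u i) (E u j) = (i == j)%:R.
Proof. by case: oe => _ h /h; apply. Qed.
Lemma frame_normal u i : U u -> g (E u i) (N u) = 0.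
Proof. by move=> Uu; rewrite gmetricC normal_perp. Qed.

Local Notation frm lem Uu := (lem _ _ _ _ _ _ _ (patch_idem Uu) (patch_adj Uu) (patch_trace Uu)
  (patch_cotrace Uu) (normal_tangent Uu) (normal_unit Uu) (fun i => frame_tangent i Uu)
  (fun i j => frame_on i j Uu) (fun i => frame_normal i Uu) dm).

Lemma metC u x y : met u x y = met u y x. Proof. exact: gmetricC. Qed.

Lemma dF_expand u x : U u -> dmx F u x = \sum_i (met u x (e i u))%:C *: E u i.
Proof.
move=> Uu; rewrite {1}(frm tangent_expand Uu (patch_tangent x Uu)).
by rewrite gmetricC normal_perp // scale0r add0r.
Qed.

Lemma vec_expand u x : U u -> x = \sum_i met u x (e i u) *: e i u.
Proof.
move=> Uu; have dF := patch_mxdiff Uu; apply/eqP; rewrite -subr_eq0; apply/eqP.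
apply: (injF Uu); rewrite dmx_dirB // dmx_dir_sum // dF_expand //.
by apply/eqP; rewrite subr_eq0; apply/eqP/eq_bigr => i _; rewrite dmx_dirZ.
Qed.

Lemma met_inj u x y : U u -> (forall z, met u x z = met u y z) -> x = y.
Proof.
by move=> Uu xy; rewrite (vec_expand x Uu) (vec_expand y Uu); apply: eq_bigr => i _; rewrite xy.
Qed.

Lemma metDl u x y z : U u -> met u (x + y) z = met u x z + met u y z.
Proof. by move=> /patch_mxdiff dF; rewrite /met dmx_dirD // gmetricDl. Qed.
Lemma metZl u (r : R) x z : U u -> met u (r *: x) z = r * met u x z.
Proof. by move=> /patch_mxdiff dF; rewrite /met dmx_dirZ // gmetricZl. Qed.
Lemma met0l u z : U u -> met u 0 z = 0.
Proof. by move=> Uu; rewrite -(scale0r 0) metZl // mul0r. Qed.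
Lemma metNl u x z : U u -> met u (- x) z = - met u x z.
Proof. by move=> Uu; rewrite -scaleN1r metZl // mulN1r. Qed.
Lemma metBl u x y z : U u -> met u (x - y) z = met u x z - met u y z.
Proof. by move=> Uu; rewrite metDl // metNl. Qed.
Lemma met_suml u (I : finType) (x : I -> 'rV[R]_d) z : U u ->
  met u (\sum_i x i) z = \sum_i met u (x i) z.
Proof.
by move=> Uu; apply: (big_morph (fun y => met u y z) (fun a b => metDl a b z Uu) (met0l z Uu)).
Qed.

Lemma met_gram u x y : U u -> met u x y = (x *m gram F u *m y^T) 0 0.
Proof.
move=> Uu; have dF := patch_mxdiff Uu.
rewrite /Defs.met (dmx_dirE x dF) (dmx_dirE y dF) gmetric_suml mxE.
under eq_bigr => i _ do rewrite gmetric_sumr.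
rewrite exchange_big; apply: eq_bigr => j _; rewrite !mxE mulr_suml.
apply: eq_bigr => i _; rewrite gmetricZl gmetricZr mxE.
by rewrite mulrA mulrAC.
Qed.

Lemma met_pos u x : U u -> met u x x = 0 -> x = 0.
Proof.
move=> Uu x0; apply: (injF Uu); apply: gmetric_eq0 => //.
by case: (patch_tangent x Uu).
Qed.

Lemma gram_unit u : U u -> gram F u \in unitmx.
Proof.
move=> Uu; rewrite -row_free_unit; apply: inj_row_free => v v0.
by apply: (met_pos Uu); rewrite met_gram // v0 mul0mx mxE.
Qed.

Lemma met_tangential u V z : U u -> met u (tangential F u V) z = g V (dmx F u z).
Proof.
move=> Uu; rewrite met_gram // /tangential mulmxKV ?gram_unit //.
rewrite (dmx_dirE z (patch_mxdiff Uu)) gmetric_sumr mxE; apply: eq_bigr => i _.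
by rewrite !mxE gmetricZr mulrC.
Qed.

Lemma tangentialE u V : U u -> tangential F u V = \sum_i g V (E u i) *: e i u.
Proof.
move=> Uu; rewrite {1}(vec_expand (tangential F u V) Uu).
by apply: eq_bigr => i _; rewrite met_tangential.
Qed.

Lemma dF_tangential u V : U u -> dmx F u (tangential F u V) = \sum_i (g V (E u i))%:C *: E u i.
Proof. by move=> Uu; rewrite dF_expand //; apply: eq_bigr => i _; rewrite met_tangential. Qed.

Lemma tangential_id u x : U u -> tangential F u (dmx F u x) = x.
Proof. by move=> Uu; apply: (met_inj Uu) => z; rewrite met_tangential. Qed.

Lemma tangentialD u V W : U u -> tangential F u (V + W) = tangential F u V + tangential F u W.
Proof. by move=> Uu; apply: (met_inj Uu) => z; rewrite metDl // !met_tangential // gmetricDl. Qed.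

(** * The Levi-Civita connection as a projected flat derivative *)

Lemma gramC u i j : gram F u i j = gram F u j i.
Proof. by rewrite !mxE metC. Qed.

Lemma derive_gram u i j k : U u ->
  'D_(coord_vec R i) (fun w => gram F w j k : R) u =
  g (dmx (fun w => dmx F w (coord_vec R j)) u (coord_vec R i)) (dmx F u (coord_vec R k)) +
  g (dmx F u (coord_vec R j)) (dmx (fun w => dmx F w (coord_vec R k)) u (coord_vec R i)).
Proof.
move=> Uu; have -> : (fun w => gram F w j k : R) =
    fun w => g (dmx F w (coord_vec R j)) (dmx F w (coord_vec R k)).
  by rewrite funeqE => w; rewrite mxE.
by apply: derive_gmetric; apply: (smooth_mxdiff (U := U)) => //; apply: smooth_dmx.
Qed.

(** Since second derivatives of [F] are symmetric, the six inner products arising from the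
    derivatives of the Gram matrix collapse to one, taken twice; contraction with the inverse Gram
    matrix is then the tangential part. *)
Lemma christoffelE u l i j : U u ->
  christoffel F u l i j =
  tangential F u (dmx (fun w => dmx F w (coord_vec R j)) u (coord_vec R i)) 0 l.
Proof.
move=> Uu; rewrite mxE /christoffel mulr_sumr; apply: eq_bigr => k _.
pose H a b := dmx (fun w => dmx F w (coord_vec R b)) u (coord_vec R a).
have dg a b c : 'D_(coord_vec R a) (fun w => gram F w b c : R) u =
  g (H a b) (dmx F u (coord_vec R c)) + g (dmx F u (coord_vec R b)) (H a c) := derive_gram a b c Uu.
rewrite !dg mxE -/(H i j).
have HC a b : H a b = H b a by apply: dmx_schwarz sF Uu.
have -> : invmx (gram F u) l k = invmx (gram F u) k l.
  have gT : (gram F u)^T = gram F u by apply/matrixP => a b; rewrite mxE gramC.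
  by rewrite -[in LHS]gT -trmx_inv mxE.
have ar (a b c p : R) : 2^-1 * (p * (a + b + (a + c) - (b + c))) = a * p by field.
rewrite (HC k i) (HC k j) (HC j i).
rewrite (gmetricC (dmx F u (coord_vec R j))) (gmetricC (dmx F u (coord_vec R i))).
exact: ar.
Qed.

Lemma tangentialZ u (r : R) V : U u -> tangential F u (r%:C *: V) = r *: tangential F u V.
Proof. by move=> Uu; apply: (met_inj Uu) => z; rewrite metZl // !met_tangential // gmetricZl. Qed.

Lemma tangential_sum u (I : finType) (V : I -> 'M[R[i]]_(m + 2)) : U u ->
  tangential F u (\sum_i V i) = \sum_i tangential F u (V i).
Proof.
move=> Uu; apply: (met_inj Uu) => z; rewrite met_suml // met_tangential // gmetric_suml.
by apply: eq_bigr => i _; rewrite met_tangential.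
Qed.

(** The bridge from the intrinsic definition to the immersion; the later computations use this form
    in place of the Christoffel symbols. *)
Lemma nablaE X Y u : smooth_on U Y -> U u ->
  nabla F X Y u = tangential F u (dmx (fun w => dmx F w (Y w)) u (X u)).
Proof.
move=> sY Uu; rewrite (dmx_dir_field Uo (X u) sF sY Uu) tangentialD // tangential_id //; congr (_ + _).
have dE y : mxdiff (fun w => dmx F w y) u := smooth_mxdiff (smooth_dmx Uo _ sF) Uu.
rewrite (dmx_dirE (X u) (dE (Y u))) tangential_sum //; apply/rowP => l.
rewrite mxE summxE; apply: eq_bigr => i _.
rewrite tangentialZ // (dmx_schwarz Uo _ _ sF Uu) (dmx_dirE (Y u) (dE _)) tangential_sum // mxE.
rewrite summxE mulr_sumr; apply: eq_bigr => j _.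
rewrite christoffelE // tangentialZ // [X in _ = _ * X]mxE (dmx_schwarz Uo _ _ sF Uu).
by rewrite mulrAC mulrC; congr (_ * _); rewrite mulrC.
Qed.

Lemma frame_smooth i : smooth_on U (e i). Proof. by case: oe => /(_ i). Qed.

(** The projection is written in the smooth frame [e], so smoothness of the inverse Gram matrix does
    not come up. *)
Lemma smooth_tangential (V : 'rV[R]_d -> 'M[R[i]]_(m + 2)) :
  smooth_mx_on U V -> smooth_on U (fun w => tangential F w (V w)).
Proof.
move=> sV; apply: (@smooth_eq _ _ _ Uo _ (fun w => \sum_i g (V w) (E w i) *: e i w)).
  by move=> u Uu; rewrite tangentialE.
apply: smooth_row_sum => // i; apply: smooth_rowZ => //; last exact: frame_smooth.
by apply: smooth_gmetric => //; apply: smooth_dmx_dir => //; apply: frame_smooth.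
Qed.

Lemma smooth_dF Y : smooth_on U Y -> smooth_mx_on U (fun w => dmx F w (Y w)).
Proof. exact: smooth_dmx_dir. Qed.

Lemma smooth_nabla X Y : smooth_on U X -> smooth_on U Y -> smooth_on U (nabla F X Y).
Proof.
move=> sX sY; apply: (@smooth_eq _ _ _ Uo _
  (fun u => tangential F u (dmx (fun w => dmx F w (Y w)) u (X u)))).
  by move=> u Uu; rewrite nablaE.
by apply: smooth_tangential; apply: smooth_dmx_dir => //; apply: smooth_dF.
Qed.

Lemma tangent_offdiag u V z : U u -> g (gproj (F u) V) (dmx F u z) = g V (dmx F u z).
Proof.
move=> Uu; rewrite /gmetric; congr (complex.Re _ / _).
exact: (mxtrace_offdiag (Q := 1%:M - F u) erefl (patch_idem Uu) V (patch_tangent z Uu)).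
Qed.

Lemma met_shape u x y : U u -> met u (Defs.shape F N u x) y = - g (dmx N u x) (dmx F u y).
Proof. by move=> Uu; rewrite (metNl _ _ Uu) (met_tangential _ _ Uu) (tangent_offdiag _ _ Uu). Qed.

Lemma normal_derive Y u x : smooth_on U Y -> U u ->
  g (dmx N u x) (dmx F u (Y u)) = - g (N u) (dmx (fun w => dmx F w (Y w)) u x).
Proof.
move=> sY Uu; apply/eqP; rewrite -addr_eq0; apply/eqP.
have dY : mxdiff (fun w => dmx F w (Y w)) u := smooth_mxdiff (smooth_dF sY) Uu.
rewrite -(derive_gmetric x (normal_mxdiff Uu) dY).
rewrite (@near_eq_derive _ _ _ _ (fun=> 0 : R)) ?derive_cst //.
by apply: filterS (near_open Uo Uu) => w Uw; rewrite normal_perp.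
Qed.

Lemma met_shapeE Y u x : smooth_on U Y -> U u ->
  met u (Defs.shape F N u x) (Y u) = g (N u) (dmx (fun w => dmx F w (Y w)) u x).
Proof. by move=> sY Uu; rewrite met_shape // (normal_derive _ sY Uu) opprK. Qed.

(** Paired with tangent vectors, the shape operator is the [N]-component of the second derivative of
    [F], which is symmetric. *)
Lemma shapeC u x y : U u -> met u (Defs.shape F N u x) y = met u (Defs.shape F N u y) x.
Proof.
move=> Uu; apply: (etrans (met_shapeE x (smooth_row_cst Uo y) Uu)).
apply: (etrans _ (esym (met_shapeE y (smooth_row_cst Uo x) Uu))).
exact: (congr1 (g (N u)) (dmx_schwarz Uo x y sF Uu)).
Qed.

Lemma smooth_xi : smooth_on U (xi F N).
Proof.
apply: (smooth_tangential (V := fun w => - gJ (F w) (N w))); apply: smooth_mxN => //.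
by apply: smooth_gJ => //; apply: normal_smooth.
Qed.

Lemma smooth_phi Y : smooth_on U Y -> smooth_on U (fun w => phi F w (Y w)).
Proof.
move=> sY; apply: (smooth_tangential (V := fun w => gJ (F w) (dmx F w (Y w)))).
by apply: smooth_gJ => //; apply: smooth_dF.
Qed.

Lemma smooth_shape Y : smooth_on U Y -> smooth_on U (fun w => Defs.shape F N w (Y w)).
Proof.
move=> sY; apply: smooth_rowN => //.
apply: (smooth_tangential (V := fun w => gproj (F w) (dmx N w (Y w)))).
have sN := smooth_dmx_dir Uo normal_smooth sY.
have s1 : smooth_mx_on U (fun w => 1%:M - F w) by apply: smooth_mxB => //; apply: smooth_mx_cst.
by apply: smooth_mxD => //; apply: smooth_mxM => //; apply: smooth_mxM.
Qed.

Lemma smooth_met X Y : smooth_on U X -> smooth_on U Y -> smooth_on U (fun w => met w (X w) (Y w)).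
Proof. by move=> sX sY; apply: smooth_gmetric => //; apply: smooth_dF. Qed.

Lemma smooth_gtw k X Y : smooth_on U X -> smooth_on U Y -> smooth_on U (gtw F N k X Y).
Proof.
move=> sX sY; have sA := smooth_phi (smooth_shape sX).
have sx := smooth_xi; have sn := smooth_nabla sX sY.
have s1 := smooth_rowZ Uo (smooth_met sA sY) sx.
have s2 := smooth_rowN Uo (smooth_rowZ Uo (smooth_met sY sx) sA).
have s3 := smooth_rowN Uo (smooth_rowZ Uo (smoothZ Uo k (smooth_met sX sx)) (smooth_phi sY)).
exact: (smooth_rowD Uo (smooth_rowD Uo (smooth_rowD Uo sn s1) s2) s3).
Qed.

Lemma dF_mxdiff Y u : smooth_on U Y -> U u -> mxdiff (fun w => dmx F w (Y w)) u.
Proof. by move=> sY; apply: smooth_mxdiff; apply: smooth_dF. Qed.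

(** * Gauss' equation and the Ricci operator *)

Local Notation s u := (1%:M - 2 *: F u).

Lemma diag_perp u V D : U u -> grass2_tangent (F u) V -> s u *m D = D *m s u -> g V D = 0.
Proof.
move=> Uu tV sD; rewrite /gmetric.
by rewrite (trace_tangent_diag (reflection_involutive erefl (patch_idem Uu))
  (tangent_anticommutes erefl tV) sD) mul0r.
Qed.

(** [tangent_derivative] splits off the part normal to the Grassmannian, and the rest expands in [N]
    and the frame. The part split off is block-diagonal, hence orthogonal to these vectors, so the
    coefficients can be read off the whole derivative. *)
Lemma tangent_field_derivative (W : 'rV[R]_d -> 'M[R[i]]_(m + 2)) u x :
  smooth_mx_on U W -> (forall w, U w -> grass2_tangent (F w) (W w)) -> U u ->
  dmx W u x = (g (dmx W u x) (N u))%:C *: N u + \sum_i (g (dmx W u x) (E u i))%:C *: E u i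
    + s u *m (dmx F u x *m W u + W u *m dmx F u x).
Proof.
move=> sW tW Uu; have dF := patch_mxdiff Uu; have dW : mxdiff W u := smooth_mxdiff sW Uu.
have Vh : (dmx W u x) ^t* = dmx W u x.
  by apply: dmx_hermitian dW; apply: filterS (near_open Uo Uu) => w /tW[].
have Ve : dmx F u x *m W u + F u *m dmx W u x + (dmx W u x *m F u + W u *m dmx F u x) = dmx W u x.
  have FW : \forall w \near u, F w *m W w + W w *m F w = W w.
    by apply: filterS (near_open Uo Uu) => w /tW[].
  rewrite -[RHS](dmx_near_eq x FW) (dmxD _ (mxdiffM dF dW) (mxdiffM dW dF)).
  by rewrite (dmxM _ dF dW) (dmxM _ dW dF).
have tX := patch_tangent x Uu.
have sK := anticommutator_comm erefl tX (tW _ Uu).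
have tT := tangent_derivative erefl (patch_idem Uu) (patch_adj Uu) tX (tW _ Uu) Vh Ve.
move: (dmx W u x) (dmx F u x *m W u + W u *m dmx F u x) sK tT => V K sK tT.
have sD : s u *m (s u *m K) = s u *m K *m s u by rewrite -[RHS]mulmxA sK.
have gT V' : grass2_tangent (F u) V' -> g (V - s u *m K) V' = g V V'.
  by move=> tV'; rewrite gmetricBl [g (s u *m K) V']gmetricC (diag_perp Uu tV' sD) subr0.
apply/eqP; rewrite -subr_eq; apply/eqP.
rewrite {1}(frm tangent_expand Uu tT) (gT _ (normal_tangent Uu)); congr (_ + _).
by apply: eq_bigr => i _; rewrite (gT _ (frame_tangent i Uu)).
Qed.

(** The second fundamental form of the hypersurface in the flat space of Hermitian matrices: a
    single Gauss equation then accounts for both the shape operator and the curvature of the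
    Grassmannian. *)
Definition second_form Y Z u := dmx (fun w => dmx F w (Z w)) u (Y u) - dmx F u (nabla F Y Z u).

Lemma smooth_second_form Y Z : smooth_on U Y -> smooth_on U Z -> smooth_mx_on U (second_form Y Z).
Proof.
move=> sY sZ; apply: smooth_mxB => //; first exact: (smooth_dmx_dir Uo (smooth_dF sZ) sY).
exact: (smooth_dF (smooth_nabla sY sZ)).
Qed.

Lemma second_form_perp Y Z u z : smooth_on U Z -> U u -> g (second_form Y Z u) (dmx F u z) = 0.
Proof.
by move=> sZ Uu; rewrite gmetricBl (nablaE _ sZ Uu) -[X in _ - X]/(met _ _ _) (met_tangential _ _ Uu) subrr.
Qed.

Lemma second_formE Y Z u : smooth_on U Z -> U u ->
  second_form Y Z u = (met u (Defs.shape F N u (Y u)) (Z u))%:C *: N u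
    + s u *m (dmx F u (Y u) *m dmx F u (Z u) + dmx F u (Z u) *m dmx F u (Y u)).
Proof.
move=> sZ Uu; rewrite /second_form (nablaE _ sZ Uu) (dF_tangential _ Uu) (met_shapeE _ sZ Uu).
have tZ w : U w -> grass2_tangent (F w) (dmx F w (Z w)) by apply: patch_tangent.
rewrite {1}(tangent_field_derivative (Y u) (smooth_dF sZ) tZ Uu).
by rewrite [g (N u) _]gmetricC addrAC addrK.
Qed.

Lemma second_form_derivative X Y Z u z : smooth_on U X -> smooth_on U Y -> smooth_on U Z -> U u ->
  g (dmx (second_form Y Z) u (X u)) (dmx F u z) =
  - g (second_form Y Z u) (second_form X (fun=> z) u).
Proof.
move=> sX sY sZ Uu; have sz := smooth_row_cst Uo z.
have dB : mxdiff (second_form Y Z) u := smooth_mxdiff (smooth_second_form sY sZ) Uu.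
have dz := dF_mxdiff sz Uu.
have e0 : g (dmx (second_form Y Z) u (X u)) (dmx F u z) +
    g (second_form Y Z u) (dmx (fun w => dmx F w z) u (X u)) = 0.
  rewrite -(derive_gmetric (X u) dB dz) (@near_eq_derive _ _ _ _ (fun=> 0 : R)) ?derive_cst //.
  by apply: filterS (near_open Uo Uu) => w Uw; apply: second_form_perp.
have -> : g (second_form Y Z u) (second_form X (fun=> z) u) =
    g (second_form Y Z u) (dmx (fun w => dmx F w z) u (X u)).
  by rewrite {2}/second_form gmetricBr (second_form_perp _ _ sZ Uu) subr0.
by apply/eqP; rewrite -addr_eq0 e0.
Qed.

(** In the curvature, the first summand is cancelled by the Lie bracket term and the second by
    symmetry of second derivatives, so only the products of second fundamental forms survive. *)
Lemma nabla_nabla X Y Z u z : smooth_on U X -> smooth_on U Y -> smooth_on U Z -> U u ->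
  met u (nabla F X (nabla F Y Z) u) z =
  g (dmx (fun w => dmx F w (Z w)) u ('D_(X u) Y u)) (dmx F u z) +
  g (dmx (fun t => dmx (fun w => dmx F w (Z w)) t (Y u)) u (X u)) (dmx F u z) +
  g (second_form Y Z u) (second_form X (fun=> z) u).
Proof.
move=> sX sY sZ Uu; have sn := smooth_nabla sY sZ; have sZF := smooth_dF sZ.
rewrite (nablaE _ sn Uu) (met_tangential _ _ Uu).
have -> : (fun w => dmx F w (nabla F Y Z w)) =
    (fun w => dmx (fun t => dmx F t (Z t)) w (Y w) - second_form Y Z w).
  by rewrite funeqE => w; rewrite /second_form opprB addrC subrK.
rewrite dmxB; last 2 first.
- exact: (smooth_mxdiff (smooth_dmx_dir Uo sZF sY) Uu).
- exact: (smooth_mxdiff (smooth_second_form sY sZ) Uu).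
rewrite gmetricBl (second_form_derivative z sX sY sZ Uu) opprK; congr (_ + _).
apply: (etrans (congr1 (fun V => g V (dmx F u z)) (dmx_dir_field Uo (X u) sZF sY Uu))).
exact: gmetricDl.
Qed.

Lemma gauss_form X Y Z u z : smooth_on U X -> smooth_on U Y -> smooth_on U Z -> U u ->
  met u (curvature F X Y Z u) z =
  g (second_form Y Z u) (second_form X (fun=> z) u) -
  g (second_form X Z u) (second_form Y (fun=> z) u).
Proof.
move=> sX sY sZ Uu; rewrite /curvature (metBl _ _ _ Uu) (metBl _ _ _ Uu).
rewrite (nabla_nabla z sX sY sZ Uu) (nabla_nabla z sY sX sZ Uu).
rewrite (nablaE _ sZ Uu) (met_tangential _ _ Uu) /lie_bracket.
have eL := etrans (congr1 (fun V => g V (dmx F u z))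
  (dmx_dirB ('D_(X u) Y u) ('D_(Y u) X u) (dF_mxdiff sZ Uu))) (gmetricBl _ _ _).
have eS := congr1 (fun V => g V (dmx F u z)) (dmx_schwarz Uo (X u) (Y u) (smooth_dF sZ) Uu).
have ar (a b c c' l p q : R) : l = a - b -> c = c' -> a + c + p - (b + c' + q) - l = p - q.
  by move=> -> ->; ring.
exact: (ar _ _ _ _ _ _ _ eL eS).
Qed.

Local Notation h u x y := (met u (Defs.shape F N u x) y).

Lemma normal_diag_metric u (a b : R) K K' : U u -> s u *m K = K *m s u -> s u *m K' = K' *m s u ->
  g (a%:C *: N u + s u *m K) (b%:C *: N u + s u *m K') = a * b + g K K'.
Proof.
move=> Uu sK sK'; have tN := normal_tangent Uu.
have sD D : s u *m D = D *m s u -> s u *m (s u *m D) = s u *m D *m s u.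
  by move=> e'; rewrite -[RHS]mulmxA e'.
have gND D : s u *m D = D *m s u -> g (N u) (s u *m D) = 0.
  by move=> e'; exact: diag_perp Uu tN (sD _ e').
have gDD : g (s u *m K) (s u *m K') = g K K'.
  by rewrite /gmetric (trace_diag_mul erefl (patch_idem Uu) sK sK').
rewrite gmetricDl (gmetricDr (a%:C *: N u)) (gmetricDr (s u *m K)) gDD.
rewrite gmetricZl gmetricZr (normal_unit Uu) gmetricZl (gND _ sK') gmetricZr.
by rewrite [g (s u *m K) _]gmetricC (gND _ sK) mulr1 !mulr0 addr0 add0r.
Qed.

Lemma gauss X Y Z u z : smooth_on U X -> smooth_on U Y -> smooth_on U Z -> U u ->
  met u (curvature F X Y Z u) z =
  h u (Y u) (Z u) * h u (X u) z - h u (X u) (Z u) * h u (Y u) z +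
  g ((dmx F u (X u) *m dmx F u (Y u) - dmx F u (Y u) *m dmx F u (X u)) *m dmx F u (Z u) -
     dmx F u (Z u) *m (dmx F u (X u) *m dmx F u (Y u) - dmx F u (Y u) *m dmx F u (X u))) (dmx F u z).
Proof.
move=> sX sY sZ Uu; rewrite (gauss_form z sX sY sZ Uu).
have sz := smooth_row_cst Uo z.
rewrite (second_formE Y sZ Uu) (second_formE X sZ Uu) (second_formE X sz Uu) (second_formE Y sz Uu).
have sK x y : s u *m (dmx F u x *m dmx F u y + dmx F u y *m dmx F u x) =
    (dmx F u x *m dmx F u y + dmx F u y *m dmx F u x) *m s u.
  by apply: anticommutator_comm => //; exact: patch_tangent.
have e1 := normal_diag_metric (h u (Y u) (Z u)) (h u (X u) z) Uu (sK (Y u) (Z u)) (sK (X u) z).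
have e2 := normal_diag_metric (h u (X u) (Z u)) (h u (Y u) z) Uu (sK (X u) (Z u)) (sK (Y u) z).
have ar (g1 g2 a b k1 k2 k : R) : g1 = a + k1 -> g2 = b + k2 -> k1 - k2 = k -> g1 - g2 = a - b + k.
  by move=> -> -> <-; ring.
apply: (ar _ _ _ _ _ _ _ e1 e2).
exact: gmetric_gauss.
Qed.

Lemma met_ricci X u z : smooth_on U X -> U u ->
  met u (ricci F e X u) z =
  (\sum_i h u (e i u) (e i u)) * h u (X u) z - \sum_i h u (X u) (e i u) * h u (e i u) z +
  ((4 * m%:R + 8) * met u (X u) z -
   g (N u *m N u *m dmx F u (X u) + dmx F u (X u) *m N u *m N u) (dmx F u z) +
   2 * g (N u *m dmx F u (X u) *m N u) (dmx F u z)).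
Proof.
move=> sX Uu; rewrite /ricci (met_suml _ _ Uu).
apply: (etrans (eq_bigr _ (fun i _ => gauss z sX (frame_smooth i) (frame_smooth i) Uu))).
have ar (a b c : 'I_d -> R) k t : \sum_i c i = t ->
    \sum_i (a i * k - b i + c i) = (\sum_i a i) * k - \sum_i b i + t.
  by move=> <-; rewrite !big_split sumrN -mulr_suml.
exact: (ar _ _ _ _ _ (frm gmetric_casimir Uu (patch_tangent (X u) Uu) (patch_tangent z Uu))).
Qed.

(** * Derivatives of the normal and Reeb fields, and the Hopf identity *)

Definition reeb w := - gJ (F w) (N w).

Lemma reeb_smooth : smooth_mx_on U reeb.
Proof. by apply: smooth_mxN => //; apply: smooth_gJ => //; exact: normal_smooth. Qed.

Lemma reeb_is_tangent u : U u -> grass2_tangent (F u) (reeb u).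
Proof.
move=> Uu; apply: grass2_tangentN.
exact: (gJ_tangent (patch_idem Uu) (patch_adj Uu) (normal_tangent Uu)).
Qed.

Lemma reeb_perp u : U u -> g (reeb u) (N u) = 0.
Proof. by move=> Uu; rewrite gmetricNl gmetric_J_self oppr0. Qed.

Lemma dF_xi u : U u -> dmx F u (xi F N u) = reeb u.
Proof.
move=> Uu; rewrite (dF_tangential _ Uu) [RHS](frm tangent_expand Uu (reeb_is_tangent Uu)).
by rewrite (reeb_perp Uu) scale0r add0r.
Qed.

Lemma dF_shape u x : U u -> dmx F u (Defs.shape F N u x) = - \sum_i (g (dmx N u x) (E u i))%:C *: E u i.
Proof.
move=> Uu; apply: (etrans (dmx_dirN _ (patch_mxdiff Uu))); apply: (congr1 -%R).
apply: (etrans (dF_tangential _ Uu)).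
by apply: eq_bigr => i _; rewrite (tangent_offdiag _ _ Uu).
Qed.

Lemma normal_derive_self u x : U u -> g (dmx N u x) (N u) = 0.
Proof.
move=> Uu; have dN := normal_mxdiff Uu.
have e0 : g (dmx N u x) (N u) + g (N u) (dmx N u x) = 0.
  rewrite -(derive_gmetric x dN dN) (@near_eq_derive _ _ _ _ (fun=> 1 : R)) ?derive_cst //.
  by apply: filterS (near_open Uo Uu) => w; exact: normal_unit.
by move: e0; rewrite [g (N u) _]gmetricC => e0; lra.
Qed.

Lemma normal_derivativeE u x : U u ->
  dmx N u x = normal_derivative (N u) (s u) (dmx F u x) (dmx F u (Defs.shape F N u x)).
Proof.
move=> Uu; rewrite {1}(tangent_field_derivative x normal_smooth normal_tangent Uu).
by rewrite (normal_derive_self x Uu) scale0r add0r (dF_shape _ Uu) /normal_derivative opprK.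
Qed.

Lemma gJ_diag u D : U u -> s u *m D = D *m s u -> gJ (F u) D = 0.
Proof.
move=> Uu sD; have two : (2 : R[i]) != 0 by rewrite pnatr_eq0.
have FD : F u *m D = D *m F u.
  apply: (scalerI two); rewrite scalemxAl scalemxAr.
  move: sD; rewrite mulmxBl mulmxBr mul1mx mulmx1 => /(congr1 (fun M => D - M)).
  by rewrite !opprB !(addrC D) !subrK.
by rewrite /gJ FD subrr scaler0.
Qed.

(** [J] annihilates the block-diagonal part of the derivative of [N]. What remains is the shape
    operator term and the term from differentiating the base point in [gJ]. *)
Lemma reeb_derivativeE u x : U u ->
  dmx reeb u x = reeb_derivative (F u) (N u) (dmx F u x) (dmx F u (Defs.shape F N u x)).
Proof.
move=> Uu; have dF := patch_mxdiff Uu; have dN := normal_mxdiff Uu.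
rewrite (dmxN _ (gJ_diff dF dN)) (dmx_gJ _ dF dN) (normal_derivativeE x Uu).
have sK := anticommutator_comm erefl (patch_tangent x Uu) (normal_tangent Uu).
have sD : s u *m (s u *m (dmx F u x *m N u + N u *m dmx F u x)) =
    s u *m (dmx F u x *m N u + N u *m dmx F u x) *m s u by rewrite -mulmxA sK.
rewrite /normal_derivative gJD gJN (gJ_diag Uu sD).
by rewrite addr0 opprD opprK -scalerN opprB.
Qed.

Lemma hopf_normal u x : Defs.shape F N u (xi F N u) = h u (xi F N u) (xi F N u) *: xi F N u ->
  U u -> g (dmx N u x) (reeb u) = - (h u (xi F N u) (xi F N u) * g (reeb u) (dmx F u x)).
Proof.
set al := h u (xi F N u) (xi F N u) => hopf Uu.
have e1 : g (dmx N u x) (reeb u) = - h u x (xi F N u).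
  by rewrite (met_shape x (xi F N u) Uu) opprK (dF_xi Uu).
have e2 : h u (xi F N u) x = al * met u (xi F N u) x.
  exact: (etrans (congr1 (fun v => met u v x) hopf) (metZl al _ _ Uu)).
have e3 : met u (xi F N u) x = g (reeb u) (dmx F u x) := congr1 (fun V => g V _) (dF_xi Uu).
by rewrite e1 (shapeC _ _ Uu) e2 e3.
Qed.

Section Hopf.
Hypothesis hopf : forall w, U w ->
  Defs.shape F N w (xi F N w) = h w (xi F N w) (xi F N w) *: xi F N w.

Lemma hopf_normal_derive u x y : U u ->
  g (dmx (fun w => dmx N w x) u y) (reeb u) + g (dmx N u x) (dmx reeb u y) =
  - (h u (xi F N u) (xi F N u) * (g (dmx reeb u y) (dmx F u x) + g (reeb u) (dmx (fun w => dmx F w x) u y))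
     + 'D_y (fun w => h w (xi F N w) (xi F N w)) u * g (reeb u) (dmx F u x)).
Proof.
move=> Uu; pose al w := h w (xi F N w) (xi F N w).
have dr : mxdiff reeb u := smooth_mxdiff reeb_smooth Uu.
have dx : mxdiff (fun w => dmx F w x) u := smooth_mxdiff (smooth_dmx Uo x sF) Uu.
have dn : mxdiff (fun w => dmx N w x) u := smooth_mxdiff (smooth_dmx Uo x normal_smooth) Uu.
have sal : smooth_on U al by exact: (smooth_met (smooth_shape smooth_xi) smooth_xi).
have dal : derivable al u y by apply/diff_derivable/(smooth_differentiable sal).
pose b w := g (reeb w) (dmx F w x).
have db : derivable b u y by apply/diff_derivable/gmetric_diff.
have e1 := derive_oppM dal db.
have e2 : 'D_y (fun w => g (dmx N w x) (reeb w)) u = 'D_y (fun w => - (al w * b w)) u.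
  apply: near_eq_derive; apply: filterS (near_open Uo Uu) => w Uw.
  exact: hopf_normal (hopf Uw) Uw.
have e3 := derive_gmetric y dr dx.
apply: (etrans (esym (derive_gmetric y dn dr))); apply: (etrans e2); apply: (etrans e1).
by apply: (congr1 -%R); apply: (congr1 (fun t => al u * t + 'D_y al u * b u)).
Qed.

(* The derivative of [alpha] is multiplied by [eta], so it drops out. *)
Lemma hopf_equation u x y : U u -> met u x (xi F N u) = 0 -> met u y (xi F N u) = 0 ->
  g (gJ (F u) (dmx F u (Defs.shape F N u x))) (dmx F u (Defs.shape F N u y)) -
  g (gJ (F u) (N u *m N u *m dmx F u x + dmx F u x *m N u *m N u)) (dmx F u y) =
  h u (xi F N u) (xi F N u) / 2 *
   (g (gJ (F u) (dmx F u (Defs.shape F N u x))) (dmx F u y) +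
    g (gJ (F u) (dmx F u x)) (dmx F u (Defs.shape F N u y))).
Proof.
move=> Uu; rewrite [met u x _]metC [met u y _]metC => mx my.
have x0 : g (reeb u) (dmx F u x) = 0 := etrans (congr1 (fun V => g V _) (esym (dF_xi Uu))) mx.
have y0 : g (reeb u) (dmx F u y) = 0 := etrans (congr1 (fun V => g V _) (esym (dF_xi Uu))) my.
have kx := hopf_normal_derive x y Uu; have ky := hopf_normal_derive y x Uu.
have eN := congr1 (fun V => g V (reeb u)) (dmx_schwarz Uo x y normal_smooth Uu).
have eF := congr1 (fun V => g (reeb u) V) (dmx_schwarz Uo x y sF Uu).
have rX x' y' : g (dmx reeb u x') (dmx F u y') = g (gJ (F u) (dmx F u (Defs.shape F N u x'))) (dmx F u y').
  rewrite (reeb_derivativeE x' Uu) /reeb_derivative gmetricDl -[RHS]addr0; congr (_ + _).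
  rewrite gmetricC; apply: (diag_perp Uu (patch_tangent y' Uu)).
  exact: (commutator_comm erefl _ (patch_tangent x' Uu) (normal_tangent Uu)).
have tX := patch_tangent x Uu; have tY := patch_tangent y Uu.
have tAX := patch_tangent (Defs.shape F N u x) Uu; have tAY := patch_tangent (Defs.shape F N u y) Uu.
have ha := hopf_algebra (patch_idem Uu) (patch_adj Uu) (normal_tangent Uu) erefl tX tY tAX tAY.
have JA : g (gJ (F u) (dmx F u (Defs.shape F N u y))) (dmx F u x) =
  - g (gJ (F u) (dmx F u x)) (dmx F u (Defs.shape F N u y)).
  exact: (etrans (gmetric_J _ _ _) (congr1 -%R (gmetricC _ _))).
have ha2 : g (dmx N u y) (dmx reeb u x) - g (dmx N u x) (dmx reeb u y) =
    - 2 * g (gJ (F u) (dmx F u (Defs.shape F N u x))) (dmx F u (Defs.shape F N u y)) +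
    2 * g (gJ (F u) (N u *m N u *m dmx F u x + dmx F u x *m N u *m N u)) (dmx F u y).
  rewrite (normal_derivativeE y Uu) (normal_derivativeE x Uu).
  rewrite (reeb_derivativeE x Uu) (reeb_derivativeE y Uu).
  exact: ha.
move: kx ky; rewrite x0 y0 => kx ky.
exact: (antisymmetrize kx ky eN eF ha2 (etrans (rX y x) JA) (rX x y)).
Qed.

End Hopf.

(** * Passage to coordinates in the orthonormal frame *)

Definition crd u x : 'rV[R]_d := \row_j met u x (e j u).

Lemma crdD u x y : U u -> crd u (x + y) = crd u x + crd u y.
Proof. by move=> Uu; apply/rowP => j; rewrite !mxE (metDl _ _ _ Uu). Qed.
Lemma crdZ u (r : R) x : U u -> crd u (r *: x) = r *: crd u x.
Proof. by move=> Uu; apply/rowP => j; rewrite !mxE (metZl _ _ _ Uu). Qed.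
Lemma crdN u x : U u -> crd u (- x) = - crd u x.
Proof. by move=> Uu; apply/rowP => j; rewrite !mxE (metNl _ _ Uu). Qed.
Lemma crdB u x y : U u -> crd u (x - y) = crd u x - crd u y.
Proof. by move=> Uu; rewrite (crdD _ _ Uu) (crdN _ Uu). Qed.

Lemma crd_surj u (c : 'rV[R]_d) : U u -> exists x, crd u x = c.
Proof.
move=> Uu; exists (\sum_i c 0 i *: e i u); apply/rowP => j; rewrite mxE (met_suml _ _ Uu).
rewrite (bigD1 j) //= big1 => [|i ij]; rewrite (metZl _ _ _ Uu) [met u _ _](frame_on _ _ Uu).
  by rewrite eqxx mulr1 addr0.
by rewrite (negPf ij) mulr0.
Qed.

Lemma met_crd u x y : U u -> met u x y = (crd u x *m (crd u y)^T) 0 0.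
Proof.
move=> Uu; rewrite {1}(vec_expand x Uu) (met_suml _ _ Uu) mxE; apply: eq_bigr => i _.
by rewrite (metZl _ _ _ Uu) !mxE [met u (e i u) y]metC.
Qed.

Lemma crd_linear u x (f : 'M[R[i]]_(m + 2) -> 'M[R[i]]_(m + 2)) :
  (forall V W, f (V + W) = f V + f W) -> (forall r V, f (r%:C *: V) = r%:C *: f V) -> U u ->
  \row_j g (f (dmx F u x)) (E u j) = crd u x *m frame_mx g (E u) f.
Proof.
move=> fD fZ Uu; have f0 : f 0 = 0 by have := fZ 0 0; rewrite rmorph0 !scale0r.
apply/rowP => j; rewrite mxE (dF_expand x Uu) (big_morph f fD f0) gmetric_suml mxE.
by apply: eq_bigr => i _; rewrite fZ gmetricZl !mxE.
Qed.

Lemma crd_phi u x : U u -> crd u (phi F u x) = crd u x *m frame_mx g (E u) (gJ (F u)).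
Proof.
move=> Uu; rewrite -(crd_linear x (f := gJ (F u)) _ _ Uu) => [|V W|r V].
- by apply/rowP => j; rewrite !mxE (met_tangential _ _ Uu).
- exact: gJD.
- by rewrite /gJ -scalemxAl -scalemxAr -scalerBr !scalerA mulrC.
Qed.

Definition shape_mx u : 'M[R]_d := \matrix_(i, j) h u (e i u) (e j u).

Lemma shape_mxE u i j : shape_mx u i j = h u (e i u) (e j u). Proof. by rewrite mxE. Qed.
Lemma crdE u x j : crd u x 0 j = met u x (e j u). Proof. by rewrite mxE. Qed.

Lemma shape_mx_sym u : U u -> (shape_mx u)^T = shape_mx u.
Proof. by move=> Uu; apply/matrixP => i j; rewrite mxE 2!shape_mxE; exact: (shapeC _ _ Uu). Qed.

Lemma crd_shape u x : U u -> crd u (Defs.shape F N u x) = crd u x *m shape_mx u.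
Proof.
move=> Uu; apply/rowP => j; rewrite crdE (shapeC _ _ Uu) metC (met_crd _ _ Uu).
rewrite [LHS]mxE [RHS]mxE; apply: eq_bigr => i _.
congr (_ * _); rewrite [LHS]mxE crdE shape_mxE; exact: (shapeC _ _ Uu).
Qed.

Lemma crd_xi u : U u -> crd u (xi F N u) = frame_row g (E u) (- gJ (F u) (N u)).
Proof. by move=> Uu; apply/rowP => j; rewrite crdE (met_tangential _ _ Uu) [RHS]mxE. Qed.

Definition ricci_mx u : 'M[R]_d :=
  (4 * m%:R + 8)%:M - frame_mx g (E u) (fun V => N u *m N u *m V + V *m N u *m N u)
  + 2 *: frame_mx g (E u) (fun V => N u *m V *m N u)
  + \tr (shape_mx u) *: shape_mx u - shape_mx u *m shape_mx u.

Lemma crd_T u x : U u ->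
  \row_j g (N u *m N u *m dmx F u x + dmx F u x *m N u *m N u) (E u j) =
  crd u x *m frame_mx g (E u) (fun V => N u *m N u *m V + V *m N u *m N u).
Proof.
apply: crd_linear => [V W|r V]; last by rewrite -!scalemxAl -scalemxAr scalerDr.
by rewrite mulmxDr !mulmxDl addrACA.
Qed.

Lemma crd_L u x : U u ->
  \row_j g (N u *m dmx F u x *m N u) (E u j) =
  crd u x *m frame_mx g (E u) (fun V => N u *m V *m N u).
Proof.
by apply: crd_linear => [V W|r V]; rewrite ?mulmxDr ?mulmxDl // -scalemxAr -scalemxAl.
Qed.

(** In particular [ricci F e X u] depends on [X] only through [X u], so the condition on vector
    fields can be tested at one point. *)
Lemma crd_ricci X u : smooth_on U X -> U u -> crd u (ricci F e X u) = crd u (X u) *m ricci_mx u.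
Proof.
move=> sX Uu; set c := crd u (X u).
have -> : c *m ricci_mx u = (4 * m%:R + 8) *: c
  - c *m frame_mx g (E u) (fun V => N u *m N u *m V + V *m N u *m N u)
  + 2 *: (c *m frame_mx g (E u) (fun V => N u *m V *m N u))
  + \tr (shape_mx u) *: (c *m shape_mx u) - c *m shape_mx u *m shape_mx u.
  by rewrite /ricci_mx row_mul_comb.
rewrite /c -(crd_T (X u) Uu) -(crd_L (X u) Uu) -(crd_shape (X u) Uu); apply/rowP => j.
have -> : (crd u (Defs.shape F N u (X u)) *m shape_mx u) = \row_j \sum_i h u (X u) (e i u) * h u (e i u) (e j u).
  apply/rowP => k; rewrite [LHS]mxE [RHS]mxE; apply: eq_bigr => i _.
  by rewrite crdE shape_mxE.
have tr : \tr (shape_mx u) = \sum_i h u (e i u) (e i u) by apply: eq_bigr => i _; exact: shape_mxE.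
rewrite mxE (met_ricci (e j u) sX Uu) tr.
have ar (a b c' t l : R) : a - b + (c' - t + 2 * l) = c' - t + 2 * l + a - b by ring.
rewrite row_combE [X in _ = _ - X]mxE.
rewrite [(\row_j g (N u *m N u *m _ + _) _) 0 j]mxE [(\row_j g (N u *m _ *m N u) _) 0 j]mxE.
rewrite !crdE; exact: ar.
Qed.

Lemma crd_outer u x y : U u -> (crd u x *m (crd u y)^T) 0 0 = met u x y.
Proof. by move=> Uu; rewrite (met_crd x y Uu). Qed.

(** The difference of the two connections; it is a tensor, hence takes vectors instead of fields. *)
Definition gtw_diff k u x y :=
  met u (phi F u (Defs.shape F N u x)) y *: xi F N u - eta F N u y *: phi F u (Defs.shape F N u x)
  - (k * eta F N u x) *: phi F u y.

Lemma gtwE k X Y u : gtw F N k X Y u = nabla F X Y u + gtw_diff k u (X u) (Y u).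
Proof. by rewrite /gtw_diff !addrA. Qed.

Lemma crd_gtw_diff k u x y : U u ->
  crd u (gtw_diff k u x y) =
  (crd u x *m shape_mx u *m frame_mx g (E u) (gJ (F u)) *m (crd u y)^T) 0 0 *: crd u (xi F N u)
  - (crd u y *m (crd u (xi F N u))^T) 0 0 *: (crd u x *m shape_mx u *m frame_mx g (E u) (gJ (F u)))
  - (k * (crd u x *m (crd u (xi F N u))^T) 0 0) *: (crd u y *m frame_mx g (E u) (gJ (F u))).
Proof.
move=> Uu; set Phi := frame_mx g (E u) (gJ (F u)).
have comb (p q r : R) a b c : crd u (p *: a - q *: b - r *: c) = p *: crd u a - q *: crd u b - r *: crd u c.
  by rewrite !(crdB _ _ Uu) !(crdZ _ _ Uu).
have cg (p p' q q' r r' : R) (a b b' c c' : 'rV[R]_d) : p = p' -> q = q' -> r = r' -> b = b' -> c = c' ->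
  p *: a - q *: b - r *: c = p' *: a - q' *: b' - r' *: c' by move=> -> -> -> -> ->.
have eA : crd u (phi F u (Defs.shape F N u x)) = crd u x *m shape_mx u *m Phi.
  exact: (etrans (crd_phi _ Uu) (congr1 (fun v => v *m Phi) (crd_shape x Uu))).
have eAy : met u (phi F u (Defs.shape F N u x)) y = (crd u x *m shape_mx u *m Phi *m (crd u y)^T) 0 0.
  exact: (etrans (met_crd _ _ Uu) (congr1 (fun v => (v *m (crd u y)^T) 0 0) eA)).
apply: (etrans (comb _ _ _ _ _ _)).
exact: (cg _ _ _ _ _ _ _ _ _ _ _ eAy (met_crd y _ Uu) (congr1 (fun t => k * t) (met_crd x _ Uu)) eA
  (crd_phi y Uu)).
Qed.

(** Both the Ricci operator and the difference of the connections are tensorial, so fields constant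
    in the chart carry the whole condition, and every pair of rows arises from such fields. *)
Lemma gtw_row_condition k u (c c' : 'rV[R]_d) : U u ->
  (forall x y, cov_op (gtw F N k) (ricci F e) (fun=> x) (fun=> y) u =
               cov_op (nabla F) (ricci F e) (fun=> x) (fun=> y) u) ->
  let A := shape_mx u in let Phi := frame_mx g (E u) (gJ (F u)) in
  let xi := frame_row g (E u) (- gJ (F u) (N u)) in let S := ricci_mx u in
  (c *m A *m Phi *m (c' *m S)^T) 0 0 *: xi - (c' *m S *m xi^T) 0 0 *: (c *m A *m Phi)
    - (k * (c *m xi^T) 0 0) *: (c' *m S *m Phi) =
  (c *m A *m Phi *m c'^T) 0 0 *: (xi *m S) - (c' *m xi^T) 0 0 *: (c *m A *m Phi *m S)
    - (k * (c *m xi^T) 0 0) *: (c' *m Phi *m S).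
Proof.
move=> Uu cond /=; have [x <-] := crd_surj c Uu; have [y <-] := crd_surj c' Uu.
have sx := smooth_row_cst Uo x; have sy := smooth_row_cst Uo y.
rewrite -(crd_xi Uu).
have comb D D' : crd u (D - D') = crd u D - crd u D' := crdB _ _ Uu.
have eS := crd_ricci sy Uu.
have eG X Y : crd u (gtw F N k X Y u) = crd u (nabla F X Y u) + crd u (gtw_diff k u (X u) (Y u)).
  by rewrite gtwE (crdD _ _ Uu).
have e1 := etrans (eG (fun=> x) (ricci F e (fun=> y)))
  (congr1 (fun v => _ + v) (crd_gtw_diff k x (ricci F e (fun=> y) u) Uu)).
rewrite eS in e1.
have e2 := etrans (crd_ricci (smooth_gtw k sx sy) Uu) (congr1 (fun v => v *m ricci_mx u)
  (etrans (eG (fun=> x) (fun=> y)) (congr1 (fun v => _ + v) (crd_gtw_diff k x y Uu)))).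
have e3 := crd_ricci (smooth_nabla sx sy) Uu.
have e4 := etrans (esym (comb _ _)) (etrans (congr1 (crd u) (cond x y)) (comb _ _)).
have cg (v1 v1' v2 v2' v3 v3' : 'rV[R]_d) : v1 = v1' -> v2 = v2' -> v3 = v3' ->
    forall t, v1 - v2 = t - v3 -> v1' - v2' = t - v3'.
  by move=> -> -> ->.
exact: row_condition (cg _ _ _ _ _ _ e1 e2 e3 _ e4).
Qed.

Lemma crd_tangential u V : U u -> crd u (tangential F u V) = \row_j g V (E u j).
Proof. by move=> Uu; apply/rowP => j; rewrite crdE (met_tangential _ _ Uu) [RHS]mxE. Qed.

Lemma hopf_row_condition u x y : U u ->
  (forall w, U w -> Defs.shape F N w (xi F N w) = h w (xi F N w) (xi F N w) *: xi F N w) ->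
  met u x (xi F N u) = 0 -> met u y (xi F N u) = 0 ->
  let A := shape_mx u in let Phi := frame_mx g (E u) (gJ (F u)) in
  let T := frame_mx g (E u) (fun V => N u *m N u *m V + V *m N u *m N u) in
  (crd u x *m (A *m Phi *m A - (h u (xi F N u) (xi F N u) / 2) *: (A *m Phi + Phi *m A) - T *m Phi)
    *m (crd u y)^T) 0 0 = 0.
Proof.
move=> Uu hopf mx my A Phi T; have eq := hopf_equation hopf Uu mx my.
pose V := N u *m N u *m dmx F u x + dmx F u x *m N u *m N u.
have phiE x' y' : (crd u x' *m Phi *m (crd u y')^T) 0 0 = g (gJ (F u) (dmx F u x')) (dmx F u y').
  by rewrite -(crd_phi x' Uu) (crd_outer _ _ Uu) (met_tangential _ _ Uu).
have cx := crd_shape x Uu; have cy := crd_shape y Uu.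
have e1 : (crd u x *m A *m Phi *m A *m (crd u y)^T) 0 0 =
    g (gJ (F u) (dmx F u (Defs.shape F N u x))) (dmx F u (Defs.shape F N u y)).
  rewrite (mulmx_sym_tr _ _ (shape_mx_sym Uu)).
  exact: (etrans (congr2 (fun v v' => (v *m Phi *m v'^T) 0 0) (esym cx) (esym cy)) (phiE _ _)).
have e2 : (crd u x *m A *m Phi *m (crd u y)^T) 0 0 = g (gJ (F u) (dmx F u (Defs.shape F N u x))) (dmx F u y).
  exact: (etrans (congr1 (fun v => (v *m Phi *m (crd u y)^T) 0 0) (esym cx)) (phiE _ _)).
have e3 : (crd u x *m Phi *m A *m (crd u y)^T) 0 0 = g (gJ (F u) (dmx F u x)) (dmx F u (Defs.shape F N u y)).
  rewrite (mulmx_sym_tr _ _ (shape_mx_sym Uu)).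
  exact: (etrans (congr1 (fun v => (crd u x *m Phi *m v^T) 0 0) (esym cy)) (phiE _ _)).
have tV : grass2_tangent (F u) V.
  exact: (sqr_anticomm_tangent (Q := 1%:M - F u) erefl (normal_tangent Uu) (patch_tangent x Uu)).
(* [V], which is [T] applied to [x], may have a component along [N] that frame coordinates lose. Its
   contribution is a multiple of [g (J N, y)], which vanishes because [y] is orthogonal to [xi]. *)
have gN0 : g (gJ (F u) (N u)) (dmx F u y) = 0.
  apply: oppr_inj; rewrite oppr0 -gmetricNl.
  exact: (etrans (congr1 (fun V' => g V' (dmx F u y)) (esym (dF_xi Uu))) (etrans (metC _ _ _) my)).
have e4 : (crd u x *m T *m Phi *m (crd u y)^T) 0 0 = g (gJ (F u) V) (dmx F u y).
  rewrite -(crd_T x Uu) -(crd_tangential V Uu) phiE (dF_tangential V Uu).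
  rewrite {2}(frm tangent_expand Uu tV) gJD gmetricDl gJ_scale gmetricZl.
  have drop (a t b : R) : t = 0 -> b = a * t + b by move=> ->; rewrite mulr0 add0r.
  exact: (drop _ _ _ gN0).
have fin (t1 t2 t3 t4 g1 g2 g3 g4 r : R) : t1 = g1 -> t4 = g4 -> t2 = g2 -> t3 = g3 ->
    g1 - g4 = r * (g2 + g3) -> t1 - t4 - r * (t2 + t3) = 0.
  by move=> -> -> -> -> ->; rewrite subrr.
exact: (etrans (hopf_row_expand _ _ _ _ _ _) (fin _ _ _ _ _ _ _ _ _ e1 e4 e2 e3 eq)).
Qed.

(** The Hopf condition is assumed on all of [U] because it gets differentiated; the condition on the
    connections enters at [u] alone. *)
Lemma patch_absurd k u : U u -> (3 <= m)%N -> k != 0 ->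
  (forall w, U w -> Defs.shape F N w (xi F N w) = h w (xi F N w) (xi F N w) *: xi F N w) ->
  (forall x y, cov_op (gtw F N k) (ricci F e) (fun=> x) (fun=> y) u =
               cov_op (nabla F) (ricci F e) (fun=> x) (fun=> y) u) -> False.
Proof.
move=> Uu m3 k0 hopf cond.
have xiE := crd_xi Uu.
have absurd := frm pointwise_absurd Uu.
refine (absurd (shape_mx u) k (h u (xi F N u) (xi F N u)) m3 k0 (shape_mx_sym Uu) _ _ _).
- rewrite -xiE -(crd_shape _ Uu) -(crdZ _ _ Uu); exact: (congr1 (crd u) (hopf u Uu)).
- by move=> c c'; exact: (gtw_row_condition c c' Uu cond).
move=> c c'; have [x <-] := crd_surj c Uu; have [y <-] := crd_surj c' Uu.
rewrite -xiE => mx my; apply/matrixP => a b; rewrite !ord1 {a b} [RHS]mxE.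
have x0 : met u x (xi F N u) = 0 by rewrite (met_crd _ _ Uu) mx mxE.
have y0 : met u y (xi F N u) = 0 by rewrite (met_crd _ _ Uu) my mxE.
exact: (hopf_row_condition Uu hopf x0 y0).
Qed.

End Patch.

Theorem corollary2 (R : realType) (m : nat) (k : R) (hm : (3 <= m)%N)
    (hk : k != 0) :
  ~ exists (M : hypersurface R m)
      (N : chart_index M -> 'rV[R]_(hdim m) -> 'M[R[i]]_(m + 2))
      (e : chart_index M -> 'I_(hdim m) -> 'rV[R]_(hdim m) -> 'rV[R]_(hdim m)),
    [/\ local_normals N, local_frames e, hopf N & ricci_gtw_eq_lc k N e].
Proof.
move=> [M [N [e [hN he hH hS]]]].
(* One arbitrary point in one arbitrary chart around it is enough. *)
have [p _] := @carrier_nonempty _ _ M; have [c pc] := dom_cover p.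
have Uu := coord_img pc; set u := Defs.coord c p in Uu.
(* [hdim m] is a natural number predecessor, so the equality rests on [0 < m]. *)
have dm : (hdim m).+1 = (4 * m)%N.
  by rewrite /hdim prednK // muln_gt0 (leq_trans _ hm).
have Uo := @img_open _ _ M c.
have grF w : Defs.img c w -> grass2 (Defs.patch c w) by move=> _; exact: immersion_grass.
apply: (patch_absurd Uo grF (immersion_smooth c) (@immersion_inj _ _ M c) (hN c) (he c) dm Uu hm hk (hH c)).
by move=> x y; apply: (hS c (fun=> x) (fun=> y)) => //; apply: smooth_row_cst.
Qed.
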